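(* Let $k$ be a field of characteristic $0$. Let $A$ be a Poisson algebra over $k$ which is a complete Noetherian local ring with residue field $k$ and maximal ideal $\mathfrak{m}\subset A$, and let $J\subset A$ be a prime Poisson ideal such that the quotient $A/J$ is a regular complete local algebra with non-degenerate Poisson structure. Then there exists a complete local Poisson algebra $B$ and a Poisson isomorphism $$A\cong B\,\widehat{\otimes}_k\,(A/J)$$ between the algebra $A$ and the completed tensor product of the algebras $A/J$ and $B$. Moreover, the Poisson scheme $\operatorname{Spec}A$ is holonomic if and only if the Poisson scheme $\operatorname{Spec}B$ is holonomic, and the Poisson algebra $A$ is exact if and only if the Poisson algebra $B$ is exact.
   Context: Poisson algebra: a commutative unital $k$-algebra $A$ with a skew-symmetric $k$-bilinear bracket $\{-,-\}$ satisfying $\{a,bc\}=\{a,b\}c+\{a,c\}b$, the Jacobi identity, and $\{1,a\}=0$. An ideal $I$ is Poisson if $\{I,A\}\subset I$. A Poisson subscheme of $\operatorname{Spec}A$ is a closed subscheme defined by a Poisson ideal. The bracket has the form $\{f,g\}=\Theta(df\wedge dg)$ for a skew-symmetric bilinear form $\Theta$ on differentials (the Poisson bivector); for complete local algebras, differentials are understood as continuous differentials. The Poisson structure on a regular complete local algebra is non-degenerate if $\Theta$ is a non-degenerate form on its (free) module of differentials. The tensor product of Poisson algebras carries the bracket $\{b\otimes a,b'\otimes a'\}=\{b,b'\}\otimes aa'+bb'\otimes\{a,a'\}$, extended to the completion by continuity. A Noetherian integral Poisson scheme $X$ with generic point $\eta$ is generically non-degenerate if $\Theta$ gives a non-degenerate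 skew-symmetric form on the module of differentials at $\eta$ over $k$; it is holonomic if every integral Poisson subscheme of $X$ is generically non-degenerate (in particular, $X$ itself is integral). A Poisson algebra $A$ is exact if there is a derivation $\xi:A\to A$ with $\xi(\{a,b\})=\{a,b\}+\{\xi(a),b\}+\{a,\xi(b)\}$ for all $a,b\in A$. *)

(* Defs.v *)
From HB Require Import structures.
From mathcomp Require Import all_boot all_algebra.
From mathcomp Require Import boolp classical_sets functions.
From mathcomp Require Import ring.

Set Implicit Arguments.
Unset Strict Implicit.
Unset Printing Implicit Defensive.

Import GRing.Theory.


Local Open Scope classical_set_scope.
Local Open Scope ring_scope.
Local Open Scope quotient_scope.

HB.mixin Record isPoisson (k : fieldType) A of GRing.ComAlgebra k A := {
  poisson : A -> A -> A;
  poisson_linear_subproof : forall a : A, linear (poisson a);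
  poissonC : forall a b : A, poisson a b = - poisson b a;
  poissonMr : forall a b c : A,
    poisson a (b * c) = poisson a b * c + poisson a c * b;
  poisson_jacobi : forall a b c : A,
    poisson a (poisson b c) + poisson b (poisson c a)
      + poisson c (poisson a b) = 0;
  poisson1l : forall a : A, poisson 1 a = 0
}.

#[short(type="poissonAlgType")]
HB.structure Definition PoissonAlgebra (k : fieldType) :=
  { A of GRing.ComAlgebra k A & isPoisson k A }.

Notation "{[ a , b ]}" := (poisson a b)
  (at level 0, a, b at level 99, format "{[ a ,  b ]}") : ring_scope.

HB.mixin Record isPoissonIdeal (k : fieldType) (A : poissonAlgType k)
    (I : A -> bool) := {
  poisson_ideal_subproof : {in I, forall u, forall a : A, {[u, a]} \in I}
}.

#[short(type="poissonIdeal")]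
HB.structure Definition PoissonIdeal (k : fieldType) (A : poissonAlgType k) :=
  { I of Idealr A I & isPoissonIdeal k A I }.

#[short(type="primePoissonIdeal")]
HB.structure Definition PrimePoissonIdeal (k : fieldType)
    (A : poissonAlgType k) :=
  { I of PrimeIdealr A I & isPoissonIdeal k A I }.

Section PoissonTheory.
Variables (k : fieldType) (A : poissonAlgType k).
Implicit Types a b c : A.

HB.instance Definition _ a :=
  GRing.isLinear.Build k A A _ (poisson a) (poisson_linear_subproof a).

Lemma poissonDr a b c : {[a, b + c]} = {[a, b]} + {[a, c]}.
Proof. exact: raddfD. Qed.
Lemma poissonNr a b : {[a, - b]} = - {[a, b]}.
Proof. exact: raddfN. Qed.
Lemma poissonZr (l : k) a b : {[a, l *: b]} = l *: {[a, b]}.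
Proof. exact: linearZ. Qed.
Lemma poisson0r a : {[a, 0]} = 0. Proof. exact: raddf0. Qed.
Lemma poissonDl a b c : {[b + c, a]} = {[b, a]} + {[c, a]}.
Proof. by rewrite poissonC poissonDr opprD -!(poissonC _ a). Qed.
Lemma poissonNl a b : {[- a, b]} = - {[a, b]}.
Proof. by rewrite poissonC poissonNr -poissonC. Qed.
Lemma poissonZl (l : k) a b : {[l *: a, b]} = l *: {[a, b]}.
Proof. by rewrite poissonC poissonZr -scalerN -poissonC. Qed.
Lemma poisson0l a : {[0, a]} = 0.
Proof. by rewrite poissonC poisson0r oppr0. Qed.
Lemma poissonMl a b c : {[b * c, a]} = {[b, a]} * c + {[c, a]} * b.
Proof. by rewrite poissonC poissonMr opprD -!mulNr -!(poissonC _ a). Qed.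
Lemma poissonBr a b c : {[a, b - c]} = {[a, b]} - {[a, c]}.
Proof. exact: raddfB. Qed.
Lemma poissonBl a b c : {[b - c, a]} = {[b, a]} - {[c, a]}.
Proof. by rewrite poissonDl poissonNl. Qed.
Lemma poisson1r a : {[a, 1]} = 0.
Proof. by rewrite poissonC poisson1l oppr0. Qed.

Lemma poisson_suml (I : Type) (r : seq I) (F : I -> A) a :
  {[\sum_(i <- r) F i, a]} = \sum_(i <- r) {[F i, a]}.
Proof.
elim: r => [|i r IH]; first by rewrite !big_nil poisson0l.
by rewrite !big_cons poissonDl IH.
Qed.

End PoissonTheory.

Section PoissonQuotient.
Variables (k : fieldType) (A : poissonAlgType k) (J : poissonIdeal A).

Definition poisson_quot : Type := {ideal_quot J}.

HB.instance Definition _ := GRing.ComNzRing.copy poisson_quot {ideal_quot J}.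

Definition quot_pi (a : A) : poisson_quot := \pi_{ideal_quot J} a.
Local Notation pi := quot_pi.
Definition quot_repr (x : poisson_quot) : A := repr (x : {ideal_quot J}).

Lemma quot_reprK : cancel quot_repr pi.
Proof. by move=> x; rewrite /pi /quot_repr reprK. Qed.

Lemma quot_piE a b : (pi a == pi b) = (a - b \in J).
Proof. by rewrite Quotient.idealrBE. Qed.

Lemma quot_pi_eq a b : a - b \in J -> pi a = pi b.
Proof. by move=> h; apply/eqP; rewrite quot_piE. Qed.

Lemma quot_reprB a : quot_repr (pi a) - a \in J.
Proof. by rewrite -quot_piE quot_reprK. Qed.

Lemma quot_piD : {morph pi : a b / a + b}.
Proof. exact: (rmorphD (\pi_{ideal_quot J})). Qed.
Lemma quot_piM : {morph pi : a b / a * b}.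
Proof. exact: (rmorphM (\pi_{ideal_quot J})). Qed.
Lemma quot_pi1 : pi 1 = 1.
Proof. exact: (rmorph1 (\pi_{ideal_quot J})). Qed.
Lemma quot_piN : {morph pi : a / - a}.
Proof. exact: (rmorphN (\pi_{ideal_quot J})). Qed.
Lemma quot_pi0 : pi 0 = 0.
Proof. exact: (rmorph0 (\pi_{ideal_quot J})). Qed.

Lemma idealrZ (l : k) u : u \in J -> l *: u \in J.
Proof. by move=> uJ; rewrite -mulr_algl idealMr. Qed.

Definition quot_scale (l : k) (x : poisson_quot) : poisson_quot :=
  pi (l *: quot_repr x).

Lemma quot_scaleE l a : quot_scale l (pi a) = pi (l *: a).
Proof. by apply: quot_pi_eq; rewrite -scalerBr idealrZ ?quot_reprB. Qed.

Lemma quot_ind (P : poisson_quot -> Prop) : (forall a, P (pi a)) -> forall x, P x.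
Proof. by move=> h x; rewrite -[x]quot_reprK. Qed.

Fact quot_scalerA a b v : quot_scale a (quot_scale b v) = quot_scale (a * b) v.
Proof. by elim/quot_ind: v => v; rewrite !quot_scaleE scalerA. Qed.
Fact quot_scale1r : left_id 1 quot_scale.
Proof. by elim/quot_ind => v; rewrite !quot_scaleE scale1r. Qed.
Fact quot_scalerDr : right_distributive quot_scale +%R.
Proof.
move=> l; elim/quot_ind => u; elim/quot_ind => v.
by rewrite -quot_piD !quot_scaleE scalerDr quot_piD.
Qed.
Fact quot_scalerDl v : {morph quot_scale^~ v: a b / a + b}.
Proof.
by move=> a b; elim/quot_ind: v => v; rewrite !quot_scaleE scalerDl quot_piD.
Qed.
HB.instance Definition _ := GRing.Zmodule_isLmodule.Build k poisson_quot
  quot_scalerA quot_scale1r quot_scalerDr quot_scalerDl.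

Lemma quot_piZ (l : k) a : pi (l *: a) = l *: pi a.
Proof. by rewrite -quot_scaleE. Qed.

Fact quot_scalerAl (l : k) (u v : poisson_quot) : l *: (u * v) = (l *: u) * v.
Proof.
elim/quot_ind: u => u; elim/quot_ind: v => v.
by rewrite -quot_piM -!quot_piZ -quot_piM scalerAl.
Qed.
HB.instance Definition _ :=
  GRing.Lmodule_isLalgebra.Build k poisson_quot quot_scalerAl.
HB.instance Definition _ := GRing.Lalgebra_isComAlgebra.Build k poisson_quot.

Definition quot_poisson (x y : poisson_quot) : poisson_quot :=
  pi {[quot_repr x, quot_repr y]}.

Lemma poisson_idealr u a : u \in J -> {[u, a]} \in J.
Proof. by move=> /(@poisson_ideal_subproof _ _ J) ->. Qed.

Lemma quot_poissonE a b : quot_poisson (pi a) (pi b) = pi {[a, b]}.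
Proof.
apply: quot_pi_eq; set a' := quot_repr _; set b' := quot_repr _.
have -> : {[a', b']} - {[a, b]} = {[a' - a, b']} - {[b' - b, a]}.
  rewrite !poissonBl (poissonC b' a) (poissonC b a) opprK.
  by rewrite opprD opprK addrA subrK.
by rewrite rpredB ?poisson_idealr ?quot_reprB.
Qed.

Fact quot_poisson_linear x : linear (quot_poisson x).
Proof.
elim/quot_ind: x => x l; elim/quot_ind => u; elim/quot_ind => v.
rewrite -quot_piZ -quot_piD !quot_poissonE -quot_piZ -quot_piD.
by rewrite poissonDr poissonZr.
Qed.
Fact quot_poissonC a b : quot_poisson a b = - quot_poisson b a.
Proof.
by elim/quot_ind: a => a; elim/quot_ind: b => b; rewrite !quot_poissonE poissonC
  quot_piN.
Qed.
Fact quot_poissonMr a b c :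
  quot_poisson a (b * c) = quot_poisson a b * c + quot_poisson a c * b.
Proof.
elim/quot_ind: a => a; elim/quot_ind: b => b; elim/quot_ind: c => c.
by rewrite -quot_piM !quot_poissonE -!quot_piM -quot_piD poissonMr.
Qed.
Fact quot_poisson_jacobi a b c : quot_poisson a (quot_poisson b c)
  + quot_poisson b (quot_poisson c a) + quot_poisson c (quot_poisson a b) = 0.
Proof.
elim/quot_ind: a => a; elim/quot_ind: b => b; elim/quot_ind: c => c.
by rewrite !quot_poissonE -!quot_piD poisson_jacobi quot_pi0.
Qed.
Fact quot_poisson1l a : quot_poisson 1 a = 0.
Proof.
by elim/quot_ind: a => a; rewrite -quot_pi1 quot_poissonE poisson1l quot_pi0.
Qed.
HB.instance Definition _ := isPoisson.Build k poisson_quot quot_poisson_linear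
  quot_poissonC quot_poissonMr quot_poisson_jacobi quot_poisson1l.

Lemma quot_pi_poisson : {morph pi : a b / {[a, b]}}.
Proof. by move=> a b; rewrite -quot_poissonE. Qed.

End PoissonQuotient.

(* The S-module generated by X, modulo exactly those linear relations that
   hold under every map f : X -> V with [adm f].  When [adm] is a set of
   linear equations on the values of f, these are the consequences of the
   equations, so that the map [mgen : X -> umod adm] satisfies [adm] and is
   universal for it; [mlift f] is the unique linear extension of f.  Tensor
   products, Kaehler differentials and base change are the instances where
   [adm] says bilinear, derivation and semilinear. *)
Section UniversalModule.
Variables (S : comNzRingType) (X : choiceType).
Variable adm : forall V : lmodType S, (X -> V) -> Prop.

Definition fsum := seq (S * X).

Definition feval (V : lmodType S) (f : X -> V) (s : fsum) : V :=
  \sum_(p <- s) p.1 *: f p.2.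

Definition feq (s t : fsum) : bool :=
  `[< forall (V : lmodType S) (f : X -> V), adm f -> feval f s = feval f t >].

Fact feq_refl : reflexive feq. Proof. by move=> s; apply/asboolP. Qed.
Fact feq_sym : symmetric feq.
Proof. by move=> s t; apply/asboolP/asboolP => h V f /h. Qed.
Fact feq_trans : transitive feq.
Proof.
by move=> t s u /asboolP h /asboolP h'; apply/asboolP => V f af; rewrite h ?h'.
Qed.
Canonical feq_equiv := EquivRel feq feq_refl feq_sym feq_trans.

Definition umod : Type := {eq_quot feq}.
HB.instance Definition _ := Choice.copy umod {eq_quot feq}.

Definition umod_pi (s : fsum) : umod := \pi_{eq_quot feq} s.
Definition umod_repr (x : umod) : fsum := repr (x : {eq_quot feq}).
Local Notation pi := umod_pi.

Lemma umod_reprK : cancel umod_repr pi.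
Proof. by move=> x; rewrite /pi /umod_repr reprK. Qed.

Lemma umod_piP s t : pi s = pi t <->
  (forall (V : lmodType S) (f : X -> V), adm f -> feval f s = feval f t).
Proof.
split=> [/eqP|h].
  by rewrite /pi -[_ == _]/(\pi_{eq_quot feq} s == \pi_{eq_quot feq} t) eqmodE
    => /asboolP.
by apply/eqP; rewrite -[_ == _]/(\pi_{eq_quot feq} s == \pi_{eq_quot feq} t)
  eqmodE; apply/asboolP.
Qed.

Definition mlift (V : lmodType S) (f : X -> V) (x : umod) : V :=
  feval f (umod_repr x).

Lemma mlift_pi (V : lmodType S) (f : X -> V) s :
  adm f -> mlift f (pi s) = feval f s.
Proof. by move=> af; move/umod_piP: (umod_reprK (pi s)) => /(_ V f af). Qed.

Lemma umod_ext x y :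
  (forall (V : lmodType S) (f : X -> V), adm f -> mlift f x = mlift f y) -> x = y.
Proof. by move=> h; rewrite -[x]umod_reprK -[y]umod_reprK; apply/umod_piP. Qed.

Definition fscale (a : S) (s : fsum) : fsum := [seq (a * p.1, p.2) | p <- s].

Definition umod_zero : umod := pi [::].
Definition umod_add (x y : umod) : umod := pi (umod_repr x ++ umod_repr y).
Definition umod_scale (a : S) (x : umod) : umod := pi (fscale a (umod_repr x)).
Definition umod_opp (x : umod) : umod := umod_scale (-1) x.

Section Lift.
Variables (V : lmodType S) (f : X -> V).
Hypothesis af : adm f.

Fact mlift0 : mlift f umod_zero = 0.
Proof. by rewrite mlift_pi // /feval big_nil. Qed.
Fact mliftD x y : mlift f (umod_add x y) = mlift f x + mlift f y.
Proof. by rewrite mlift_pi // /feval big_cat. Qed.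
Fact mliftZ a x : mlift f (umod_scale a x) = a *: mlift f x.
Proof.
rewrite mlift_pi // /feval big_map scaler_sumr.
by apply: eq_bigr => p _; rewrite scalerA.
Qed.
Fact mliftN x : mlift f (umod_opp x) = - mlift f x.
Proof. by rewrite mliftZ scaleN1r. Qed.
End Lift.

Fact umod_addA : associative umod_add.
Proof. by move=> x y z; apply: umod_ext => V f af; rewrite !mliftD // addrA. Qed.
Fact umod_addC : commutative umod_add.
Proof. by move=> x y; apply: umod_ext => V f af; rewrite !mliftD // addrC. Qed.
Fact umod_add0 : left_id umod_zero umod_add.
Proof.
by move=> x; apply: umod_ext => V f af; rewrite !mliftD // mlift0 // add0r.
Qed.
Fact umod_addN : left_inverse umod_zero umod_opp umod_add.
Proof.
by move=> x; apply: umod_ext => V f af; rewrite mliftD // mliftN // mlift0 // addNr.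
Qed.
HB.instance Definition _ :=
  GRing.isZmodule.Build umod umod_addA umod_addC umod_add0 umod_addN.

Fact umod_scalerA a b v : umod_scale a (umod_scale b v) = umod_scale (a * b) v.
Proof. by apply: umod_ext => V f af; rewrite !mliftZ // scalerA. Qed.
Fact umod_scale1r : left_id 1 umod_scale.
Proof. by move=> v; apply: umod_ext => V f af; rewrite mliftZ // scale1r. Qed.
Fact umod_scalerDr : right_distributive umod_scale +%R.
Proof.
move=> a u v; apply: umod_ext => V f af.
by rewrite mliftZ // !mliftD // !mliftZ // scalerDr.
Qed.
Fact umod_scalerDl v : {morph umod_scale^~ v: a b / a + b}.
Proof.
by move=> a b; apply: umod_ext => V f af; rewrite mliftD // !mliftZ // scalerDl.
Qed.
HB.instance Definition _ := GRing.Zmodule_isLmodule.Build S umod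
  umod_scalerA umod_scale1r umod_scalerDr umod_scalerDl.

Definition mgen (x : X) : umod := pi [:: (1, x)].

Lemma mlift_gen (V : lmodType S) (f : X -> V) x :
  adm f -> mlift f (mgen x) = f x.
Proof. by move=> af; rewrite mlift_pi // /feval big_seq1 scale1r. Qed.

Lemma mlift_linear (V : lmodType S) (f : X -> V) : adm f -> linear (mlift f).
Proof. by move=> af a x y; rewrite mliftD // mliftZ. Qed.

Lemma umod_sum x : x = \sum_(p <- umod_repr x) p.1 *: mgen p.2.
Proof.
apply: umod_ext => V f af; rewrite {1}/mlift /feval.
elim: (umod_repr x) => [|p s IH]; first by rewrite !big_nil mlift0.
by rewrite !big_cons mliftD // mliftZ // mlift_gen // IH.
Qed.

End UniversalModule.

Lemma linear_form_sep (k : fieldType) (V : lmodType k) (W : {pred V}) (v : V) :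
  0 \in W -> (forall a, {in W &, forall x y, a *: x + y \in W}) -> v \notin W ->
  exists f : V -> k^o, [/\ linear f, f v = 1 & {in W, forall x, f x = 0}].
Proof.
move=> W0 WD Wv.
pose P (U : set V) := (forall x, U x -> x != v) /\
  forall a x y, (U x \/ x \in W) -> (U y \/ y \in W) -> (U (a *: x + y)).
have WP : P [set` W].
  split=> [x Wx|a x y]; first by apply: contraNneq Wv => <-.
  by move=> [|] Wx [|] Wy; apply: WD.
pose Q (U : set V) := U = set0 \/ P U.
have [F FQ Ftot|U [QU Umax]] := @Zorn_bigcup V Q.
  have [[U0 [FU0 U0n]]|F0] := pselect (exists U, F U /\ U <> set0); last first.
    left; apply/seteqP; split=> // x [U FU Ux]; apply: F0; exists U.
    by split=> // U0; rewrite U0 in Ux.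
  right; split=> [x [U FU Ux]|a x y hx hy].
    by have [U0'|[h _]] := FQ U FU; [rewrite U0' in Ux|exact: h].
  have key U : F U -> (U x \/ x \in W) -> (U y \/ y \in W) -> U <> set0 ->
      (\bigcup_(X in F) X) (a *: x + y).
    move=> FU Ux Uy Un; exists U => //.
    by have [|[_ h]] := FQ U FU => //; apply: h.
  have ne (U : set V) z : U z -> U <> set0 by move=> Uz U0'; rewrite U0' in Uz.
  case: hx => [[U1 FU1 Ux]|Wx]; case: hy => [[U2 FU2 Uy]|Wy].
  - have [s12|s21] := Ftot _ _ FU1 FU2.
      by apply: (key U2) => //; [left; apply: s12|left|exact: ne Uy].
    by apply: (key U1) => //; [left|left; apply: s21|exact: ne Ux].
  - by apply: (key U1) => //; [left|right|exact: ne Ux].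
  - by apply: (key U2) => //; [right|left|exact: ne Uy].
  - by apply: (key U0) => //; right.
have PU : P U.
  case: QU => // U0; exfalso; apply: (Umax [set` W]); last by right.
  by rewrite U0; split=> // /(_ 0 W0).
have [Uv UD] := PU.
have UW x : x \in W -> U x.
  by move=> Wx; have := UD 0 x x (or_intror Wx) (or_intror Wx);
    rewrite scale0r add0r.
have U0 : U 0 by exact: UW.
have Unv : ~ U v by move=> /Uv /eqP.
have UZ a x : U x -> U (a *: x).
  by move=> Ux; rewrite -[_ *: _]addr0; apply: UD; left.
have UA x y : U x -> U y -> U (x + y).
  by move=> Ux Uy; rewrite -[x]scale1r; apply: UD; left.
have ex x : exists c : k, U (x - c *: v).
  apply: contrapT => nx; have nUx : ~ U x.
    by move=> Ux; apply: nx; exists 0; rewrite scale0r subr0.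
  pose U' : set V := fun y => exists c, U (y - c *: x).
  apply: (Umax U').
    split=> [y Uy|/(_ x)]; first by exists 0; rewrite scale0r subr0.
    move=> h; apply: nUx; apply: h; exists 1.
    by rewrite scale1r subrr.
  right; split.
    move=> y [c Uy]; apply/eqP => yv; rewrite {}yv in Uy.
    have [c0|c0] := eqVneq c 0; first by apply: Unv; rewrite c0 scale0r subr0 in Uy.
    apply: nx; exists c^-1; have := UZ (- c^-1) _ Uy.
    by rewrite scalerBr !scaleNr scalerA mulVf // scale1r opprK addrC.
  have UW' z : U' z \/ z \in W -> U' z.
    by case=> // Wz; exists 0; rewrite scale0r subr0; apply: UW.
  move=> a y z /UW'[c Uy] /UW'[d Uz]; exists (a * c + d).
  rewrite scalerDl opprD addrACA -scalerA -scalerBr.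
  by apply: UA => //; apply: UZ.
pose f x := xget 0 [set c : k | U (x - c *: v)].
have fP x : U (x - f x *: v) by rewrite /f; case: xgetP => // /(_ _)/= h; case: (ex x) => c /h.
have fU x c : U (x - c *: v) -> f x = c.
  move=> Ux; apply/eqP; rewrite -subr_eq0; apply/negP => /negP ne; apply: Unv.
  have : U ((f x - c) *: v).
    have -> : (f x - c) *: v = -1 *: (x - f x *: v) + (x - c *: v).
      by rewrite scaleN1r opprB addrA subrK scalerBl.
    by apply: UD; left.
  by move/(UZ (f x - c)^-1); rewrite scalerA mulVf // scale1r.
exists f; split.
- move=> a x y; apply: fU; rewrite scalerDl opprD addrACA -scalerA -scalerBr.
  by apply: UA => //; apply: UZ.
- by apply: fU; rewrite scale1r subrr.
- by move=> x Wx; apply: fU; rewrite scale0r subr0; apply: UW.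
Qed.

Section TensorProduct.
Variables (k : fieldType) (B C : poissonAlgType k).

Definition bilinear_map (V : lmodType k) (f : B * C -> V) : Prop :=
  (forall b, linear (fun c => f (b, c))) /\ (forall c, linear (fun b => f (b, c))).

Definition tensor : Type := umod bilinear_map.
HB.instance Definition _ := GRing.Lmodule.copy tensor (umod bilinear_map).

Definition tens (b : B) (c : C) : tensor := mgen bilinear_map (b, c).

Lemma tens_linearr b : linear (tens b).
Proof.
move=> a x y; apply: umod_ext => V f bf.
by rewrite mlift_linear // !mlift_gen // bf.1.
Qed.
Lemma tens_linearl c : linear (tens ^~ c).
Proof.
move=> a x y; apply: umod_ext => V f bf.
by rewrite mlift_linear // !mlift_gen // bf.2.
Qed.
HB.instance Definition _ b :=
  GRing.isLinear.Build k C tensor _ (tens b) (tens_linearr b).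

Lemma tensDr b x y : tens b (x + y) = tens b x + tens b y.
Proof. exact: raddfD. Qed.
Lemma tensNr b x : tens b (- x) = - tens b x.
Proof. exact: raddfN. Qed.
Lemma tensZr a b x : tens b (a *: x) = a *: tens b x.
Proof. exact: linearZ. Qed.
Lemma tens0r b : tens b 0 = 0. Proof. exact: raddf0. Qed.
Lemma tensDl c x y : tens (x + y) c = tens x c + tens y c.
Proof. by have := tens_linearl c 1 x y; rewrite !scale1r. Qed.
Lemma tens0l c : tens 0 c = 0.
Proof. by apply: (addIr (tens 0 c)); rewrite -tensDl !add0r. Qed.
Lemma tensZl a c x : tens (a *: x) c = a *: tens x c.
Proof. by have := tens_linearl c a x 0; rewrite !addr0 tens0l addr0. Qed.
Lemma tensNl c x : tens (- x) c = - tens x c.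
Proof. by rewrite -scaleN1r tensZl scaleN1r. Qed.

Lemma tens_ind (P : tensor -> Prop) :
  P 0 -> (forall x y, P x -> P y -> P (x + y)) -> (forall b c, P (tens b c)) ->
  forall x, P x.
Proof.
move=> P0 PD Pt x; rewrite [x]umod_sum.
apply: (big_ind P) => // -[a [b c]] _ /=.
by rewrite -[_ *: _]tensZl.
Qed.

(* The bilinear operation on the tensor product that takes the value
   [F (b, c) (b', c')] on the pure tensors b (x) c and b' (x) c'. *)
Definition tensor_op (F : B * C -> B * C -> tensor) (x y : tensor) : tensor :=
  mlift (fun u => mlift (F u) y) x.

Section TensorOp.
Variable F : B * C -> B * C -> tensor.
Hypothesis Fr : forall u, bilinear_map (F u).
Hypothesis Fl : forall v, bilinear_map (F^~ v).

Lemma tensor_op_bil (y : tensor) : bilinear_map (fun u => mlift (F u) y).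
Proof.
rewrite /mlift /feval; split=> [b|c] a z w; elim: (umod_repr y) => [|p s IH].
- by rewrite !big_nil scaler0 addr0.
- rewrite !big_cons IH ((Fl p.2).1 b) !scalerDr !scalerA addrACA.
  by rewrite (mulrC a) -!scalerA.
- by rewrite !big_nil scaler0 addr0.
rewrite !big_cons IH ((Fl p.2).2 c) !scalerDr !scalerA addrACA.
by rewrite (mulrC a) -!scalerA.
Qed.

Lemma tensor_opE b c b' c' :
  tensor_op F (tens b c) (tens b' c') = F (b, c) (b', c').
Proof. by rewrite /tensor_op mlift_gen ?mlift_gen //; exact: tensor_op_bil. Qed.

Lemma tensor_op_linearl y : linear (tensor_op F ^~ y).
Proof. exact/mlift_linear/tensor_op_bil. Qed.

Lemma tensor_op_linearr x : linear (tensor_op F x).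
Proof.
move=> a y z; rewrite /tensor_op [mlift _ x]/mlift /feval.
rewrite [mlift (fun _ => mlift _ y) _]/mlift [mlift (fun _ => mlift _ z) _]/mlift.
rewrite /feval scaler_sumr -big_split; apply: eq_bigr => p _ /=.
by rewrite mlift_linear // scalerDr !scalerA mulrC.
Qed.

Lemma tensor_opDl x y z : tensor_op F (x + y) z = tensor_op F x z + tensor_op F y z.
Proof. by have := tensor_op_linearl z 1 x y; rewrite !scale1r. Qed.
Lemma tensor_opDr x y z : tensor_op F x (y + z) = tensor_op F x y + tensor_op F x z.
Proof. by have := tensor_op_linearr x 1 y z; rewrite !scale1r. Qed.
Lemma tensor_op0l x : tensor_op F 0 x = 0.
Proof. by apply: (addIr (tensor_op F 0 x)); rewrite -tensor_opDl !add0r. Qed.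
Lemma tensor_op0r x : tensor_op F x 0 = 0.
Proof. by apply: (addIr (tensor_op F x 0)); rewrite -tensor_opDr !add0r. Qed.
Lemma tensor_opZl a x y : tensor_op F (a *: x) y = a *: tensor_op F x y.
Proof. by have := tensor_op_linearl y a x 0; rewrite !addr0 tensor_op0l addr0. Qed.
End TensorOp.

Definition tensor_mul : tensor -> tensor -> tensor :=
  tensor_op (fun u v => tens (u.1 * v.1) (u.2 * v.2)).

Fact tensor_mul_r (u : B * C) :
  bilinear_map (fun v => tens (u.1 * v.1) (u.2 * v.2)).
Proof.
split=> [b|c] a x y /=; first by rewrite mulrDr -scalerAr tens_linearr.
by rewrite mulrDr -scalerAr tens_linearl.
Qed.
Fact tensor_mul_l (v : B * C) :
  bilinear_map (fun u => tens (u.1 * v.1) (u.2 * v.2)).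
Proof.
split=> [b|c] a x y /=; first by rewrite mulrDl -scalerAl tens_linearr.
by rewrite mulrDl -scalerAl tens_linearl.
Qed.

Lemma tensor_mulE b c b' c' :
  tensor_mul (tens b c) (tens b' c') = tens (b * b') (c * c').
Proof. exact: (tensor_opE tensor_mul_r tensor_mul_l). Qed.
Fact tensor_mulDl : left_distributive tensor_mul +%R.
Proof. by move=> x y z; rewrite /tensor_mul (tensor_opDl tensor_mul_l). Qed.
Fact tensor_mulDr : right_distributive tensor_mul +%R.
Proof. by move=> x y z; rewrite /tensor_mul (tensor_opDr tensor_mul_r). Qed.
Fact tensor_mul0l x : tensor_mul 0 x = 0.
Proof. by rewrite /tensor_mul (tensor_op0l tensor_mul_l). Qed.
Fact tensor_mul0r x : tensor_mul x 0 = 0.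
Proof. by rewrite /tensor_mul (tensor_op0r tensor_mul_r). Qed.

Fact tensor_mulC : commutative tensor_mul.
Proof.
move=> x y; elim/tens_ind: x => [|x x' hx hx'|b c].
- by rewrite tensor_mul0l tensor_mul0r.
- by rewrite tensor_mulDl tensor_mulDr hx hx'.
elim/tens_ind: y => [|y y' hy hy'|b' c'].
- by rewrite tensor_mul0l tensor_mul0r.
- by rewrite tensor_mulDl tensor_mulDr hy hy'.
by rewrite !tensor_mulE (mulrC b) (mulrC c).
Qed.
Fact tensor_mulA : associative tensor_mul.
Proof.
move=> x y z; elim/tens_ind: x => [|x x' hx hx'|b c].
- by rewrite !tensor_mul0l.
- by rewrite !tensor_mulDl hx hx'.
elim/tens_ind: y => [|y y' hy hy'|b' c'].
- by rewrite !(tensor_mul0l, tensor_mul0r).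
- by rewrite !(tensor_mulDl, tensor_mulDr) hy hy'.
elim/tens_ind: z => [|z z' hz hz'|b'' c''].
- by rewrite !tensor_mul0r.
- by rewrite !tensor_mulDr hz hz'.
by rewrite !tensor_mulE !mulrA.
Qed.
Definition tensor_one : tensor := tens 1 1.
Fact tensor_mul1 : left_id tensor_one tensor_mul.
Proof.
elim/tens_ind => [|x y hx hy|b c]; first by rewrite tensor_mul0r.
  by rewrite tensor_mulDr hx hy.
by rewrite tensor_mulE !mul1r.
Qed.

(* A linear form separating 1 from a proper ideal; it gives 1 (x) 1 != 0. *)
Lemma tensor_form (mB : {pred B}) (mC : {pred C}) :
  idealr_closed mB -> idealr_closed mC ->
  exists phi : tensor -> k^o, [/\ linear phi, phi tensor_one = 1 &
    forall b c, (b \in mB) || (c \in mC) -> phi (tens b c) = 0].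
Proof.
move=> hB hC.
have sub (A : comAlgType k) (m : {pred A}) : idealr_closed m ->
  exists f : A -> k^o, [/\ linear f, f 1 = 1 & {in m, forall x, f x = 0}].
  case=> m0 m1 mD; apply: linear_form_sep => //.
  by move=> a x y mx my; rewrite -mulr_algl; apply: mD.
have [f [fl f1 f0]] := sub B mB hB; have [g [gl g1 g0]] := sub C mC hC.
have bf : @bilinear_map k^o (fun u => f u.1 * g u.2).
  split=> [b|c] a x y /=; first by rewrite gl mulrDr -scalerAr.
  by rewrite fl mulrDl -scalerAl.
exists (mlift (fun u => f u.1 * g u.2 : k^o)); split.
- exact: mlift_linear.
- by rewrite mlift_gen //= f1 g1 mulr1.
- by move=> b c /orP[/f0|/g0] h; rewrite mlift_gen //= h ?mul0r ?mulr0.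
Qed.

Fact tensor_one_neq0 : tensor_one != 0.
Proof.
have triv (A : comAlgType k) : idealr_closed (pred1 (0 : A)).
  split; rewrite ?inE ?oner_eq0 // => a x y; rewrite !inE => /eqP -> /eqP ->.
  by rewrite mulr0 addr0.
have [f [fl f1 _]] := tensor_form (triv B) (triv C).
apply/eqP => h; have := fl (-1) 0 0.
rewrite scaler0 addr0 scaleN1r addNr -h f1 => /eqP.
by rewrite oner_eq0.
Qed.

HB.instance Definition _ := GRing.Zmodule_isComNzRing.Build tensor
  tensor_mulA tensor_mulC tensor_mul1 tensor_mulDl tensor_one_neq0.

Fact tensor_scalerAl (a : k) (x y : tensor) : a *: (x * y) = (a *: x) * y.
Proof. exact: (esym (tensor_opZl tensor_mul_l a x y)). Qed.
HB.instance Definition _ :=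
  GRing.Lmodule_isLalgebra.Build k tensor tensor_scalerAl.
HB.instance Definition _ := GRing.Lalgebra_isComAlgebra.Build k tensor.

Lemma tensM b c b' c' : tens b c * tens b' c' = tens (b * b') (c * c').
Proof. exact: tensor_mulE. Qed.
Lemma tens11 : tens 1 1 = 1. Proof. by []. Qed.

(* {b (x) c, b' (x) c'} = {b, b'} (x) c c' + b b' (x) {c, c'} *)
Definition tensor_poisson : tensor -> tensor -> tensor :=
  tensor_op (fun u v => tens {[u.1, v.1]} (u.2 * v.2)
                        + tens (u.1 * v.1) {[u.2, v.2]}).

Fact tensor_poisson_r (u : B * C) : bilinear_map (fun v =>
  tens {[u.1, v.1]} (u.2 * v.2) + tens (u.1 * v.1) {[u.2, v.2]}).
Proof.
split=> [b|c] a x y /=.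
  rewrite mulrDr -scalerAr poissonDr poissonZr !tens_linearr.
  by rewrite scalerDr addrACA.
rewrite mulrDr -scalerAr poissonDr poissonZr !tens_linearl.
by rewrite scalerDr addrACA.
Qed.
Fact tensor_poisson_l (v : B * C) : bilinear_map (fun u =>
  tens {[u.1, v.1]} (u.2 * v.2) + tens (u.1 * v.1) {[u.2, v.2]}).
Proof.
split=> [b|c] a x y /=.
  rewrite mulrDl -scalerAl poissonDl poissonZl !tens_linearr.
  by rewrite scalerDr addrACA.
rewrite mulrDl -scalerAl poissonDl poissonZl !tens_linearl.
by rewrite scalerDr addrACA.
Qed.

Lemma tensor_poissonE b c b' c' : tensor_poisson (tens b c) (tens b' c')
  = tens {[b, b']} (c * c') + tens (b * b') {[c, c']}.
Proof. exact: (tensor_opE tensor_poisson_r tensor_poisson_l). Qed.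

Fact tensor_poisson_linear x : linear (tensor_poisson x).
Proof. exact: (tensor_op_linearr tensor_poisson_r). Qed.
Fact tensor_poissonDl : left_distributive tensor_poisson +%R.
Proof. by move=> x y z; rewrite /tensor_poisson (tensor_opDl tensor_poisson_l). Qed.
Fact tensor_poissonDr : right_distributive tensor_poisson +%R.
Proof. by move=> x y z; rewrite /tensor_poisson (tensor_opDr tensor_poisson_r). Qed.
Fact tensor_poisson0l x : tensor_poisson 0 x = 0.
Proof. by rewrite /tensor_poisson (tensor_op0l tensor_poisson_l). Qed.
Fact tensor_poisson0r x : tensor_poisson x 0 = 0.
Proof. by rewrite /tensor_poisson (tensor_op0r tensor_poisson_r). Qed.

Fact tensor_poissonC x y : tensor_poisson x y = - tensor_poisson y x.
Proof.
elim/tens_ind: x => [|x x' hx hx'|b c].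
- by rewrite tensor_poisson0l tensor_poisson0r oppr0.
- by rewrite tensor_poissonDl tensor_poissonDr hx hx' opprD.
elim/tens_ind: y => [|y y' hy hy'|b' c'].
- by rewrite tensor_poisson0l tensor_poisson0r oppr0.
- by rewrite tensor_poissonDl tensor_poissonDr hy hy' opprD.
rewrite !tensor_poissonE (poissonC b) (poissonC c) (mulrC b) (mulrC c).
by rewrite tensNl tensNr opprD.
Qed.

Fact tensor_poissonMr x y z : tensor_poisson x (y * z)
  = tensor_poisson x y * z + tensor_poisson x z * y.
Proof.
elim/tens_ind: x => [|x x' hx hx'|b c].
- by rewrite !tensor_poisson0l !mul0r addr0.
- by rewrite !tensor_poissonDl hx hx' !mulrDl addrACA.
elim/tens_ind: y => [|y y' hy hy'|b' c'].
- by rewrite mul0r mulr0 tensor_poisson0r mul0r addr0.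
- by rewrite mulrDl !tensor_poissonDr hy hy' mulrDl mulrDr addrACA.
elim/tens_ind: z => [|z z' hz hz'|b'' c''].
- by rewrite !mulr0 tensor_poisson0r mul0r addr0.
- by rewrite mulrDr !tensor_poissonDr hz hz' mulrDl mulrDr addrACA.
rewrite tensM !tensor_poissonE !mulrDl !tensM !poissonMr tensDl tensDr.
by rewrite addrACA (mulrAC c c'') (mulrAC b b'') !mulrA.
Qed.

Fact tensor_poisson_jacobi x y z : tensor_poisson x (tensor_poisson y z)
  + tensor_poisson y (tensor_poisson z x)
  + tensor_poisson z (tensor_poisson x y) = 0.
Proof.
have D (a b c a' b' c' : tensor) : a + a' + (b + b') + (c + c')
    = a + b + c + (a' + b' + c').
  by rewrite (addrACA a) (addrACA (a + b)).
elim/tens_ind: x => [|x x' hx hx'|b c].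
- by rewrite !(tensor_poisson0l, tensor_poisson0r) !addr0.
- by rewrite !(tensor_poissonDl, tensor_poissonDr) D hx hx' addr0.
elim/tens_ind: y => [|y y' hy hy'|b' c'].
- by rewrite !(tensor_poisson0l, tensor_poisson0r) !addr0.
- by rewrite !(tensor_poissonDl, tensor_poissonDr) D hy hy' addr0.
elim/tens_ind: z => [|z z' hz hz'|b'' c''].
- by rewrite !(tensor_poisson0l, tensor_poisson0r) !addr0.
- by rewrite !(tensor_poissonDl, tensor_poissonDr) D hz hz' addr0.
have jl u : tens {[b, {[b', b'']}]} u =
    - (tens {[b', {[b'', b]}]} u + tens {[b'', {[b, b']}]} u).
  by apply/eqP; rewrite -addr_eq0 addrA -!tensDl poisson_jacobi tens0l.
have jr u : tens u {[c, {[c', c'']}]} =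
    - (tens u {[c', {[c'', c]}]} + tens u {[c'', {[c, c']}]}).
  by apply/eqP; rewrite -addr_eq0 addrA -!tensDr poisson_jacobi tens0r.
rewrite !(tensor_poissonE, tensor_poissonDr) !poissonMr jl jr.
rewrite !(mulrC {[_, _]}) !(tensDl, tensDr).
rewrite (poissonC c c'') (poissonC b b'') (poissonC c'' c') (poissonC b'' b')
  (poissonC c' c) (poissonC b' b).
rewrite (mulrC c'' c) (mulrCA c' c) (mulrCA c'' c) (mulrC c'' c').
rewrite (mulrC b'' b) (mulrCA b' b) (mulrCA b'' b) (mulrC b'' b').
rewrite !(mulrN, tensNl, tensNr).
by ring.
Qed.

Fact tensor_poisson1l x : tensor_poisson 1 x = 0.
Proof.
elim/tens_ind: x => [|x y hx hy|b c]; first by rewrite tensor_poisson0r.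
  by rewrite tensor_poissonDr hx hy addr0.
by rewrite tensor_poissonE !poisson1l tens0l tens0r addr0.
Qed.

HB.instance Definition _ := isPoisson.Build k tensor tensor_poisson_linear
  tensor_poissonC tensor_poissonMr tensor_poisson_jacobi tensor_poisson1l.

Lemma tens_poisson b c b' c' : {[tens b c, tens b' c']}
  = tens {[b, b']} (c * c') + tens (b * b') {[c, c']}.
Proof. exact: tensor_poissonE. Qed.

End TensorProduct.

Section TensorIdeal.
Variables (k : fieldType) (B C : poissonAlgType k).
Variables (mB : idealr B) (mC : idealr C).

(* mB (x) C + B (x) mC *)
Definition tensor_ideal (x : tensor B C) : bool :=
  `[< exists s : seq (B * C), {in s, forall p, (p.1 \in mB) || (p.2 \in mC)} /\
      x = \sum_(p <- s) tens p.1 p.2 >].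

Fact tensor_ideal_closed : idealr_closed tensor_ideal.
Proof.
split.
- by apply/asboolP; exists [::]; rewrite big_nil.
- apply/negP => /asboolP[s [ms s1]].
  have cl (A : comAlgType k) (m : idealr A) : idealr_closed (m : {pred A}).
    split; first exact: rpred0; first by rewrite idealr1.
    by move=> a x y mx my; rewrite rpredD ?idealMr.
  have [f [fl f1 f0]] := tensor_form (cl _ mB) (cl _ mC).
  pose g : {linear tensor B C -> k^o} := HB.pack f (GRing.isLinear.Build _ _ _ _ f fl).
  have : g 1 = 0.
    by rewrite s1 linear_sum big1_seq // => p /andP[_ /ms]; exact: f0.
  by rewrite /g /= f1 => /eqP; rewrite oner_eq0.
move=> a x y /asboolP[s [ms ->]] /asboolP[t [mt ->]].
elim/tens_ind: a => [|a a' /asboolP[u [mu eu]] /asboolP[u' [mu' eu']]|b c].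
- by apply/asboolP; exists t; rewrite mul0r add0r.
- apply/asboolP; exists (u ++ u' ++ [seq (- p.1, p.2) | p <- t]); split.
    move=> p; rewrite !mem_cat => /or3P[/mu//|/mu'//|/mapP[q /mt h ->]] /=.
    by rewrite rpredN.
  rewrite !big_cat /= -eu -eu' big_map mulrDl.
  under [X in _ = _ + (_ + X)]eq_bigr do rewrite /= tensNl.
  by rewrite sumrN addrK addrAC.
apply/asboolP; exists ([seq (b * p.1, c * p.2) | p <- s] ++ t); split.
  move=> p; rewrite mem_cat => /orP[/mapP[q /ms h ->]|/mt //] /=.
  by case/orP: h => h; apply/orP; [left|right]; apply: idealMr.
rewrite big_cat big_map mulr_sumr; congr (_ + _).
by apply: eq_bigr => p _; rewrite tensM.
Qed.
HB.instance Definition _ := isIdealr.Build (tensor B C) tensor_ideal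
  tensor_ideal_closed.

End TensorIdeal.

Section Adic.
Variables (R : comNzRingType) (I : {pred R}).

(* I^n M *)
Fixpoint adic (M : lmodType R) (n : nat) : set M :=
  if n is n'.+1 then
    [set x | exists s : seq (R * M),
       {in s, forall p, p.1 \in I /\ adic n' p.2} /\ x = \sum_(p <- s) p.1 *: p.2]
  else setT.

Variable M : lmodType R.
Implicit Types (x y : M) (n : nat).

Lemma adic0 n : adic n (0 : M).
Proof. by case: n => [|n] //; exists [::]; rewrite big_nil. Qed.

Lemma adicD n x y : adic n x -> adic n y -> adic n (x + y).
Proof.
case: n => [|n] // [s [Is ->]] [t [It ->]]; exists (s ++ t).
by rewrite big_cat; split=> // p; rewrite mem_cat => /orP[/Is|/It].
Qed.

Lemma adicZ n a x : adic n x -> adic n (a *: x).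
Proof.
elim: n x => [|n IH] x // [s [Is ->]].
exists [seq (p.1, a *: p.2) | p <- s]; split.
  by move=> p /mapP[q /Is[Iq hq] ->] /=; split=> //; apply: IH.
rewrite big_map scaler_sumr; apply: eq_bigr => p _ /=.
by rewrite !scalerA mulrC.
Qed.

Lemma adicN n x : adic n x -> adic n (- x).
Proof. by move=> h; rewrite -scaleN1r; apply: adicZ. Qed.

Lemma adicB n x y : adic n x -> adic n y -> adic n (x - y).
Proof. by move=> hx hy; apply: adicD => //; apply: adicN. Qed.

Lemma adic_sum n (J : Type) (r : seq J) (F : J -> M) :
  (forall j, adic n (F j)) -> adic n (\sum_(j <- r) F j).
Proof.
by move=> h; elim: r => [|j r IH]; rewrite ?big_nil ?big_cons; [exact: adic0|exact: adicD].
Qed.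

Lemma adicS n x : adic n.+1 x -> adic n x.
Proof.
case=> s [Is ->]; rewrite big_seq.
by apply: big_ind => [||p /Is[_ h]]; [exact: adic0|exact: adicD|exact: adicZ].
Qed.

Definition adic_cauchy (u : nat -> M) : Prop :=
  forall n, exists N, forall i j, (N <= i)%N -> (N <= j)%N -> adic n (u i - u j).

Definition adic_cvg (u : nat -> M) (l : M) : Prop :=
  forall n, exists N, forall i, (N <= i)%N -> adic n (u i - l).

(* Separatedness is part of completeness. *)
Definition adic_complete : Prop :=
  (forall u, adic_cauchy u -> exists l, adic_cvg u l) /\
  (forall x, (forall n, adic n x) -> x = 0).

Lemma cauchy_cst x : adic_cauchy (fun _ => x).
Proof. by move=> n; exists 0%N => i j _ _; rewrite subrr; apply: adic0. Qed.

Lemma cauchyD u v : adic_cauchy u -> adic_cauchy v -> adic_cauchy (u + v).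
Proof.
move=> hu hv n; have [N hN] := hu n; have [N' hN'] := hv n.
exists (maxn N N') => i j; rewrite !geq_max => /andP[? ?] /andP[? ?].
by rewrite -[(u + v) i]/(u i + v i) -[(u + v) j]/(u j + v j) opprD addrACA;
  apply: adicD; [exact: hN|exact: hN'].
Qed.

Lemma cauchyZ a u : adic_cauchy u -> adic_cauchy (a *: u).
Proof.
move=> hu n; have [N hN] := hu n; exists N => i j hi hj.
by rewrite -[(a *: u) i]/(a *: u i) -[(a *: u) j]/(a *: u j) -scalerBr;
  apply: adicZ; exact: hN.
Qed.

Lemma cauchyN u : adic_cauchy u -> adic_cauchy (- u).
Proof. by move=> hu; rewrite -scaleN1r; apply: cauchyZ. Qed.

Lemma cvg0_cst0 : adic_cvg 0 0.
Proof. by move=> n; exists 0%N => i _; rewrite subrr; apply: adic0. Qed.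

Lemma cvg0D u v : adic_cvg u 0 -> adic_cvg v 0 -> adic_cvg (u + v) 0.
Proof.
move=> hu hv n; have [N hN] := hu n; have [N' hN'] := hv n.
exists (maxn N N') => i; rewrite !geq_max => /andP[? ?].
rewrite subr0 -[(u + v) i]/(u i + v i).
by apply: adicD; rewrite -[X in adic n X]subr0; [exact: hN|exact: hN'].
Qed.

Lemma cvg0Z a u : adic_cvg u 0 -> adic_cvg (a *: u) 0.
Proof.
move=> hu n; have [N hN] := hu n; exists N => i hi.
rewrite subr0 -[(a *: u) i]/(a *: u i).
by apply: adicZ; rewrite -[X in adic n X]subr0; exact: hN.
Qed.

End Adic.

(* The I-adic completion of the module M: Cauchy sequences modulo sequences
   tending to 0. *)
Section ModuleCompletion.
Variables (R : comNzRingType) (I : {pred R}) (M : lmodType R).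

Definition mcauchy (u : nat -> M) : bool := `[< adic_cauchy I u >].

Fact mcauchy_submod : submod_closed mcauchy.
Proof.
split; first by apply/asboolP/(cauchy_cst I (0 : M)).
by move=> a u v /asboolP hu /asboolP hv; apply/asboolP/cauchyD => //; apply: cauchyZ.
Qed.
HB.instance Definition _ :=
  GRing.isSubmodClosed.Build R (nat -> M) mcauchy mcauchy_submod.

Definition mcauchy_seq : Type := {u : nat -> M | mcauchy u}.
HB.instance Definition _ := SubChoice.copy mcauchy_seq {u : nat -> M | mcauchy u}.
HB.instance Definition _ :=
  [SubChoice_isSubLmodule of mcauchy_seq by <:].

Definition mnull (u : mcauchy_seq) : bool := `[< adic_cvg I (val u) 0 >].

Fact mnull_submod : submod_closed mnull.
Proof.
split; first by apply/asboolP; rewrite raddf0; apply: cvg0_cst0.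
move=> a u v /asboolP hu /asboolP hv; apply/asboolP.
by rewrite linearP; apply: cvg0D => //; apply: cvg0Z.
Qed.
HB.instance Definition _ :=
  GRing.isSubmodClosed.Build R mcauchy_seq mnull mnull_submod.

Local Notation mquot :=
  (Quotient.quot (GRing.ZmodClosed.clone mcauchy_seq mnull _)).
Definition mcompletion : Type := mquot.
HB.instance Definition _ := GRing.Zmodule.copy mcompletion mquot.

Definition mcompl_pi (u : mcauchy_seq) : mcompletion := \pi_mquot u.
Definition mcompl_repr (x : mcompletion) : mcauchy_seq :=
  repr (x : mquot).
Local Notation pi := mcompl_pi.

Lemma mcompl_ind (P : mcompletion -> Prop) : (forall u, P (pi u)) -> forall x, P x.
Proof. by move=> h x; rewrite -[x](@reprK _ mquot); apply: h. Qed.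

Lemma mcompl_piP u v : pi u = pi v <-> adic_cvg I (val u - val v) 0.
Proof.
have -> : val u - val v = val (u - v) by rewrite raddfB.
split=> [/eqP|h].
  by rewrite -[_ == _]/(\pi_mquot u == \pi v)
    -Quotient.idealrBE => /asboolP.
apply/eqP; rewrite -[_ == _]/(\pi_mquot u == \pi v).
by rewrite -Quotient.idealrBE; apply/asboolP.
Qed.

Lemma mcompl_piD : {morph pi : u v / u + v}.
Proof. exact: (raddfD (\pi_mquot)). Qed.

Definition mcompl_scale (a : R) (x : mcompletion) : mcompletion :=
  pi (a *: mcompl_repr x).

Lemma mcompl_scaleE a u : mcompl_scale a (pi u) = pi (a *: u).
Proof.
apply/mcompl_piP; rewrite !linearZ /= -scalerDr; apply: cvg0Z.
by apply/mcompl_piP; rewrite /pi /mcompl_repr reprK.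
Qed.

Fact mcompl_scalerA a b v : mcompl_scale a (mcompl_scale b v) = mcompl_scale (a * b) v.
Proof. by elim/mcompl_ind: v => v; rewrite !mcompl_scaleE scalerA. Qed.
Fact mcompl_scale1r : left_id 1 mcompl_scale.
Proof. by elim/mcompl_ind => v; rewrite !mcompl_scaleE scale1r. Qed.
Fact mcompl_scalerDr : right_distributive mcompl_scale +%R.
Proof.
move=> l; elim/mcompl_ind => u; elim/mcompl_ind => v.
by rewrite -mcompl_piD !mcompl_scaleE scalerDr mcompl_piD.
Qed.
Fact mcompl_scalerDl v : {morph mcompl_scale^~ v: a b / a + b}.
Proof.
by move=> a b; elim/mcompl_ind: v => v; rewrite !mcompl_scaleE scalerDl mcompl_piD.
Qed.
HB.instance Definition _ := GRing.Zmodule_isLmodule.Build R mcompletion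
  mcompl_scalerA mcompl_scale1r mcompl_scalerDr mcompl_scalerDl.

Lemma mcompl_piZ (a : R) u : pi (a *: u) = a *: pi u.
Proof. by rewrite -mcompl_scaleE. Qed.

Definition mcauchy_cst (x : M) : mcauchy_seq :=
  Sub (fun _ : nat => x) (asboolT (cauchy_cst I x)).

(* The canonical map from M to its completion. *)
Definition mcompl_in (x : M) : mcompletion := pi (mcauchy_cst x).

Lemma mcompl_in_linear : linear mcompl_in.
Proof.
move=> a x y; rewrite /mcompl_in -mcompl_piZ -mcompl_piD.
by congr pi; apply: val_inj.
Qed.

End ModuleCompletion.

(* The I-adic completion of a Poisson algebra A, with the bracket extended by
   continuity: {lim u, lim v} = lim {u, v}. *)
Section PoissonCompletion.
Variables (k : fieldType) (A : poissonAlgType k) (I : idealr A).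
Local Notation adicA := (@adic A I A^o).
Local Notation cauchy := (@adic_cauchy A I A^o).

Lemma adic_mull n (a x : A) : adicA n x -> adicA n (a * x).
Proof. exact: (@adicZ A I A^o). Qed.
Lemma adic_mulr n (a x : A) : adicA n x -> adicA n (x * a).
Proof. by rewrite mulrC; apply: adic_mull. Qed.

Lemma adic_poisson n (x a : A) : adicA n.+1 x -> adicA n {[x, a]}.
Proof.
elim: n x => [|n IH] x; first by [].
case=> s [Is ->]; rewrite poisson_suml big_seq.
apply: (big_ind (adicA n.+1)) => [|y z|p /Is[Ip hp]].
- exact: (@adic0 A I A^o).
- exact: (@adicD A I A^o).
rewrite -[p.1 *: p.2]/(p.1 * p.2) poissonMl.
apply: (@adicD A I A^o).
  by apply: adic_mull; exact: hp.
exists [:: (p.1, {[p.2, a]})]; split; last first.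
  by rewrite big_seq1 -[_ *: _]/(p.1 * {[p.2, a]}) mulrC.
by move=> q; rewrite inE => /eqP ->; split=> //; apply: IH.
Qed.

Lemma cauchyM (u v : nat -> A) : cauchy u -> cauchy v -> cauchy (u * v).
Proof.
move=> hu hv n; have [N hN] := hu n; have [N' hN'] := hv n.
exists (maxn N N') => i j; rewrite !geq_max => /andP[? ?] /andP[? ?].
have -> : (u * v) i - (u * v) j = u i * (v i - v j) + (u i - u j) * v j.
  by rewrite mulrBr mulrBl addrA subrK.
apply: (@adicD A I A^o).
  by apply: adic_mull; exact: hN'.
by apply: adic_mulr; exact: hN.
Qed.

Lemma cauchy_poisson (u v : nat -> A) :
  cauchy u -> cauchy v -> cauchy (fun i => {[u i, v i]}).
Proof.
move=> hu hv n; have [N hN] := hu n.+1; have [N' hN'] := hv n.+1.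
exists (maxn N N') => i j; rewrite !geq_max => /andP[? ?] /andP[? ?].
have -> : {[u i, v i]} - {[u j, v j]} = {[u i - u j, v i]} - {[v i - v j, u j]}.
  rewrite !poissonBl (poissonC (v i)) (poissonC (v j)).
  by rewrite opprK opprD opprK addrA subrK.
by apply: (@adicB A I A^o); apply: adic_poisson; [exact: hN|exact: hN'].
Qed.

Lemma cauchyZk (l : k) (u : nat -> A) : cauchy u -> cauchy (fun i => l *: u i).
Proof.
move=> hu n; have [N hN] := hu n; exists N => i j hi hj.
by rewrite -[_ - _]/(l *: u i - l *: u j) -scalerBr -mulr_algl; apply/adic_mull/hN.
Qed.

Definition acauchy (u : nat -> A) : bool := `[< cauchy u >].

Fact acauchy_subring : subring_closed acauchy.
Proof.
split; first by apply/asboolP/(@cauchy_cst A I A^o 1).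
  move=> u v /asboolP hu /asboolP hv; apply/asboolP.
  by apply: (@cauchyD A I A^o) => //; apply: (@cauchyN A I A^o).
by move=> u v /asboolP hu /asboolP hv; apply/asboolP/cauchyM.
Qed.
HB.instance Definition _ :=
  GRing.isSubringClosed.Build (nat -> A) acauchy acauchy_subring.

Definition cauchy_seq : Type := {u : nat -> A | acauchy u}.
HB.instance Definition _ := SubChoice.copy cauchy_seq {u : nat -> A | acauchy u}.
HB.instance Definition _ := [SubChoice_isSubComNzRing of cauchy_seq by <:].

Definition cauchy_scale (l : k) (u : cauchy_seq) : cauchy_seq :=
  Sub (fun i => l *: val u i) (asboolT (cauchyZk l (asboolW (valP u)))).

Lemma val_cauchy_scale l u i : val (cauchy_scale l u) i = l *: val u i.
Proof. by []. Qed.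

Lemma cauchy_seqP (u v : cauchy_seq) : (forall i, val u i = val v i) -> u = v.
Proof. by move=> h; apply: val_inj; apply/funext. Qed.

Fact cauchy_scalerA a b v : cauchy_scale a (cauchy_scale b v) = cauchy_scale (a * b) v.
Proof. by apply: cauchy_seqP => i; rewrite !val_cauchy_scale scalerA. Qed.
Fact cauchy_scale1r : left_id 1 cauchy_scale.
Proof. by move=> v; apply: cauchy_seqP => i; rewrite val_cauchy_scale scale1r. Qed.
Fact cauchy_scalerDr : right_distributive cauchy_scale +%R.
Proof.
move=> a u v; apply: cauchy_seqP => i; rewrite val_cauchy_scale.
rewrite -[RHS]/(val (cauchy_scale a u) i + val (cauchy_scale a v) i).
by rewrite !val_cauchy_scale -scalerDr.
Qed.
Fact cauchy_scalerDl v : {morph cauchy_scale^~ v: a b / a + b}.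
Proof.
move=> a b; apply: cauchy_seqP => i; rewrite val_cauchy_scale.
rewrite -[RHS]/(val (cauchy_scale a v) i + val (cauchy_scale b v) i).
by rewrite !val_cauchy_scale -scalerDl.
Qed.
HB.instance Definition _ := GRing.Zmodule_isLmodule.Build k cauchy_seq
  cauchy_scalerA cauchy_scale1r cauchy_scalerDr cauchy_scalerDl.

Fact cauchy_scalerAl (a : k) (u v : cauchy_seq) : a *: (u * v) = (a *: u) * v.
Proof.
apply: cauchy_seqP => i; rewrite val_cauchy_scale.
rewrite -[RHS]/(val (cauchy_scale a u) i * val v i) val_cauchy_scale.
by rewrite -scalerAl.
Qed.
HB.instance Definition _ :=
  GRing.Lmodule_isLalgebra.Build k cauchy_seq cauchy_scalerAl.
HB.instance Definition _ := GRing.Lalgebra_isComAlgebra.Build k cauchy_seq.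

Definition cauchy_bracket (u v : cauchy_seq) : cauchy_seq :=
  Sub (fun i => {[val u i, val v i]})
    (asboolT (cauchy_poisson (asboolW (valP u)) (asboolW (valP v)))).

Fact cauchy_bracket_linear u : linear (cauchy_bracket u).
Proof.
move=> a v w; apply: cauchy_seqP => i.
rewrite -[RHS]/(val (cauchy_scale a (cauchy_bracket u v)) i + {[val u i, val w i]}).
rewrite val_cauchy_scale -[LHS]/{[val u i, val (cauchy_scale a v) i + val w i]}.
by rewrite val_cauchy_scale poissonDr poissonZr.
Qed.
Fact cauchy_bracketC u v : cauchy_bracket u v = - cauchy_bracket v u.
Proof. by apply: cauchy_seqP => i; exact: poissonC. Qed.
Fact cauchy_bracketMr u v w : cauchy_bracket u (v * w)
  = cauchy_bracket u v * w + cauchy_bracket u w * v.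
Proof. by apply: cauchy_seqP => i; exact: poissonMr. Qed.
Fact cauchy_bracket_jacobi u v w : cauchy_bracket u (cauchy_bracket v w)
  + cauchy_bracket v (cauchy_bracket w u)
  + cauchy_bracket w (cauchy_bracket u v) = 0.
Proof. by apply: cauchy_seqP => i; exact: poisson_jacobi. Qed.
Fact cauchy_bracket1l u : cauchy_bracket 1 u = 0.
Proof. by apply: cauchy_seqP => i; exact: poisson1l. Qed.
HB.instance Definition _ := isPoisson.Build k cauchy_seq cauchy_bracket_linear
  cauchy_bracketC cauchy_bracketMr cauchy_bracket_jacobi cauchy_bracket1l.

Definition null_seq (u : cauchy_seq) : bool := `[< @adic_cvg A I A^o (val u) 0 >].

Lemma adic1 (x : A) : adicA 1 x -> x \in I.
Proof.
case=> s [Is ->]; rewrite big_seq; apply: rpred_sum => p /Is[Ip _].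
by rewrite -[_ *: _]/(p.1 * p.2) mulrC idealMr.
Qed.

Fact null_seq_ideal : idealr_closed null_seq.
Proof.
split.
- by apply/asboolP; apply: (@cvg0_cst0 A I A^o).
- apply/negP => /asboolP /(_ 1%N)[N /(_ N (leqnn N))].
  by rewrite subr0 => /adic1; rewrite idealr1.
move=> a u v /asboolP hu /asboolP hv; apply/asboolP.
apply: (@cvg0D A I A^o) => // n; have [N hN] := hu n; exists N => i hi.
rewrite subr0; apply: adic_mull.
by have := hN i hi; rewrite subr0.
Qed.
HB.instance Definition _ := isIdealr.Build cauchy_seq null_seq null_seq_ideal.

Fact null_seq_poisson : {in null_seq, forall u, forall v, {[u, v]} \in null_seq}.
Proof.
move=> u /asboolP hu v; apply/asboolP => n; have [N hN] := hu n.+1.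
exists N => i hi; rewrite subr0; apply: adic_poisson.
by have := hN i hi; rewrite subr0.
Qed.
HB.instance Definition _ :=
  isPoissonIdeal.Build k cauchy_seq null_seq null_seq_poisson.

Definition completion : Type :=
  poisson_quot (PoissonIdeal.clone k cauchy_seq null_seq _).
HB.instance Definition _ := PoissonAlgebra.copy completion
  (poisson_quot (PoissonIdeal.clone k cauchy_seq null_seq _)).

Definition cauchy_cst_seq (x : A) : cauchy_seq :=
  Sub (fun _ : nat => x) (asboolT (@cauchy_cst A I A^o x)).

(* The canonical map from A to its completion. *)
Definition completion_in (x : A) : completion := quot_pi _ (cauchy_cst_seq x).

End PoissonCompletion.

(* The completed tensor product of two local Poisson algebras: the completion
   of B (x) C with respect to mB (x) C + B (x) mC. *)
Definition completed_tensor (k : fieldType) (B C : poissonAlgType k)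
    (mB : idealr B) (mC : idealr C) : poissonAlgType k :=
  completion (Idealr.clone (tensor B C) (tensor_ideal mB mC) _).

Section CommutativeAlgebra.
Variable R : comNzRingType.

Definition generates (s : seq R) (I : {pred R}) : Prop :=
  forall x, x \in I <-> exists c : nat -> R, x = \sum_(i < size s) c i * s`_i.

(* An [idealr] is a proper ideal; the unit ideal is finitely generated. *)
Definition noetherian : Prop := forall I : idealr R, exists s, generates s I.

Definition maximal_ideal (m : idealr R) : Prop :=
  forall I : idealr R, {subset m <= I} -> {subset I <= m}.

Definition is_local_at (m : idealr R) : Prop :=
  maximal_ideal m /\ forall n : idealr R, maximal_ideal n -> n =i m.

Definition prime_chain (d : nat) : Prop :=
  exists P : nat -> prime_idealr R, forall i, (i < d)%N ->
    {subset P i <= P i.+1} /\ exists2 x, x \in P i.+1 & x \notin P i.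

Definition krull_dim_eq (d : nat) : Prop := prime_chain d /\ ~ prime_chain d.+1.

Definition regular_local_at (m : idealr R) : Prop :=
  [/\ is_local_at m, noetherian & exists2 s, generates s m & krull_dim_eq (size s)].

End CommutativeAlgebra.

Definition complete_local (k : fieldType) (A : comAlgType k) (m : idealr A) : Prop :=
  [/\ is_local_at m,
      noetherian A,
      (* the map k -> A/m is bijective *)
      forall a : A, exists! c : k, a - c%:A \in m &
      @adic_complete A m A^o].

Section ClassicalDomain.
Variables (R : comNzRingType) (dR : GRing.integral_domain_axiom R).

Definition domain_of : Type := R.
HB.instance Definition _ := GRing.ComNzRing.copy domain_of R.

Definition domain_unit (x : domain_of) : bool := `[< exists y, y * x = 1 >].
Definition domain_inv (x : domain_of) : domain_of :=
  if pselect (exists y, y * x = 1) is left h then projT1 (cid h) else x.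

Fact domain_mulVx : {in domain_unit, left_inverse 1 domain_inv *%R}.
Proof.
move=> x /asboolP ux; rewrite /domain_inv; case: pselect => // h.
exact: projT2 (cid h).
Qed.
Fact domain_unitPl (x y : domain_of) : y * x = 1 -> domain_unit x.
Proof. by move=> h; apply/asboolP; exists y. Qed.
Fact domain_inv_out : {in [predC domain_unit], domain_inv =1 id}.
Proof.
move=> x /negP ux; rewrite /domain_inv; case: pselect => // h.
by case: ux; apply/asboolP.
Qed.
HB.instance Definition _ := GRing.ComNzRing_hasMulInverse.Build domain_of
  domain_mulVx domain_unitPl domain_inv_out.

Definition domain_pack : idomainType :=
  HB.pack domain_of (GRing.ComUnitRing_isIntegral.Build domain_of dR).

Definition fraction_field : fieldType := {fraction domain_pack}.
Definition to_fraction (x : R) : fraction_field :=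
  @FracField.tofrac domain_pack x.

End ClassicalDomain.

Section Differentials.
Variables (k : fieldType) (A : comAlgType k).

Definition derivation (V : lmodType A) (D : A -> V) : Prop :=
  [/\ forall a b, D (a + b) = D a + D b,
      forall (c : k), D c%:A = 0 &
      forall a b, D (a * b) = a *: D b + b *: D a].

Definition kahler : lmodType A := umod derivation.
Definition kahler_d (a : A) : kahler := mgen derivation a.

Lemma kahler_d_derivation : derivation kahler_d.
Proof.
split=> [a b|c|a b]; apply: umod_ext => V D dD; have [DD DZ DM] := dD.
- by rewrite mliftD // !mlift_gen.
- by rewrite mlift_gen // DZ mlift0.
- by rewrite mliftD // !mliftZ // !mlift_gen.
Qed.

(* For a local ring (A, m): continuous differentials, that is, the m-adic
   completion of the module of Kaehler differentials. *)
Definition cont_diff (m : idealr A) : lmodType A := mcompletion m kahler.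
Definition cont_d (m : idealr A) (a : A) : cont_diff m :=
  mcompl_in m (kahler_d a).

End Differentials.

(* The base change K (x)_R M along f : R -> K *)
Section BaseChange.
Variables (R K : comNzRingType) (f : R -> K) (M : lmodType R).

Definition semilinear_map (V : lmodType K) (g : M -> V) : Prop :=
  forall a x y, g (a *: x + y) = f a *: g x + g y.

Definition base_change : lmodType K := umod semilinear_map.
Definition base_change_in (x : M) : base_change := mgen semilinear_map x.

Lemma base_change_in_semilinear : semilinear_map base_change_in.
Proof.
move=> a x y; apply: umod_ext => V g hg.
by rewrite mliftD // mliftZ // !mlift_gen.
Qed.

End BaseChange.

Definition bilinear_form (S : comNzRingType) (M : lmodType S)
    (Th : M -> M -> S) : Prop :=
  (forall u, linear (Th u : M -> S^o)) /\ (forall v, linear (Th ^~ v : M -> S^o)).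

Definition skew_form (S : comNzRingType) (M : lmodType S)
    (Th : M -> M -> S) : Prop :=
  forall u v, Th u v = - Th v u.

(* The induced map from M to its dual is an isomorphism. *)
Definition nondegenerate_form (S : comNzRingType) (M : lmodType S)
    (Th : M -> M -> S) : Prop :=
  forall phi : M -> S^o, linear phi -> exists! u, forall v, Th u v = phi v.

(* The bivector of A, regarded as a form on an S-module M of differentials with
   universal derivation d : A -> M (where S is A or a localization of A), is
   non-degenerate.  For continuous differentials the da generate M, so that the
   third condition determines the form. *)
Definition nondegenerate_bivector (k : fieldType) (A : poissonAlgType k)
    (S : comNzRingType) (iota : A -> S) (M : lmodType S) (d : A -> M) : Prop :=
  exists Th : M -> M -> S,
    [/\ bilinear_form Th, skew_form Th,
        forall a b, Th (d a) (d b) = iota {[a, b]} &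
        nondegenerate_form Th].

Section Nondegeneracy.
Variables (k : fieldType) (A : poissonAlgType k) (m : idealr A).

Definition nondegenerate_poisson : Prop :=
  @nondegenerate_bivector k A A id (cont_diff m) (cont_d m).

(* [dA] says that Spec A is integral; the stalk at its generic point is the
   fraction field. *)
Definition generically_nondegenerate : Prop :=
  exists dA : GRing.integral_domain_axiom A,
    let K := fraction_field dA in
    let iota := @to_fraction A dA in
    @nondegenerate_bivector k A K iota
      (base_change iota (cont_diff m))
      (fun a => base_change_in iota (cont_d m a)).

End Nondegeneracy.

Section Holonomic.
Variables (k : fieldType) (A : poissonAlgType k).

(* Integral Poisson subschemes of Spec A correspond to prime Poisson ideals. *)
Definition holonomic : Prop :=
  [/\ noetherian A,
      GRing.integral_domain_axiom A &
      forall (P : primePoissonIdeal A) (n : idealr (poisson_quot P)),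
        maximal_ideal n -> generically_nondegenerate n].

Definition exact_poisson : Prop :=
  exists xi : A -> A,
    [/\ linear xi,
        forall a b, xi (a * b) = xi a * b + a * xi b &
        forall a b, xi {[a, b]} = {[a, b]} + {[xi a, b]} + {[a, xi b]}].

End Holonomic.

(* Main.v *)
Require Import Defs.
From HB Require Import structures.
From mathcomp Require Import all_boot all_algebra.
From mathcomp Require Import boolp classical_sets functions.
From mathcomp Require Import ring mpoly.

(* The idea is the formal Darboux-Weinstein splitting theorem. If {f, g} is a unit,
   solving one ODE by a power series replaces f by x with {x, g} = 1. Starting
   from the empty family, canonical pairs z = (x_i, y_i) are added as long as
   possible inside their common centralizer B; the number of pairs is bounded by
   the number of generators of the maximal ideal m. The Hamiltonian derivations of
   z are coordinate derivations for z, so, in characteristic 0, A is the ring of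
   power series in z over B.

   When no pair can be added, J contains the maximal ideal of B. Otherwise some b
   in it would have an image in A/J outside the square of the maximal ideal. As
   A/J is regular, monomials in a minimal system of generators are independent in
   its associated graded ring, so a derivation of A/J takes the image of b to a
   unit; by non-degeneracy it is a combination of Hamiltonian derivations, so some
   bracket of b with an element of the maximal ideal of B is a unit. Hence A/J is
   k[[z]], which embeds in A as a Poisson subalgebra commuting with B, and A is the
   completed tensor product of B and A/J.

   A prime Poisson ideal P of A restricts to p in B, and each p arises from the
   largest z-stable subset of p + (z). Over the generic point the 2-form of A/P is
   that of B/p plus a symplectic form in dz; since the modules of differentials are
   finitely generated, non-degeneracy says that 1-forms in the kernel of the
   bivector are killed by all derivations, and this passes between B/p and A/P by
   comparing coefficients of power series in z. *)

Set Implicit Arguments.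
Unset Strict Implicit.
Unset Printing Implicit Defensive.

Import GRing.Theory.

Local Open Scope ring_scope.

(** * Powers of ideals and derivations *)

(** No ring of power series is ever built. Its role is played by Euler's relation: with E = sum_i
    z_i D_i and x in (z)^(n+1), E x = (n+1) x modulo (z)^(n+2), so in characteristic 0 an x whose
    derivatives D_i x also lie in (z)^(n+1) lies in (z)^(n+2). With separatedness, an element
    vanishes as soon as the constant terms of all its iterated derivatives do. The facts needed are
    collected in records, so that one argument serves both A over B and A/P over B/p. Regularity is
    given by the Krull dimension and a number of generators, whereas the proof needs a derivation.
    The bridge is a bound on chains of primes: a form relation among the n+1 generators of the
    maximal ideal would leave n elements generating an ideal that contains a power of it, too few
    for a chain of n+1 strict inclusions. For a singular A/P the differentials need not be free, and
    the form at the generic point is awkward to transport between A/P and B/p. Derivations with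
    values in the algebra itself detect the same kernel once denominators are cleared, and they can
    be extended and restricted. *)

Section Choice.

Lemma dependent_choice (T : Type) (P : nat -> T -> Prop) (E : nat -> T -> T -> Prop)
    (x0 : T) :
  P 0%N x0 -> (forall n x, P n x -> exists y, P n.+1 y /\ E n x y) ->
  exists u : nat -> T, [/\ u 0%N = x0, forall n, P n (u n) & forall n, E n (u n) (u n.+1)].
Proof.
move=> P0 PS.
have step n (x : {x | P n x}) : {y : {y | P n.+1 y} | E n (projT1 x) (projT1 y)}.
  by have [y [Py Exy]] := cid (PS n _ (projT2 x)); exists (exist _ y Py).
pose fix u n : {x | P n x} :=
  if n is n'.+1 then projT1 (step n' (u n')) else exist _ x0 P0.
exists (fun n => projT1 (u n)); split=> // n; first exact: projT2 (u n).
exact: projT2 (step n (u n)).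
Qed.

Lemma fun_choice (I T : Type) (P : I -> T -> Prop) :
  (forall i, exists x, P i x) -> exists f : I -> T, forall i, P i (f i).
Proof. by move=> h; exists (fun i => projT1 (cid (h i))) => i; exact: projT2 (cid _). Qed.

End Choice.

Section IdealPowers.
Variables (R : comNzRingType).
Implicit Types (I J : {pred R}) (a x y : R).

Definition ipow I (n : nat) x : Prop := @adic R I R^o n x.

Lemma ipow_zero I n : ipow I n 0. Proof. exact: (@adic0 R I R^o n). Qed.
Lemma ipowD I n x y : ipow I n x -> ipow I n y -> ipow I n (x + y).
Proof. exact: (@adicD R I R^o n). Qed.
Lemma ipowN I n x : ipow I n x -> ipow I n (- x).
Proof. exact: (@adicN R I R^o n). Qed.
Lemma ipowB I n x y : ipow I n x -> ipow I n y -> ipow I n (x - y).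
Proof. exact: (@adicB R I R^o n). Qed.
Lemma ipowM I n a x : ipow I n x -> ipow I n (a * x).
Proof. exact: (@adicZ R I R^o n). Qed.
Lemma ipowMr I n a x : ipow I n x -> ipow I n (x * a).
Proof. by rewrite mulrC; apply: ipowM. Qed.
Lemma ipow_sum I n (K : Type) (r : seq K) (P : pred K) (F : K -> R) :
  (forall i, P i -> ipow I n (F i)) -> ipow I n (\sum_(i <- r | P i) F i).
Proof. by move=> h; apply: big_ind => //; [exact: ipow_zero|exact: ipowD]. Qed.
Lemma ipow_sym I n x y : ipow I n (x - y) -> ipow I n (y - x).
Proof. by move=> h; rewrite -opprB; apply: ipowN. Qed.
Lemma ipow_trans I n y x z : ipow I n (x - y) -> ipow I n (y - z) -> ipow I n (x - z).
Proof. by move=> h h'; rewrite -(subrK y x) -addrA; apply: ipowD. Qed.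
Lemma ipow_subl I n x y : ipow I n (x - y) -> ipow I n x -> ipow I n y.
Proof. by move=> h hx; rewrite -(subKr x y); apply: ipowB. Qed.
Lemma ipow_subr I n x y : ipow I n (x - y) -> ipow I n y -> ipow I n x.
Proof. by move=> h hx; rewrite -(subrK y x); apply: ipowD. Qed.

Lemma ipowS I n x : ipow I n.+1 x -> ipow I n x.
Proof. exact: (@adicS R I R^o n). Qed.
Lemma ipow_le I n p x : (n <= p)%N -> ipow I p x -> ipow I n x.
Proof.
move/subnK <-; elim: (p - n)%N => [|q IH] //.
by rewrite addSn => /ipowS.
Qed.

Lemma ipow_mem I n a x : a \in I -> ipow I n x -> ipow I n.+1 (a * x).
Proof.
move=> Ia hx; exists [:: (a, x)]; split; last by rewrite big_seq1.
by move=> p; rewrite inE => /eqP ->.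
Qed.

Lemma ipowS_ind I n (X : R -> Prop) :
  X 0 -> (forall x y, X x -> X y -> X (x + y)) ->
  (forall a x, a \in I -> ipow I n x -> X (a * x)) ->
  forall x, ipow I n.+1 x -> X x.
Proof.
move=> X0 XD XM x [s [Is ->]]; rewrite big_seq; apply: big_ind => // p /Is[Ip hp].
exact: XM.
Qed.

Lemma ipow_mul I n p x y : ipow I n x -> ipow I p y -> ipow I (n + p) (x * y).
Proof.
elim: n x => [|n IH] x; first by move=> _; apply: ipowM.
move=> hx hy; move: x hx; apply: ipowS_ind => [|x x' hx hx'|a x Ia hx].
- by rewrite mul0r; apply: ipow_zero.
- by rewrite mulrDl; apply: ipowD.
by rewrite -mulrA addSn; apply: ipow_mem => //; apply: IH.
Qed.

Lemma ipow_add_ind I n p (X : R -> Prop) :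
  X 0 -> (forall x y, X x -> X y -> X (x + y)) ->
  (forall x y, ipow I n x -> ipow I p y -> X (x * y)) ->
  forall z, ipow I (n + p) z -> X z.
Proof.
elim: n X => [|n IH] X X0 XD XM z.
  by move=> hz; rewrite -(mul1r z); apply: XM.
rewrite addSn; apply: ipowS_ind => // a x Ia.
apply: (IH (fun x => X (a * x))) => [|x' y|x' y hx hy]; first by rewrite mulr0.
  by rewrite mulrDr; apply: XD.
by rewrite mulrA; apply: XM => //; apply: ipow_mem.
Qed.

Lemma ipow1_mem I x : x \in I -> ipow I 1 x.
Proof. by move=> Ix; rewrite -[x]mulr1; apply: ipow_mem. Qed.

Lemma ipow_comp I J N : (forall x, x \in I -> ipow J N x) ->
  forall n x, ipow I n x -> ipow J (n * N) x.
Proof.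
move=> h; elim=> [|n IH] // x; apply: ipowS_ind; [exact: ipow_zero|exact: ipowD|].
by move=> a y /h ha /IH hy; rewrite mulSn; apply: ipow_mul.
Qed.

Lemma ipow_mono I J : {subset I <= J} -> forall n x, ipow I n x -> ipow J n x.
Proof.
move=> h n x hx; have h1 y : y \in I -> ipow J 1 y by move/h/ipow1_mem.
by have := ipow_comp h1 hx; rewrite muln1.
Qed.

Lemma ipowX I n x : x \in I -> ipow I n (x ^+ n).
Proof.
by move=> Ix; elim: n => [|n IH] //; rewrite exprS; apply: ipow_mem.
Qed.

End IdealPowers.

Lemma ipow1_ideal (R : comNzRingType) (I : idealr R) (x : R) : ipow I 1 x -> x \in I.
Proof.
apply: (ipowS_ind (X := fun x => x \in I)); [exact: rpred0|exact: rpredD|].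
by move=> a y Ia _; rewrite mulrC idealMr.
Qed.

Lemma ipow_morph (R S : comNzRingType) (I : {pred R}) (J : {pred S}) (f : R -> S) :
  f 0 = 0 -> {morph f : x y / x + y} -> {morph f : x y / x * y} ->
  (forall x, x \in I -> f x \in J) ->
  forall n x, ipow I n x -> ipow J n (f x).
Proof.
move=> f0 fD fM fI; elim=> [|n IH] //; apply: ipowS_ind => [|x' y h h'|a y Ia /IH hy].
- by rewrite f0; apply: ipow_zero.
- by rewrite fD; apply: ipowD.
by rewrite fM; apply: ipow_mem => //; apply: fI.
Qed.

(* Derivations along j: the target is an S-module through j. *)
Definition der_along (k : fieldType) (S R : comAlgType k) (j : S -> R) (D : S -> R) :=
  [/\ forall a b, D (a + b) = D a + D b,
      forall c : k, D c%:A = 0 &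
      forall a b, D (a * b) = j a * D b + j b * D a].

Notation der := (der_along (@id _)).

Section Derivations.
Variables (k : fieldType).

Section Along.
Variables (S R : comAlgType k) (j : S -> R) (D : S -> R).
Hypothesis hD : der_along j D.

Lemma derD a b : D (a + b) = D a + D b. Proof. by case: hD. Qed.
Lemma derC (c : k) : D c%:A = 0. Proof. by case: hD. Qed.
Lemma derM a b : D (a * b) = j a * D b + j b * D a. Proof. by case: hD. Qed.
Lemma der0 : D 0 = 0. Proof. by rewrite -(scale0r 1) derC. Qed.
Lemma der1 : D 1 = 0. Proof. by rewrite -(scale1r 1) derC. Qed.
Lemma derN a : D (- a) = - D a.
Proof. by apply/eqP; rewrite -addr_eq0 -derD addNr der0. Qed.
Lemma derB a b : D (a - b) = D a - D b. Proof. by rewrite derD derN. Qed.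
Lemma der_sum (K : Type) (r : seq K) (P : pred K) (F : K -> S) :
  D (\sum_(i <- r | P i) F i) = \sum_(i <- r | P i) D (F i).
Proof. by apply: (big_morph D derD der0). Qed.
Lemma derZ (c : k) a : j c%:A = c%:A -> D (c *: a) = c *: D a.
Proof. by move=> h; rewrite -mulr_algl derM derC mulr0 addr0 h mulr_algl. Qed.

Lemma ipow_der (I : {pred S}) (J : {pred R}) :
  j 0 = 0 -> {morph j : x y / x + y} -> {morph j : x y / x * y} ->
  (forall x, x \in I -> j x \in J) ->
  forall n x, ipow I n.+1 x -> ipow J n (D x).
Proof.
move=> j0 jD jM jI; elim=> [|n IH] //; apply: ipowS_ind => [|y z hy hz|a y Ia hy].
- by rewrite der0; apply: ipow_zero.
- by rewrite derD; apply: ipowD.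
rewrite derM; apply: ipowD.
  by apply: ipow_mem; [exact: jI|exact: IH].
by apply: ipowMr; apply: (ipow_morph j0 jD jM jI).
Qed.

End Along.

Section Endo.
Variables (R : comAlgType k).
Implicit Types D E : R -> R.

Lemma der_ipow D (I : {pred R}) n x : der D -> ipow I n.+1 x -> ipow I n (D x).
Proof. by move=> hD; apply: (ipow_der hD). Qed.

Lemma der_scale D (c : k) x : der D -> D (c *: x) = c *: D x.
Proof. by move=> hD; rewrite (derZ hD). Qed.

Lemma der_mull D a : der D -> der (fun x => a * D x).
Proof.
move=> hD; split=> [x y|c|x y]; first by rewrite (derD hD) mulrDr.
  by rewrite (derC hD) mulr0.
by rewrite (derM hD); ring.
Qed.

Lemma der_add D E : der D -> der E -> der (fun x => D x + E x).
Proof.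
move=> hD hE; split=> [x y|c|x y]; first by rewrite (derD hD) (derD hE) addrACA.
  by rewrite (derC hD) (derC hE) addr0.
by rewrite (derM hD) (derM hE); ring.
Qed.

Lemma der_sumf (I : finType) (D : I -> R -> R) :
  (forall i, der (D i)) -> der (fun x => \sum_i D i x).
Proof.
move=> hD; split=> [x y|c|x y].
- by rewrite -big_split; apply: eq_bigr => i _; rewrite (derD (hD i)).
- by apply: big1 => i _; rewrite (derC (hD i)).
rewrite !mulr_sumr -big_split; apply: eq_bigr => i _; exact: (derM (hD i)).
Qed.

Lemma derX D x n : der D -> D (x ^+ n.+1) = n.+1%:R * x ^+ n * D x.
Proof.
move=> hD; elim: n => [|n IH]; first by rewrite expr1 expr0 !mul1r.
by rewrite exprS (derM hD) IH exprS -(natr1 n.+1); ring.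
Qed.

End Endo.
End Derivations.

Lemma poisson_der (k : fieldType) (A : poissonAlgType k) (a : A) :
  der (fun x => {[a, x]}).
Proof.
split=> [x y|c|x y]; first exact: poissonDr.
  by rewrite poissonZr poisson1r scaler0.
by rewrite poissonMr addrC mulrC; congr (_ + _); rewrite mulrC.
Qed.

Lemma poisson_derl (k : fieldType) (A : poissonAlgType k) (a : A) :
  der (fun x => {[x, a]}).
Proof.
split=> [x y|c|x y]; first exact: poissonDl.
  by rewrite poissonZl poisson1l scaler0.
by rewrite poissonMl addrC mulrC; congr (_ + _); rewrite mulrC.
Qed.

Section Limits.
Variables (R : comNzRingType) (I : {pred R}).
Hypothesis hR : @adic_complete R I R^o.

Lemma adic_separated x : (forall n, ipow I n x) -> x = 0.
Proof. exact: hR.2. Qed.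

Lemma adic_separatedB x y : (forall n, ipow I n (x - y)) -> x = y.
Proof. by move=> h; apply/eqP; rewrite -subr_eq0; apply/eqP/adic_separated. Qed.

Lemma adic_step_le (u : nat -> R) : (forall n, ipow I n (u n.+1 - u n)) ->
  forall n p, (n <= p)%N -> ipow I n (u p - u n).
Proof.
move=> h n p /subnK <-; elim: (p - n)%N => [|q IH].
  by rewrite subrr; apply: ipow_zero.
rewrite addSn; apply: ipow_trans IH; apply: ipow_le (h _); exact: leq_addl.
Qed.

(** The form in which completeness serves all successive approximations below: the modulus of
    convergence is the index itself, for the steps and for the limit. *)
Lemma adic_limit (u : nat -> R) : (forall n, ipow I n (u n.+1 - u n)) ->
  exists l, forall n, ipow I n (l - u n).
Proof.
move=> h; have hle := adic_step_le h.
have [|l hl] := hR.1 u.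
  move=> n; exists n => i j hi hj; apply: (@ipow_trans _ _ _ (u n)).
    exact: hle.
  by apply: ipow_sym; apply: hle.
exists l => n; have [N hN] := hl n.
apply: (@ipow_trans _ _ _ (u (maxn n N))).
  by apply: ipow_sym; apply: hN; rewrite leq_maxr.
by apply: hle; rewrite leq_maxl.
Qed.

End Limits.

Definition span (R : comNzRingType) (I : finType) (s : I -> R) : {pred R} :=
  fun x => `[< exists c : I -> R, x = \sum_i c i * s i >].

Section Span.
Variables (R : comNzRingType) (I : finType) (s : I -> R).

Lemma spanP x : reflect (exists c : I -> R, x = \sum_i c i * s i) (x \in span s).
Proof. exact: asboolP. Qed.

Lemma span_gen i : s i \in span s.
Proof.
apply/spanP; exists (fun j => (j == i)%:R).
by rewrite (bigD1 i) //= eqxx mul1r big1 ?addr0 // => j /negPf ->; rewrite mul0r.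
Qed.

Lemma span0 : 0 \in span s.
Proof. by apply/spanP; exists (fun _ => 0); rewrite big1 // => i _; rewrite mul0r. Qed.

Lemma spanD x y : x \in span s -> y \in span s -> x + y \in span s.
Proof.
move=> /spanP[c ->] /spanP[d ->]; apply/spanP; exists (fun i => c i + d i).
by rewrite -big_split; apply: eq_bigr => i _; rewrite mulrDl.
Qed.

Lemma spanM a x : x \in span s -> a * x \in span s.
Proof.
move=> /spanP[c ->]; apply/spanP; exists (fun i => a * c i).
by rewrite mulr_sumr; apply: eq_bigr => i _; rewrite mulrA.
Qed.

Lemma spanN x : x \in span s -> - x \in span s.
Proof. by rewrite -mulN1r; apply: spanM. Qed.

Lemma spanB x y : x \in span s -> y \in span s -> x - y \in span s.
Proof. by move=> hx /spanN; apply: spanD. Qed.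

Lemma span_sum (K : Type) (r : seq K) (P : pred K) (F : K -> R) :
  (forall i, P i -> F i \in span s) -> \sum_(i <- r | P i) F i \in span s.
Proof.
by move=> h; apply: (big_ind (fun y => y \in span s)); [exact: span0|exact: spanD|].
Qed.

Lemma span_ind (X : R -> Prop) :
  X 0 -> (forall x y, X x -> X y -> X (x + y)) -> (forall a i, X (a * s i)) ->
  forall x, x \in span s -> X x.
Proof. by move=> X0 XD XM x /spanP[c ->]; apply: big_ind. Qed.

Lemma span_sub (J : idealr R) : (forall i, s i \in J) -> {subset span s <= J}.
Proof.
move=> h; apply: (span_ind (X := fun y => y \in J)); [exact: rpred0|exact: rpredD|].
by move=> a i; apply: idealMr.
Qed.

Lemma ipow_span_coef n x : ipow (span s) n.+1 x ->
  exists2 c : I -> R, x = \sum_i c i * s i & forall i, ipow (span s) n (c i).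
Proof.
pose X x := exists2 c : I -> R, x = \sum_i c i * s i & forall i, ipow (span s) n (c i).
apply: (ipowS_ind (X := X)) x => [|x y [c -> hc] [d -> hd]|a y /spanP[c ->] hy].
- exists (fun _ => 0); first by rewrite big1 // => i _; rewrite mul0r.
  by move=> i; apply: ipow_zero.
- exists (fun i => c i + d i); last by move=> i; apply: ipowD.
  by rewrite -big_split; apply: eq_bigr => i _; rewrite mulrDl.
exists (fun i => c i * y); last by move=> i; apply: ipowM.
by rewrite mulr_suml; apply: eq_bigr => i _; rewrite mulrAC.
Qed.

End Span.

(** * Formal integration *)

Section Integration.
Variables (k : fieldType) (char0 : [pchar k] =i pred0).

Lemma natk_neq0 n : n.+1%:R != 0 :> k.
Proof. by rewrite (pcharf0P k).1. Qed.

Lemma natr_inj0 (R : comAlgType k) n (x : R) : n.+1%:R * x = 0 -> x = 0.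
Proof.
move=> h; rewrite -(scale1r x) -(mulVf (natk_neq0 n)) -scalerA.
by rewrite scaler_nat -[x *+ _]mulr_natl h scaler0.
Qed.

Variables (R : comAlgType k) (I : {pred R}).
Hypothesis hR : @adic_complete R I R^o.

(* x is the Taylor series of the primitive of w, divided by z:
   z x = sum_i (-1)^i z^(i+1) / (i+1)! D^i w. *)
Lemma der_integral (D : R -> R) (z w : R) : der D -> z \in I -> D z = 1 ->
  exists x, D (z * x) = w /\ forall E : R -> R, der E ->
    (forall y, E (D y) = D (E y)) -> E z = 0 -> E w = 0 -> E x = 0.
Proof.
move=> hD Iz Dz.
pose c n : k := (-1) ^+ n * (n.+1)`!%:R^-1.
pose d n : k := (-1) ^+ n * n`!%:R^-1.
pose t n : R := c n *: (z ^+ n * iter n D w).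
pose u n : R := \sum_(i < n) t i.
have uS n : u n.+1 = u n + t n by rewrite /u big_ord_recr.
have It n : ipow I n (t n).
  by rewrite /t -mulr_algl; apply: ipowM; apply: ipowMr; apply: ipowX.
have [x hx] : exists x, forall n, ipow I n (x - u n).
  by apply: (adic_limit hR) => n; rewrite uS addrAC subrr add0r.
have cd n : c n * n.+1%:R = d n.
  rewrite /c /d factS natrM invfM -mulrA; congr (_ * _).
  by rewrite mulrAC mulVf ?natk_neq0 // mul1r.
have cd' n : c n = - d n.+1 by rewrite /c /d exprS mulN1r mulNr opprK.
(* The sum telescopes: D (z t_n) = d_n z^n D^n w - d_(n+1) z^(n+1) D^(n+1) w, since c_n (n+1) = d_n
   and c_n = - d_(n+1). *)
have Du n : D (z * u n) = w - d n *: (z ^+ n * iter n D w).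
  elim: n => [|n IH].
    rewrite /u big_ord0 mulr0 (der0 hD) /d expr0 mul1r fact0 invr1 scale1r.
    by rewrite expr0 mul1r subrr.
  rewrite uS mulrDr (derD hD) IH /t -scalerAr (der_scale _ _ hD) mulrA -exprS.
  rewrite (derM hD) -/(iter n.+1 D w) (derX _ _ hD) Dz mulr1 scalerDr.
  have -> : iter n D w * (n.+1%:R * z ^+ n) = n.+1%:R *: (z ^+ n * iter n D w).
    by rewrite scaler_nat -[_ *+ n.+1]mulr_natl; ring.
  by rewrite scalerA cd cd' scaleNr addrA addrAC addrNK.
exists x; split.
  apply: (adic_separatedB hR) => n.
  have -> : D (z * x) - w = D (z * (x - u n)) - d n *: (z ^+ n * iter n D w).
    by rewrite mulrBr (derB hD) Du; ring.
  apply: ipowB.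
    by apply: der_ipow => //; apply: ipow_mem.
  by rewrite -mulr_algl; apply: ipowM; apply: ipowMr; apply: ipowX.
move=> E hE ED Ez Ew; apply: (adic_separated hR) => n.
have Eit i : E (iter i D w) = 0.
  by elim: i => [|i IH] //=; rewrite ED IH (der0 hD).
have -> : E x = E (x - u n.+1).
  rewrite (derB hE) (der_sum hE) big1 ?subr0 // => i _.
  rewrite /t (der_scale _ _ hE) (derM hE) Eit mulr0 add0r.
  by case: (nat_of_ord i) => [|j]; rewrite ?expr0 ?(der1 hE) ?(derX _ _ hE) ?Ez ?mulr0 ?scaler0.
exact: der_ipow.
Qed.

End Integration.

Lemma poisson_leibniz (k : fieldType) (A : poissonAlgType k) (c a b : A) :
  {[c, {[a, b]}]} = {[{[c, a]}, b]} + {[a, {[c, b]}]}.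
Proof.
have := poisson_jacobi c a b.
rewrite (poissonC b c) poissonNr (poissonC b {[c, a]}) -addrA -opprD => /eqP.
by rewrite subr_eq0 => /eqP ->; rewrite addrC.
Qed.

(* With v = {f, g}^-1, the derivation E = v {-, g} satisfies E f = 1 and
   {x, g} = {f, g} E x, so it suffices to solve E x = v. *)
Lemma poisson_straighten (k : fieldType) (char0 : [pchar k] =i pred0)
    (A : poissonAlgType k) (m : idealr A) (hA : @adic_complete A m A^o) (f g v : A) :
  f \in m -> v * {[f, g]} = 1 ->
  exists x, [/\ x \in m, {[x, g]} = 1 &
    forall c, {[c, f]} = 0 -> {[c, g]} = 0 -> {[c, x]} = 0].
Proof.
move=> mf vfg.
have hE := der_mull v (poisson_derl g).
have [x [Ex xE]] := der_integral char0 hA v hE mf vfg.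
exists (f * x); split.
- by rewrite mulrC idealMr.
- by rewrite -[LHS]mul1r -{1}vfg mulrAC Ex.
move=> c cf cg; rewrite poissonMr cf mul0r add0r.
(* By the Jacobi identity c commutes with {f, g}, hence with its inverse v, and the derivations {c,
   -} and E commute. *)
have cv : {[c, v]} = 0.
  have : {[c, v * {[f, g]}]} = 0 by rewrite vfg poisson1r.
  rewrite poissonMr poisson_leibniz cf cg poisson0l poisson0r addr0 mul0r addr0.
  by move/(congr1 ( *%R v)); rewrite mulr0 mulrCA vfg mulr1.
rewrite (xE _ (poisson_der c)) ?mul0r // => y.
rewrite poissonMr cv mul0r add0r poisson_leibniz cg poisson0r addr0.
by rewrite mulrC.
Qed.

(** * Nakayama and Krull *)

Definition mk_idealr (R : comNzRingType) (S : {pred R}) (h : idealr_closed S) :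
  idealr R := HB.pack_for (idealr R) S (isIdealr.Build R S h).

Lemma mk_idealrE (R : comNzRingType) (S : {pred R}) (h : idealr_closed S) x :
  (x \in mk_idealr h) = (x \in S).
Proof. by []. Qed.

Definition sspan (R : comNzRingType) (s : seq R) (x : R) : Prop :=
  exists c : nat -> R, x = \sum_(i < size s) c i * s`_i.

Section SeqSpan.
Variable R : comNzRingType.

Lemma sspan_nil (x : R) : sspan [::] x <-> x = 0.
Proof.
split=> [[c ->]|->]; first by rewrite big_ord0.
by exists (fun _ => 0); rewrite big_ord0.
Qed.

Lemma sspan_cons (y : R) s x :
  sspan (y :: s) x <-> exists a z, sspan s z /\ x = a * y + z.
Proof.
split=> [[c ->]|[a [z [[c ->] ->]]]].
  exists (c 0%N), (\sum_(i < size s) c i.+1 * s`_i); split.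
    by exists (fun i => c i.+1).
  by rewrite /= big_ord_recl.
by exists (fun i => if i is i'.+1 then c i' else a); rewrite /= big_ord_recl.
Qed.

Lemma generates_mem s (I : idealr R) : generates s I -> forall y, y \in s -> y \in I.
Proof.
move=> h y ys; apply/h; exists (fun i => (i == index y s)%:R).
have ls : (index y s < size s)%N by rewrite index_mem.
rewrite (bigD1 (Ordinal ls)) //= eqxx mul1r nth_index // big1 ?addr0 // => i ne.
have -> : (i : nat) == index y s = false by apply/negbTE; exact: ne.
by rewrite mul0r.
Qed.

Lemma sspan_span (s : seq R) (x : R) :
  sspan s x <-> x \in span (fun i : 'I_(size s) => s`_i).
Proof.
split=> [[c ->]|/spanP[c ->]].
  by apply/spanP; exists (fun i : 'I_(size s) => c i).
exists (fun i => oapp c 0 (insub i)); apply: eq_bigr => i _.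
by rewrite valK.
Qed.

End SeqSpan.

Section Noetherian.
Variable R : comNzRingType.
Hypothesis hN : noetherian R.

Lemma noetherian_chain (I : nat -> idealr R) :
  (forall n, {subset I n <= I n.+1}) -> exists n, {subset I n.+1 <= I n}.
Proof.
move=> hI.
have hle n p : (n <= p)%N -> {subset I n <= I p}.
  move/subnK <-; elim: (p - n)%N => [|q IH] // x /IH; exact: hI.
pose U : {pred R} := fun x => `[< exists n, x \in I n >].
have hU : idealr_closed U.
  split.
  - by apply/asboolP; exists 0%N; exact: rpred0.
  - by apply/asboolPn => -[n]; rewrite idealr1.
  move=> a x y /asboolP[n nx] /asboolP[p py]; apply/asboolP; exists (maxn n p).
  apply: rpredD; first by apply: idealMr; apply: hle nx; apply: leq_maxl.
  by apply: hle py; apply: leq_maxr.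
have [s hs] := hN (mk_idealr hU).
have hs' (t : seq R) : (forall y, y \in t -> y \in U) ->
    exists n, forall y, y \in t -> y \in I n.
  elim: t => [|y t IH] ht; first by exists 0%N.
  have [n hn] := IH (fun z zt => ht z (mem_behead (s := y :: t) zt)).
  have /asboolP[p hp] := ht y (mem_head _ _).
  exists (maxn n p) => z; rewrite inE => /orP[/eqP ->|/hn].
    by apply: hle hp; apply: leq_maxr.
  by apply: hle; apply: leq_maxl.
have [n hn] := hs' s (generates_mem hs).
exists n => x nx.
have : x \in mk_idealr hU by apply/asboolP; exists n.+1.
move/hs => [c ->]; apply: rpred_sum => i _; apply: idealMr; apply: hn.
by rewrite mem_nth.
Qed.

Lemma noetherian_maximal (X : idealr R -> Prop) (I0 : idealr R) : X I0 ->
  exists2 I, X I & forall J, X J -> {subset I <= J} -> {subset J <= I}.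
Proof.
move=> X0; apply: contrapT => hno.
have step (n : nat) (I : idealr R) : X I -> exists J, X J /\
    ({subset I <= J} /\ ~ {subset J <= I}).
  move=> XI; apply: contrapT => hJ; apply: hno; exists I => // J XJ IJ.
  by apply: contrapT => JI; apply: hJ; exists J.
have [u [_ _ hu]] := @dependent_choice _ (fun _ => X)
  (fun _ I J => {subset I <= J} /\ ~ {subset J <= I}) I0 X0 step.
have [n hn] := @noetherian_chain u (fun n => (hu n).1).
exact: (hu n).2 hn.
Qed.

End Noetherian.

Section CompleteLocal.
Variables (k : fieldType) (A : comAlgType k) (m : idealr A).
Hypothesis hA : complete_local m.

Let hadic : @adic_complete A m A^o. Proof. by case: hA. Qed.
Let hnoeth : noetherian A. Proof. by case: hA. Qed.

Lemma residue_ex a : exists c : k, a - c%:A \in m.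
Proof. by case: hA => _ _ /(_ a)[c [hc _]] _; exists c. Qed.

Lemma scalar_mem (c : k) : c%:A \in m -> c = 0.
Proof.
have [//|c0 /(idealMr (c^-1)%:A)] := eqVneq c 0.
by rewrite mulr_algl scalerA mulVf // scale1r idealr1.
Qed.

(** Dividing by the residue c leaves 1 - v with v in m, which the geometric series inverts. *)
Lemma complete_unit a : a \notin m -> exists b, b * a = 1.
Proof.
move=> ma; have [c hc] := residue_ex a.
have c0 : c != 0 by apply: contraNneq ma => c0; rewrite c0 scale0r subr0 in hc.
pose v : A := 1 - c^-1 *: a.
have mv : v \in m.
  have -> : v = - (c^-1)%:A * (a - c%:A).
    by rewrite mulrBr !mulNr !mulr_algl scalerA mulVf // scale1r opprK addrC.
  by rewrite idealMr.
pose u n : A := \sum_(i < n) v ^+ i.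
have [l hl] : exists l, forall n, ipow m n (l - u n).
  apply: (adic_limit hadic) => n; rewrite /u big_ord_recr /= addrAC subrr add0r.
  exact: ipowX.
have l1 : l * (1 - v) = 1.
  apply: (adic_separatedB hadic) => n.
  have -> : l * (1 - v) - 1 = (l - u n) * (1 - v) - v ^+ n.
    rewrite mulrBl; have -> : u n * (1 - v) = 1 - v ^+ n.
      by rewrite -(opprB (v ^+ n) 1) subrX1 /u; ring.
    by ring.
  by apply: ipowB; [apply: ipowMr|apply: ipowX].
exists (c^-1 *: l); rewrite -scalerAl scalerAr -[RHS]l1; congr (_ * _).
by rewrite /v subKr.
Qed.

Lemma ideal_sub_max (I : idealr A) : {subset I <= m}.
Proof.
move=> x Ix; apply/negPn/negP => /complete_unit[b hb].
by have := idealr1 I; rewrite -hb idealMr.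
Qed.

Section Krull.

(** An [idealr] is proper by definition; the sums of ideals formed below may be the whole ring. *)
Definition ideal_like (X : A -> Prop) :=
  [/\ X 0, forall x y, X x -> X y -> X (x + y) & forall a x, X x -> X (a * x)].

(** Adding the head a of s to X gives, by induction, m^K inside X + (a). Then m^(jK) lies in X +
    (a^j), which is X once a^j is in X. *)
Lemma ipow_radical (s : seq A) (X : A -> Prop) : ideal_like X ->
  (forall a, a \in s -> exists j, X (a ^+ j)) ->
  (forall x, x \in m -> exists2 y, X y & sspan s (x - y)) ->
  exists K, forall x, ipow m K x -> X x.
Proof.
elim: s X => [|a s IH] X [X0 XD XM] hs hm.
  exists 1%N; move=> x /ipow1_ideal /hm[y Xy /sspan_nil /eqP].
  by rewrite subr_eq0 => /eqP ->.
pose Y x := exists c, X (x - c * a).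
have hY : ideal_like Y.
  split; first by exists 0; rewrite mul0r subr0.
    move=> x y [c hc] [d hd]; exists (c + d).
    have -> : x + y - (c + d) * a = (x - c * a) + (y - d * a) by ring.
    exact: XD.
  move=> b x [c hc]; exists (b * c).
  have -> : b * x - b * c * a = b * (x - c * a) by ring.
  exact: XM.
have [||K hK] := IH Y hY.
- move=> b bs; have [j hj] := hs b (mem_behead (s := a :: s) bs); exists j, 0.
  by rewrite mul0r subr0.
- move=> x /hm[y Xy /sspan_cons[c [z [sz e]]]]; exists (y + c * a).
    exists c; by rewrite addrK.
  by rewrite opprD addrA e addrAC subrr add0r.
have [j hj] := hs a (mem_head _ _).
exists (j * K)%N => x hx.
suff [c hc] : exists c, X (x - c * a ^+ j).
  by rewrite -(subrK (c * a ^+ j) x); apply: XD => //; apply: XM.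
elim: j x hx {hj} => [|j IHj] x.
  by move=> _; exists x; rewrite expr0 mulr1 subrr.
rewrite mulSn; apply: (ipow_add_ind (X := fun x => exists c, X (x - c * a ^+ j.+1))).
- by exists 0; rewrite mul0r subr0.
- move=> y z [c hc] [d hd]; exists (c + d).
  have -> : y + z - (c + d) * a ^+ j.+1 = (y - c * a ^+ j.+1) + (z - d * a ^+ j.+1).
    by ring.
  exact: XD.
move=> y z /hK[c hc] /IHj[d hd]; exists (c * d).
have -> : y * z - c * d * a ^+ j.+1 = z * (y - c * a) + (c * a) * (z - d * a ^+ j).
  by rewrite exprS; ring.
by apply: XD; apply: XM.
Qed.

(* I is maximal among the ideals containing W = m N + P with I N-part in W;
   it contains a power of each a in m, hence a power of m, so N lies in I. *)
Lemma krull_step (P : idealr A) (N : A -> Prop) (W : idealr A) :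
  ideal_like N -> {subset P <= W} -> (forall a x, a \in m -> N x -> a * x \in W) ->
  (forall x, N x -> forall n, exists2 p, p \in P & ipow m n (x - p)) ->
  forall x, N x -> x \in W.
Proof.
move=> [N0 ND NM] PW mNW NP.
pose X (I : idealr A) := {subset W <= I} /\ forall x, x \in I -> N x -> x \in W.
have [|I [WI IN] Imax] := noetherian_maximal hnoeth (X := X) (I0 := W).
  by split.
move=> x Nx; apply: contrapT => Wx.
have pw a : a \in m -> exists j, a ^+ j \in I.
  move=> ma; apply: contrapT => hj.
  (* The colon ideals (I : a^j) ascend, so two consecutive ones agree. For that j, the ideal I' = I
     + (a^j) still meets N inside W, and maximality of I puts a^j into I. *)
  pose Q j : {pred A} := fun y => a ^+ j * y \in I.
  have QE j y : (y \in Q j) = (a ^+ j * y \in I) by [].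
  have hQ j : idealr_closed (Q j).
    split; first by rewrite QE mulr0 rpred0.
      by apply/negP; rewrite QE mulr1 => aj; apply: hj; exists j.
    move=> b u v; rewrite !QE mulrDr mulrCA => hu hv.
    by rewrite rpredD // idealMr.
  have [|j hQj] := noetherian_chain hnoeth (I := fun j => mk_idealr (hQ j)).
    move=> j y; rewrite !mk_idealrE !QE exprS -mulrA => h.
    by rewrite idealMr.
  pose I' : {pred A} := fun y => `[< exists c, y - c * a ^+ j \in I >].
  have I'N y : y \in I' -> N y -> y \in W.
    move=> /asboolP[c hc] Ny; apply: IN => //.
    have : a ^+ j.+1 * c \in I.
      have -> : a ^+ j.+1 * c = a * y - a * (y - c * a ^+ j) by rewrite exprS; ring.
      by apply: rpredB; [apply: WI; apply: mNW|apply: idealMr].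
    move/(hQj c); rewrite mk_idealrE QE mulrC => h.
    by rewrite -(subrK (c * a ^+ j) y) rpredD.
  have hI' : idealr_closed I'.
    split; first by apply/asboolP; exists 0; rewrite mul0r subr0 rpred0.
      (* I' is proper, since otherwise it would contain x, which lies in N but not in W. *)
      apply/negP => /asboolP[c hc]; apply: Wx; apply: I'N => //.
      apply/asboolP; exists (x * c).
      have -> : x - x * c * a ^+ j = x * (1 - c * a ^+ j) by ring.
      exact: idealMr.
    move=> b u v /asboolP[c hc] /asboolP[d hd]; apply/asboolP; exists (b * c + d).
    have -> : b * u + v - (b * c + d) * a ^+ j =
      b * (u - c * a ^+ j) + (v - d * a ^+ j) by ring.
    by rewrite rpredD // idealMr.
  apply: hj; exists j; apply: (Imax (mk_idealr hI')).
  - split=> // y Wy; apply/asboolP; exists 0; rewrite mul0r subr0; exact: WI.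
  - by move=> y Iy; apply/asboolP; exists 0; rewrite mul0r subr0.
  by apply/asboolP; exists 1; rewrite mul1r subrr rpred0.
have [s hs] := hnoeth m.
have [|||K hK] := @ipow_radical s (fun y => y \in I).
- by split=> [|y z|a y]; [exact: rpred0|exact: rpredD|exact: idealMr].
- by move=> a /(generates_mem hs)/pw.
- by move=> y /hs hy; exists 0; rewrite ?rpred0 // subr0.
apply: Wx; apply: IN => //; have [p Pp hp] := NP x Nx K.
by rewrite -(subrK p x); apply: rpredD; [apply: hK|apply/WI/PW].
Qed.

Definition max_mul (N : A -> Prop) (x : A) : Prop :=
  exists t : seq (A * A), (forall p, p \in t -> p.1 \in m /\ N p.2) /\
    x = \sum_(p <- t) p.1 * p.2.

Lemma max_mul_ind (N X : A -> Prop) :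
  X 0 -> (forall x y, X x -> X y -> X (x + y)) ->
  (forall a x, a \in m -> N x -> X (a * x)) -> forall x, max_mul N x -> X x.
Proof.
move=> X0 XD XM x [t [ht ->]]; rewrite big_seq; apply: big_ind => // p /ht[]; exact: XM.
Qed.

Lemma max_mul_like (N : A -> Prop) : ideal_like N -> ideal_like (max_mul N).
Proof.
move=> [N0 ND NM]; split; first by exists [::]; rewrite big_nil.
  move=> x y [t [ht ->]] [u [hu ->]]; exists (t ++ u); rewrite big_cat; split=> // p.
  by rewrite mem_cat => /orP[/ht|/hu].
move=> a x [t [ht ->]]; exists [seq (p.1, a * p.2) | p <- t]; split.
  by move=> p /mapP[q /ht[mq Nq] ->]; split=> //=; apply: NM.
by rewrite big_map mulr_sumr; apply: eq_bigr => p _ /=; rewrite mulrCA.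
Qed.

(** Generators are eliminated one at a time: modulo P, the head y equals u y plus a combination of
    the others with u in m, and 1 - u is a unit. *)
Lemma nakayama (P : idealr A) (N : A -> Prop) (s : seq A) :
  (forall y, y \in s -> N y) ->
  (forall x, N x -> exists2 p, p \in P & sspan s (x - p)) ->
  (forall x, N x -> exists2 p, p \in P & max_mul N (x - p)) ->
  forall x, N x -> x \in P.
Proof.
move=> sN hs hN; elim: s sN hs => [|y s IH] sN hs x.
  by move=> /hs[p Pp /sspan_nil /eqP]; rewrite subr_eq0 => /eqP ->.
have ssD u v : sspan s u -> sspan s v -> sspan s (u + v).
  by move=> /sspan_span hu /sspan_span hv; apply/sspan_span/spanD.
have ssM a u : sspan s u -> sspan s (a * u).
  by move=> /sspan_span hu; apply/sspan_span/spanM.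
have red z : max_mul N z -> exists2 p, p \in P &
    exists2 u, u \in m & sspan s (z - u * y - p).
  move: z; apply: max_mul_ind => [|z z' [p Pp [u mu h]] [p' Pp' [u' mu' h']]|a z ma /hs].
  - exists 0; rewrite ?rpred0 //; exists 0; rewrite ?rpred0 //.
    by rewrite mul0r !subr0; apply/sspan_span/span0.
  - exists (p + p'); rewrite ?rpredD //; exists (u + u'); rewrite ?rpredD //.
    have -> : z + z' - (u + u') * y - (p + p') =
      (z - u * y - p) + (z' - u' * y - p') by ring.
    exact: ssD.
  move=> [p Pp /sspan_cons[c [w [sw e]]]].
  exists (a * p); rewrite ?idealMr //; exists (a * c); first by rewrite mulrC idealMr.
  have -> : a * z - a * c * y - a * p = a * (z - p - c * y) by ring.
  by apply: ssM; rewrite e addrAC subrr add0r.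
have [p Pp sy] : exists2 p, p \in P & sspan s (y - p).
  have [p Pp /red[q Pq [u mu h]]] := hN y (sN y (mem_head _ _)).
  have [|v hv] := @complete_unit (1 - u).
    apply/negP => h1; have := idealr1 m; rewrite -(subrK u 1).
    by rewrite rpredD.
  exists (v * (p + q)); first by rewrite idealMr // rpredD.
  have -> : y - v * (p + q) = v * (y - p - u * y - q).
    rewrite -{1}[y]mul1r -hv; ring.
  exact: ssM.
apply: IH => [z zs|z].
  by apply: sN; rewrite inE zs orbT.
move=> /hs[q Pq /sspan_cons[c [w [sw e]]]]; exists (q + c * p).
  by rewrite rpredD // idealMr.
have -> : z - (q + c * p) = c * (y - p) + w.
  by rewrite opprD addrA e; ring.
by apply: ssD => //; apply: ssM.
Qed.

(** Every ideal is closed. Its closure N satisfies N = m N + P by [krull_step], which stands in for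
    the Artin-Rees lemma, and Nakayama's lemma then gives N = P. *)
Lemma krull_intersection (P : idealr A) x :
  (forall n, exists2 p, p \in P & ipow m n (x - p)) -> x \in P.
Proof.
pose N : {pred A} := fun x => `[< forall n, exists2 p, p \in P & ipow m n (x - p) >].
have NlikeN : ideal_like (fun x => x \in N).
  split.
  - by apply/asboolP => n; exists 0; rewrite ?rpred0 // subrr; apply: ipow_zero.
  - move=> y z /asboolP hy /asboolP hz; apply/asboolP => n.
    have [p Pp hp] := hy n; have [q Pq hq] := hz n; exists (p + q); rewrite ?rpredD //.
    by rewrite opprD addrACA; apply: ipowD.
  move=> a y /asboolP hy; apply/asboolP => n; have [p Pp hp] := hy n.
  by exists (a * p); rewrite ?idealMr // -mulrBr; apply: ipowM.
have [N0 ND NM] := NlikeN.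
have [W0 WD WM] := max_mul_like NlikeN.
have Nm y : y \in N -> y \in m.
  move=> /asboolP/(_ 1%N)[p Pp /ipow1_ideal h].
  by rewrite -(subrK p y) rpredD //; apply: ideal_sub_max Pp.
have hNid : idealr_closed N.
  split=> //; first by apply/negP => /Nm; rewrite idealr1.
  by move=> a y z Ny Nz; apply: ND => //; apply: NM.
have PN y : y \in P -> y \in N.
  by move=> Py; apply/asboolP => n; exists y => //; rewrite subrr; apply: ipow_zero.
pose W : {pred A} := fun x => `[< exists2 p, p \in P & max_mul (fun x => x \in N) (x - p) >].
have WN y : y \in W -> y \in N.
  move=> /asboolP[p Pp h]; rewrite -(subrK p y); apply: (ND _ _); last exact: PN.
  by apply: (max_mul_ind (X := fun y => y \in N) N0 ND _ h) => a z _; exact: NM.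
have hW : idealr_closed W.
  split.
  - by apply/asboolP; exists 0; rewrite ?rpred0 // subrr.
  - by apply/negP => /WN/Nm; rewrite idealr1.
  move=> a y z /asboolP[p Pp hp] /asboolP[q Pq hq]; apply/asboolP.
  exists (a * p + q); first by rewrite rpredD // idealMr.
  have -> : a * y + z - (a * p + q) = a * (y - p) + (z - q) by ring.
  by apply: WD => //; apply: WM.
have [s hs] := hnoeth (mk_idealr hNid).
move=> hx; have Nx : x \in N by apply/asboolP.
apply: (@nakayama P (fun x => x \in N) s) => //.
- exact: (generates_mem hs).
- by move=> y /hs hy; exists 0; rewrite ?rpred0 // subr0.
move=> y Ny; apply/asboolP.
apply: (@krull_step P (fun x => x \in N) (mk_idealr hW)) => //.
- by move=> z Pz; apply/asboolP; exists z => //; rewrite subrr.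
- move=> a z ma Nz; apply/asboolP; exists 0; rewrite ?rpred0 // subr0.
  by exists [:: (a, z)]; rewrite big_seq1; split=> // p; rewrite inE => /eqP ->.
by move=> z /asboolP.
Qed.

End Krull.
End CompleteLocal.

(** A Cauchy sequence has a subsequence whose n-th step lies in I^n; summing the moduli [N] makes
    the chosen indices [M] monotone. *)
Lemma complete_of_steps (R : comNzRingType) (I : {pred R}) :
  (forall u : nat -> R, (forall n, ipow I n (u n.+1 - u n)) ->
    exists l, forall n, ipow I n (l - u n)) ->
  (forall x, (forall n, ipow I n x) -> x = 0) -> @adic_complete R I R^o.
Proof.
move=> hlim hsep; split=> // u hu.
pose N n := projT1 (cid (hu n)).
have hN n i j : (N n <= i)%N -> (N n <= j)%N -> ipow I n (u i - u j).
  by move=> hi hj; exact: (projT2 (cid (hu n)) i j hi hj).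
pose M n := (\sum_(i < n.+1) N i)%N.
have NM n : (N n <= M n)%N by rewrite /M big_ord_recr leq_addl.
have MS n : (M n <= M n.+1)%N by rewrite /M [leqRHS]big_ord_recr leq_addr.
have [|l hl] := hlim (u \o M).
  by move=> n; apply: hN => //; apply: leq_trans (MS n).
exists l => n; exists (M n) => i hi.
apply: (@ipow_trans _ _ _ (u (M n))); last exact/ipow_sym/hl.
by apply: hN => //; apply: leq_trans hi.
Qed.

(** * Quotients of a complete local Poisson algebra *)

Section QuotientComplete.
Variables (k : fieldType) (A : poissonAlgType k) (m : idealr A).
Hypothesis hA : complete_local m.
Variables (P : poissonIdeal A).
Local Notation Q := (poisson_quot P).
Local Notation pi := (quot_pi P).

Lemma quot_pi_mem0 a : pi a = 0 <-> a \in P.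
Proof.
split=> [/eqP|aP]; first by rewrite -(quot_pi0 P) quot_piE subr0.
by rewrite -(quot_pi0 P); apply: quot_pi_eq; rewrite subr0.
Qed.

Lemma quot_piB : {morph pi : a b / a - b}.
Proof. by move=> a b; rewrite quot_piD quot_piN. Qed.

Lemma quot_pi_sum (K : Type) (r : seq K) (S : pred K) (F : K -> A) :
  pi (\sum_(i <- r | S i) F i) = \sum_(i <- r | S i) pi (F i).
Proof. by apply: (big_morph pi (quot_piD P) (quot_pi0 P)). Qed.

Lemma quot_pi_alg (c : k) : pi c%:A = c%:A.
Proof. by rewrite quot_piZ quot_pi1. Qed.

Lemma quot_ideal_sub (N : idealr Q) b : pi b \in N -> b \in m.
Proof.
pose I : {pred A} := fun a => pi a \in N.
have IE b' : (b' \in I) = (pi b' \in N) by [].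
have hI : idealr_closed I.
  split; rewrite ?IE ?quot_pi0 ?rpred0 ?quot_pi1 ?idealr1 // => a x y.
  by rewrite !IE quot_piD quot_piM => hx hy; rewrite rpredD ?idealMr.
exact: (@ideal_sub_max _ _ _ hA (mk_idealr hI)).
Qed.

Lemma quot_image_max : exists M : idealr Q, forall b, (pi b \in M) = (b \in m).
Proof.
have reprm b : (quot_repr (pi b) \in m) = (b \in m).
  have h := ideal_sub_max hA (quot_reprB P b).
  apply/idP/idP => hb; last by rewrite -(subrK b (quot_repr _)) rpredD.
  by rewrite -(subKr (quot_repr (pi b)) b) rpredB.
pose M : {pred Q} := fun x => quot_repr x \in m.
have ME b : (pi b \in M) = (b \in m) by rewrite -reprm.
have hM : idealr_closed M.
  split; rewrite -?(quot_pi0 P) -?(quot_pi1 P) ?ME ?rpred0 ?idealr1 //.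
  elim/quot_ind => b; elim/quot_ind => x; elim/quot_ind => y.
  by rewrite -quot_piM -quot_piD !ME => hx hy; rewrite rpredD ?idealMr.
by exists (mk_idealr hM) => b; rewrite mk_idealrE ME.
Qed.

Lemma quot_max_ex : exists n : idealr Q, maximal_ideal n.
Proof.
have [M ME] := quot_image_max; exists M => N _; elim/quot_ind => a.
by rewrite ME; exact: quot_ideal_sub.
Qed.

Variables (n : idealr Q).
Hypothesis nmax : maximal_ideal n.

(** Holonomicity quantifies over every maximal ideal of a quotient; this identifies each of them
    with the image of m. *)
Lemma quot_max_mem a : (pi a \in n) = (a \in m).
Proof.
have [M ME] := quot_image_max.
apply/idP/idP => [|ma]; first exact: quot_ideal_sub.
apply: (@nmax M); last by rewrite ME.
by elim/quot_ind => b /quot_ideal_sub; rewrite ME.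
Qed.

Lemma quot_ipow l a : ipow n l (pi a) <-> exists2 p, p \in P & ipow m l (a - p).
Proof.
split; last first.
  move=> [p Pp h]; have -> : pi a = pi (a - p).
    by rewrite quot_piB (quot_pi_mem0 p).2 ?subr0.
  apply: ipow_morph h; [exact: quot_pi0|exact: quot_piD|exact: quot_piM|].
  by move=> x; rewrite quot_max_mem.
suff key y : ipow n l y -> forall a, pi a = y ->
    exists2 p, p \in P & ipow m l (a - p) by move/key; apply.
elim: l y {a} => [|l IH] y; first by exists 0; rewrite ?rpred0.
move: y; apply: ipowS_ind => [|y z hy hz|y z].
- by move=> a /quot_pi_mem0 Pa; exists a => //; rewrite subrr; apply: ipow_zero.
- move=> a e; have [p Pp hp] := hy _ (quot_reprK y).
  have [q Pq hq] := hz _ (quot_reprK z).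
  exists (p + q + (a - (quot_repr y + quot_repr z))).
    apply: rpredD; first exact: rpredD; apply/quot_pi_mem0.
    by rewrite quot_piB quot_piD !quot_reprK e subrr.
  have -> : a - (p + q + (a - (quot_repr y + quot_repr z))) =
    (quot_repr y - p) + (quot_repr z - q) by ring.
  exact: ipowD.
elim/quot_ind: y => y; elim/quot_ind: z => z; rewrite quot_max_mem => my hz a e.
have [p Pp hp] := IH _ hz z erefl.
exists (a - y * (z - p)).
  apply/quot_pi_mem0; rewrite !(quot_piB, quot_piM) e.
  by rewrite [pi p](quot_pi_mem0 p).2 // subr0 subrr.
by rewrite subKr; apply: ipow_mem.
Qed.

(** Separatedness is the closedness of P. A sequence is lifted term by term, each lift being
    corrected by an element of P so that the steps stay small in A. *)
Lemma quot_complete : @adic_complete Q n Q^o.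
Proof.
apply: complete_of_steps => [u hu|]; last first.
  elim/quot_ind => a ha; apply/quot_pi_mem0; apply: (krull_intersection hA) => l.
  exact/quot_ipow.
have [|l a e|v [_ vu vS]] := @dependent_choice A (fun l a => pi a = u l)
    (fun l a b => ipow m l (b - a)) (quot_repr (u 0%N)).
- exact: quot_reprK.
- have := hu l; rewrite -e -(quot_reprK (u l.+1)) -quot_piB => /quot_ipow[p Pp hp].
  exists (quot_repr (u l.+1) - p); split; last by rewrite addrAC.
  by rewrite quot_piB (quot_pi_mem0 p).2 // subr0 quot_reprK.
have [|x hx] := adic_limit _ vS; first by case: hA.
exists (pi x) => l; rewrite -vu -quot_piB; apply/quot_ipow.
by exists 0; rewrite ?rpred0 // subr0.
Qed.

Lemma quot_residue x : exists c : k, x - c%:A \in n.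
Proof.
elim/quot_ind: x => a; have [c hc] := residue_ex hA a.
by exists c; rewrite -quot_pi_alg -quot_piB quot_max_mem.
Qed.

Lemma quot_span (I : finType) (s : I -> A) : (forall a, a \in m <-> a \in span s) ->
  forall x, x \in n <-> x \in span (pi \o s).
Proof.
move=> hs; elim/quot_ind => a; rewrite quot_max_mem; split.
  move=> /hs/spanP[c ->]; apply/spanP; exists (pi \o c).
  by rewrite quot_pi_sum; apply: eq_bigr => i _; rewrite quot_piM.
rewrite -quot_max_mem; move: (pi a); apply: span_sub => i.
by rewrite quot_max_mem; apply/hs/span_gen.
Qed.

End QuotientComplete.

Lemma prime_quot_domain (k : fieldType) (A : poissonAlgType k) (P : primePoissonIdeal A) :
  GRing.integral_domain_axiom (poisson_quot P).
Proof.
elim/quot_ind => a; elim/quot_ind => b.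
rewrite -quot_piM => /quot_pi_mem0; rewrite prime_idealrM => /orP[h|h]; apply/orP.
  by left; apply/eqP/quot_pi_mem0.
by right; apply/eqP/quot_pi_mem0.
Qed.

(** * Dimension theory *)

Section Evaluation.
Variables (k : fieldType) (A : comAlgType k) (n : nat).
Implicit Types (t : 'I_n -> A) (p q : {mpoly k[n] }).

Definition peval t : {mpoly k[n] } -> A := mmap (in_alg A) t.

Lemma pevalE t p :
  peval t p = \sum_(mo <- msupp p) p@_mo *: \prod_i t i ^+ (mo i).
Proof. by apply: eq_bigr => mo _; rewrite mulr_algl. Qed.

Lemma pevalD t : {morph peval t : p q / p + q}. Proof. exact: mmapD. Qed.
Lemma pevalB t : {morph peval t : p q / p - q}. Proof. exact: mmapB. Qed.
Lemma peval0 t : peval t 0 = 0. Proof. exact: mmap0. Qed.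
Lemma peval_sum t (K : Type) (r : seq K) (S : pred K) (F : K -> {mpoly k[n] }) :
  peval t (\sum_(i <- r | S i) F i) = \sum_(i <- r | S i) peval t (F i).
Proof. by apply: (big_morph _ (pevalD t) (peval0 t)). Qed.
Lemma pevalM t : {morph peval t : p q / p * q}. Proof. exact: rmorphM. Qed.
Lemma peval1 t : peval t 1 = 1. Proof. exact: rmorph1. Qed.
Lemma pevalC t c : peval t c%:MP = c%:A. Proof. exact: mmapC. Qed.
Lemma pevalZ t c p : peval t (c *: p) = c *: peval t p.
Proof. by rewrite -[RHS]mulr_algl; apply: mmapZ. Qed.
Lemma pevalU t i : peval t 'X_i = t i.
Proof. by rewrite /peval mmapX mmap1U. Qed.
Lemma pevalX t mo : peval t 'X_[mo] = \prod_i t i ^+ (mo i).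
Proof. exact: mmapX. Qed.

Lemma mpoly_alg_ind (X : {mpoly k[n] } -> Prop) :
  (forall c, X c%:MP) -> (forall p q, X p -> X q -> X (p + q)) ->
  (forall p q, X p -> X q -> X (p * q)) -> (forall i, X 'X_i) -> forall p, X p.
Proof.
move=> XC XD XM XU; elim/mpolyind => [|c mo p _ _ hp].
  by rewrite -mpolyC0; apply: XC.
apply: XD => //; rewrite -mul_mpolyC; apply: (XM _ _) => //.
rewrite mpolyXE_id; apply: (big_ind X); [by rewrite -mpolyC1; apply: XC|exact: XM|].
move=> i _; elim: (mo i) => [|e IH]; first by rewrite expr0 -mpolyC1; apply: XC.
by rewrite exprS; apply: XM.
Qed.

Lemma ipow_prod (I : {pred A}) t (mo : 'X_{1..n}) : (forall i, t i \in I) ->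
  ipow I (mdeg mo) (\prod_i t i ^+ (mo i)).
Proof.
move=> It; rewrite mdegE.
apply: (big_ind2 (fun x (d : nat) => ipow I d x)) => [|x d y e hx hy|i _] //.
  exact: ipow_mul.
exact: ipowX.
Qed.

Lemma ipow_peval (I : {pred A}) t p l : (forall i, t i \in I) ->
  (forall mo, mo \in msupp p -> (l <= mdeg mo)%N) -> ipow I l (peval t p).
Proof.
move=> It hp; rewrite pevalE big_seq; apply: ipow_sum => mo /hp hl.
by rewrite -mulr_algl; apply: ipowM; apply: (ipow_le hl); apply: ipow_prod.
Qed.

Lemma low_form p l : (forall mo, mo \in msupp p -> (l <= mdeg mo)%N) \/
  exists d q, [/\ (d < l)%N, q \is d.-homog, q != 0 &
    forall t, ipow (span t) d.+1 (peval t p - peval t q)].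
Proof.
have [h|h] := pselect (forall mo, mo \in msupp p -> (l <= mdeg mo)%N); first by left.
right; have [mo0 mo0p lmo] : exists2 mo, mo \in msupp p & (mdeg mo < l)%N.
  apply: contrapT => no; apply: h => mo mop; rewrite leqNgt; apply/negP => hl.
  by apply: no; exists mo.
pose X d := has (fun mo => mdeg mo == d) (msupp p).
have exX : exists d, X d by exists (mdeg mo0); apply/hasP; exists mo0.
have [d /hasP[mo mop /eqP mod_] dmin] := ex_minnP exX.
exists d, (pihomog mdeg d p); split.
- apply: leq_ltn_trans lmo; apply: dmin; apply/hasP; by exists mo0.
- exact: pihomogP.
- apply/negP => /eqP /(congr1 (mcoeff mo)); rewrite mcoeff0 pihomogE.
  rewrite raddf_sum /= -big_filter (bigD1_seq mo) ?filter_uniq ?msupp_uniq //=; last first.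
    by rewrite mem_filter mod_ eqxx.
  rewrite mcoeffZ mcoeffX eqxx mulr1 big1 ?addr0 => [/eqP|mo' ne].
    by rewrite mcoeff_eq0 mop.
  by rewrite mcoeffZ mcoeffX (negPf ne) mulr0.
move=> t; rewrite -pevalB; have -> : p - pihomog mdeg d p =
    \sum_(mo <- msupp p | mdeg mo != d) p@_mo *: 'X_[mo].
  rewrite pihomogE {1}[p]mpolyE (bigID (fun mo => mdeg mo == d)) /=.
  by rewrite addrAC subrr add0r.
rewrite peval_sum big_seq_cond; apply: ipow_sum => mo' /andP[mo'p ne].
rewrite pevalZ pevalX -mulr_algl; apply: ipowM.
have hd : (d < mdeg mo')%N.
  by rewrite ltn_neqAle eq_sym ne dmin //; apply/hasP; exists mo'.
by apply: (ipow_le hd); apply: ipow_prod => i; apply: span_gen.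
Qed.

Lemma peval_homog_line (mu : 'I_n -> k) (x : A) d p : p \is d.-homog ->
  peval (fun i => mu i *: x) p = p.@[mu] *: x ^+ d.
Proof.
move=> /dhomogP hp; rewrite pevalE mevalE scaler_suml big_seq [RHS]big_seq.
apply: eq_bigr => mo /hp e; rewrite -scalerA; congr (_ *: _).
have {e}-> : d = (\sum_i mo i)%N by rewrite -e; exact: mdegE.
apply: (big_ind3 (fun (y : A) (c : k) (e : nat) => y = c *: x ^+ e)) => //.
- by rewrite expr0 scale1r.
- move=> _ c e _ c' e' -> ->; rewrite -scalerAl -scalerAr scalerA exprD.
  by rewrite mulrC.
by move=> i _; rewrite exprZn.
Qed.

Lemma peval_congr (I : {pred A}) t t' p :
  (forall x y, x \in I -> y \in I -> x + y \in I) ->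
  (forall a x, x \in I -> a * x \in I) -> 0 \in I ->
  (forall i, t i - t' i \in I) -> peval t p - peval t' p \in I.
Proof.
move=> ID IM I0 h; elim/mpoly_alg_ind: p => [c|p q hp hq|p q hp hq|i].
- by rewrite !pevalC subrr.
- by rewrite !pevalD opprD addrACA; apply: ID.
- rewrite !pevalM.
  have -> : peval t p * peval t q - peval t' p * peval t' q =
    peval t q * (peval t p - peval t' p) + peval t' p * (peval t q - peval t' q).
    by ring.
  by apply: ID; apply: IM.
by rewrite !pevalU.
Qed.

End Evaluation.

(** * Polynomial functions over a field of characteristic 0 *)

Section Nonvanishing.
Variables (k : fieldType) (char0 : [pchar k] =i pred0).

Lemma horner_infinite (q : {poly k}) : (forall s, q.[s] = 0) -> q = 0.
Proof.
move=> hq; apply/eqP; apply: contraT => q0.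
have inj : injective (fun i : nat => i%:R : k).
  move=> i j; wlog le_ij : i j / (i <= j)%N.
    by move=> h e; have [/h->|/ltnW/h->] := leqP i j.
  move=> /eqP; rewrite -subr_eq0 -opprB oppr_eq0 -natrB // => /eqP e.
  apply/eqP; rewrite eqn_leq le_ij -subn_eq0.
  by rewrite -((pcharf0P k).1 char0) e eqxx.
have := max_poly_roots (rs := [seq i%:R | i <- iota 0 (size q)]) q0.
rewrite size_map size_iota ltnn => -> //.
  by apply/allP => x _; rewrite /root hq.
by rewrite map_inj_uniq ?iota_uniq.
Qed.

(** If p vanishes everywhere, so does its restriction to each line parallel to an axis, as a
    univariate polynomial over an infinite field. Hence the partial derivatives vanish everywhere
    and are 0 by induction on the size, so that p is a constant. *)
Lemma meval_neq0 n (p : {mpoly k[n] }) : p != 0 -> exists v, p.@[v] != 0.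
Proof.
move=> p0; apply: contrapT => hno.
have hp v : p.@[v] = 0.
  by apply/eqP; apply/negPn/negP => h; apply: hno; exists v.
case/eqP: p0; elim: {p}(msize p) {-2}p (leqnn (msize p)) hp {hno} => [|e IH] p.
  by rewrite leqn0 msize_poly_eq0 => /eqP.
move=> le_p hp.
have deriv0 i : p^`M(i) = 0.
  apply: IH.
    rewrite mmeasureE; apply/bigmax_leqP_seq => mo; rewrite mcoeff_msupp => + _.
    rewrite mcoeff_mderiv => h; have : (mo + U_(i))%MM \in msupp p.
      by rewrite mcoeff_msupp; apply: contraNneq h => ->; rewrite mul0rn.
    move/msize_mdeg_lt; rewrite mdegD mdeg1 addn1 => h'.
    by have := leq_trans h' le_p; rewrite ltnS.
  move=> v; pose h j : {poly k} := (v j)%:P + ((j == i)%:R)%:P * 'X.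
  have hs q s : (peval h q).[s] = q.@[fun j => v j + (j == i)%:R * s].
    elim/mpoly_alg_ind: q => [c|q r hq hr|q r hq hr|j].
    - by rewrite pevalC mevalC hornerZ hornerC mulr1.
    - by rewrite pevalD mevalD hornerD hq hr.
    - by rewrite pevalM mevalM hornerM hq hr.
    by rewrite pevalU mevalXU /h hornerD hornerC hornerM hornerC hornerX.
  have hd q : (peval h q)^`() = peval h (q^`M(i)).
    elim/mpoly_alg_ind: q => [c|q r hq hr|q r hq hr|j].
    - by rewrite pevalC mderivC peval0 derivZ derivC scaler0.
    - by rewrite mderivD !pevalD derivD hq hr.
    - by rewrite mderivM pevalD !pevalM derivM hq hr.
    rewrite pevalU /h derivD derivM !derivC derivX mul0r !add0r mulr1.
    rewrite mderivX mnm1E; have [->|_] := eqVneq j i; last first.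
      by rewrite scale0r peval0.
    rewrite scale1r pevalX big1 // => l _.
    by rewrite mnmBE !mnm1E subnn expr0.
  have := hs (p^`M(i)) 0; rewrite -hd.
  have -> : peval h p = 0.
    by apply: horner_infinite => s; rewrite hs hp.
  by rewrite deriv0 horner0 => ->; apply: meval_eq => j; rewrite mulr0 addr0.
have coef0 mo : mo != 0%MM -> p@_mo = 0.
  move=> mo0; have [i hi] : exists i, (0 < mo i)%N.
    apply: contrapT => no; case/eqP: mo0; apply/mnmP => i; rewrite mnm0E.
    by case mi : (mo i) => [//|x]; case: no; exists i; rewrite mi.
  have moE : mo = ((mo - U_(i)) + U_(i))%MM.
    apply/mnmP => l; rewrite mnmDE mnmBE mnm1E.
    by case: (eqVneq i l) => [<-|_]; rewrite ?subnK ?subn0 ?addn0.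
  have := mcoeff_mderiv i p (mo - U_(i))%MM.
  rewrite deriv0 mcoeff0 -moE => /esym /eqP.
  by rewrite -mulr_natr mulf_eq0 (pcharf0P k).1 // orbF => /eqP.
have pE : p = (p@_0%MM)%:MP.
  apply/mpolyP => mo; rewrite mcoeffC; have [->|mo0] := eqVneq 0%MM mo.
    by rewrite mulr1.
  by rewrite mulr0 coef0 // eq_sym.
by have := hp (fun _ => 0); rewrite pE mevalC => ->; rewrite mpolyC0.
Qed.

End Nonvanishing.

(** Extension by continuity from a dense image. The last hypothesis makes f (D s) depend only on f
    s, and [rel] is the graph of the extension: its two precisions differ by one because a
    derivation loses one power. *)
Lemma der_extend (k : fieldType) (S R : comAlgType k) (I : {pred R})
    (hR : @adic_complete R I R^o) (f : S -> R) (D : S -> S) :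
  {morph f : x y / x + y} -> {morph f : x y / x * y} ->
  (forall c : k, f c%:A = c%:A) -> der D ->
  (forall a n, exists s, ipow I n (a - f s)) ->
  (forall n s, ipow I n.+1 (f s) -> ipow I n (f (D s))) ->
  exists E : R -> R, der E /\ forall s, E (f s) = f (D s).
Proof.
move=> fD fM fC hD dense cont.
have f0 : f 0 = 0 by rewrite -(scale0r 1) fC scale0r.
have fN x : f (- x) = - f x by apply/eqP; rewrite -addr_eq0 -fD addNr f0.
have fB x y : f (x - y) = f x - f y by rewrite fD fN.
pose rel a e := forall n, exists s, ipow I n.+1 (a - f s) /\ ipow I n (e - f (D s)).
have rel_ex a : exists e, rel a e.
  have [s hs] : exists s : nat -> S, forall n, ipow I n.+1 (a - f (s n)).
    by exists (fun n => projT1 (cid (dense a n.+1))) => n; exact: (projT2 (cid (dense a n.+1))).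
  have [|e he] := adic_limit hR (u := fun n => f (D (s n))).
    move=> n; rewrite -fB -(derB hD); apply: cont; rewrite fB.
    apply: (@ipow_trans _ _ _ a).
      by apply/ipow_sym/ipowS; apply: hs.
    exact: hs.
  by exists e => n; exists (s n).
have rel_uniq a e e' : rel a e -> rel a e' -> e = e'.
  move=> h h'; apply: (adic_separatedB hR) => n.
  have [s [hs he]] := h n; have [s' [hs' he']] := h' n.
  apply: (ipow_trans he); apply/ipow_sym; apply: (ipow_trans he').
  rewrite -fB -(derB hD); apply: cont; rewrite fB.
  by apply: (@ipow_trans _ _ _ a) => //; apply: ipow_sym.
pose E a := projT1 (cid (rel_ex a)).
have EP a : rel a (E a) by exact: projT2 (cid (rel_ex a)).
have rel_f s : rel (f s) (f (D s)).
  by move=> n; exists s; rewrite !subrr; split; exact: ipow_zero.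
have Ef s : E (f s) = f (D s) by exact: (rel_uniq _ _ _ (EP _) (rel_f s)).
exists E; split=> //; split=> [a b|c|a b].
- apply: (rel_uniq _ _ _ (EP _)) => n.
  have [s [hs he]] := EP a n; have [t [ht he']] := EP b n.
  exists (s + t); rewrite (derD hD) !fD !opprD (addrACA a) (addrACA (E a)).
  by split; apply: ipowD.
- by rewrite -fC Ef (derC hD).
apply: (rel_uniq _ _ _ (EP _)) => n.
have [s [hs he]] := EP a n; have [t [ht he']] := EP b n.
exists (s * t); rewrite fM (derM hD) fD !fM; split.
  have -> : a * b - f s * f t = b * (a - f s) + f s * (b - f t) by ring.
  by apply: ipowD; apply: ipowM.
have -> : a * E b + b * E a - (f s * f (D t) + f t * f (D s)) =
  E b * (a - f s) + f s * (E b - f (D t)) + (E a * (b - f t) + f t * (E a - f (D s))).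
  by ring.
apply: ipowD; apply: ipowD; apply: ipowM => //; exact: ipowS.
Qed.

Section Dimension.
Variables (k : fieldType) (char0 : [pchar k] =i pred0).
Variables (A : comAlgType k) (m : idealr A).
Hypothesis hA : complete_local m.
Let hadic : @adic_complete A m A^o. Proof. by case: hA. Qed.

(* A linear change of coordinates makes the form monic in one variable. *)
Lemma form_reduces_params n (t : 'I_n.+1 -> A) d (p : {mpoly k[n.+1] }) (I : A -> Prop) :
  (forall i, t i \in m) -> p \is d.-homog -> p != 0 -> ideal_like I ->
  (exists2 y, I y & ipow (span t) d.+1 (peval t p - y)) ->
  exists t' : 'I_n -> A, (forall i, t' i \in m) /\
    forall x, ipow (span t) d x -> exists2 y, I y & x - y \in span t'.
Proof.
move=> mt hp p0 [I0 ID IM] [y0 Iy0 hy0].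
have tm := span_sub mt.
have [v pv] := meval_neq0 char0 p0.
have line := fun mu (x : A) => peval_homog_line mu x hp.
(* In degree 0 the form is a nonzero scalar, so y0 is a unit and I is the whole ring; any n of the
   parameters will do. *)
have [d0|d_gt0] := posnP d.
  rewrite {}d0 in hp hy0 line *; exists (fun i => t (lift ord0 i)); split=> // x _.
  have hpt : peval t p - (p.@[v])%:A \in m.
    rewrite -(expr0 (0 : A)) -line; apply: peval_congr.
    - exact: rpredD.
    - by move=> a y; apply: idealMr.
    - exact: rpred0.
    by move=> i; rewrite scaler0 subr0.
  have [|b hb] := complete_unit hA (a := y0).
    apply/negP => my0; have e := scalar_mem (c := p.@[v]) (m := m).
    rewrite e ?eqxx // in pv.
    rewrite -(subKr (peval t p) _%:A) rpredB // -(subrK y0 (peval t p)) rpredD //.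
    exact/ipow1_ideal/(ipow_mono tm)/hy0.
  exists x; last by rewrite subrr span0.
  by rewrite -(mulr1 x) -hb mulrA; apply: IM.
(* A form of positive degree vanishes at the origin, so the point v is not the origin. *)
have [j vj] : exists j, v j != 0.
  apply: contrapT => no; have v0 i : v i = 0.
    by apply/eqP/negPn/negP => vi; apply: no; exists i.
  have := line v (1 : A); rewrite (_ : (fun i => _) = (fun i => v i *: (0 : A))).
    rewrite line expr0n gtn_eqF // expr1n scaler0 => /esym h.
    have := scalar_mem (c := p.@[v]) (m := m); rewrite h rpred0 => /(_ isT) e.
    by rewrite e eqxx in pv.
  by apply/funext => i; rewrite v0 !scale0r.
(* Modulo t' each t_i equals v_i tau, so p becomes p(v) tau^d and the error of order d+1 becomes a
   tau^(d+1). As p(v) - a tau is a unit, tau^d lies in W = I + (t'). *)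
pose tau := (v j)^-1 *: t j.
pose t' (i : 'I_n) := t (lift j i) - v (lift j i) *: tau.
have mtau : tau \in m by rewrite /tau -mulr_algl idealMr.
exists t'; split.
  by move=> i; rewrite rpredB // -mulr_algl idealMr.
pose W x := exists2 y, I y & x - y \in span t'.
have WD x y : W x -> W y -> W (x + y).
  move=> [z Iz hz] [w Iw hw]; exists (z + w); first exact: ID.
  by rewrite opprD addrACA spanD.
have WM a x : W x -> W (a * x).
  by move=> [z Iz hz]; exists (a * z); [exact: IM|rewrite -mulrBr spanM].
have Wspan x : x \in span t' -> W x by exists 0; rewrite ?subr0.
have htau i : t i - v i *: tau \in span t'.
  case: (unliftP j i) => [i' ->|->]; first exact: (span_gen t' i').
  by rewrite /tau scalerA mulfV // scale1r subrr span0.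
have power l x : ipow (span t) l x -> exists a, W (x - a * tau ^+ l).
  elim: l x => [|l IH] x.
    by move=> _; exists x; rewrite expr0 mulr1 subrr; apply: Wspan; apply: span0.
  move=> /ipow_span_coef[c -> hc].
  have [a ha] := fun_choice (fun i => IH _ (hc i)).
  exists (\sum_i v i *: a i).
  rewrite mulr_suml -sumrB; apply: (big_ind W) => //; first exact/Wspan/span0.
  move=> i _; have -> : c i * t i - v i *: a i * tau ^+ l.+1 =
      t i * (c i - a i * tau ^+ l) + a i * tau ^+ l * (t i - v i *: tau).
    have [w vE] : exists w, forall z : A, v i *: z = w * z.
      by exists (v i)%:A => z; rewrite mulr_algl.
    by rewrite !vE exprS; ring.
  by apply: WD; apply: WM => //; apply: Wspan.
have Wp : W (peval t p - p.@[v] *: tau ^+ d).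
  rewrite -line; apply: Wspan; apply: peval_congr => //.
  - exact: spanD.
  - exact: spanM.
  exact: span0.
have [a Wa] := power _ _ hy0.
have WI y : I y -> W y by exists y; rewrite ?subrr ?span0.
have Wtau : W (tau ^+ d).
  have : (p.@[v])%:A - a * tau \notin m.
    apply/negP => h; have := scalar_mem (c := p.@[v]) (m := m).
    rewrite -(subrK (a * tau) (_%:A)) rpredD ?idealMr // => /(_ isT) e.
    by rewrite e eqxx in pv.
  move=> /(complete_unit hA)[b hb].
  rewrite -[tau ^+ d]mul1r -hb -mulrA; apply: (WM _ _).
  have -> : ((p.@[v])%:A - a * tau) * tau ^+ d = y0 +
      (-1) * (peval t p - p.@[v] *: tau ^+ d) + (peval t p - y0 - a * tau ^+ d.+1).
    have [w vE] : exists w, forall z : A, p.@[v] *: z = w * z.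
      by exists (p.@[v])%:A => z; rewrite mulr_algl.
    by rewrite !vE exprS; ring.
  by apply: (WD _ _) => //; apply: (WD _ _); [exact: WI|exact: WM].
move=> x /power[b hb]; rewrite -/(W x) -(subrK (b * tau ^+ d) x).
by apply: (WD _ _) => //; apply: WM.
Qed.

End Dimension.

Section PowerSeries.
Variables (k : fieldType) (A : comAlgType k) (m : idealr A).
Variables (n : nat) (t : 'I_n -> A) (P : idealr A).

(* Elements that are congruent modulo P to power series in t. *)
Definition pseries : {pred A} := fun f => `[< forall l, exists p, exists2 y,
  y \in P & ipow m l (f - peval t p - y) >].

Fact pseries_subring : subring_closed pseries.
Proof.
split.
- apply/asboolP => l; exists 1, 0; rewrite ?rpred0 // peval1 subrr subr0.
  exact: ipow_zero.
- move=> x y /asboolP hx /asboolP hy; apply/asboolP => l.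
  have [p [u Pu hp]] := hx l; have [q [v Pv hq]] := hy l.
  exists (p - q), (u - v); first by rewrite rpredB.
  have -> : x - y - peval t (p - q) - (u - v) =
    (x - peval t p - u) - (y - peval t q - v) by rewrite pevalB; ring.
  exact: ipowB.
move=> x y /asboolP hx /asboolP hy; apply/asboolP => l.
have [p [u Pu hp]] := hx l; have [q [v Pv hq]] := hy l.
exists (p * q), (y * u + peval t p * v); first by rewrite rpredD // idealMr.
have -> : x * y - peval t (p * q) - (y * u + peval t p * v) =
  y * (x - peval t p - u) + peval t p * (y - peval t q - v) by rewrite pevalM; ring.
by apply: ipowD; apply: ipowM.
Qed.
HB.instance Definition _ := GRing.isSubringClosed.Build A pseries pseries_subring.

End PowerSeries.

(** * Noether normalization and regular parameters *)

Section ChainBound.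
Variables (k : fieldType) (char0 : [pchar k] =i pred0).
Variables (A : comAlgType k) (m : idealr A).
Hypothesis hA : complete_local m.
Let hadic : @adic_complete A m A^o. Proof. by case: hA. Qed.
Let hnoeth : noetherian A. Proof. by case: hA. Qed.

Lemma max_generators : exists q, exists s : 'I_q -> A, forall a, a \in m <-> a \in span s.
Proof.
have [s hs] := hnoeth m; exists (size s), (fun i => s`_i) => a; rewrite hs.
exact: sspan_span.
Qed.

Lemma residue_span N : exists q, exists g : 'I_q -> A, forall x : A, exists c : 'I_q -> k,
  ipow m N (x - \sum_i c i *: g i).
Proof.
suff [I [g hg]] : exists I : finType, exists g : I -> A, forall x : A, exists c : I -> k,
    ipow m N (x - \sum_i c i *: g i).
  exists #|I|, (fun i => g (enum_val i)) => x; have [c hc] := hg x.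
  exists (fun i => c (enum_val i)).
  rewrite -(reindex (@enum_val I predT) (P := predT) (F := fun i => c i *: g i)) //.
  by apply: onW_bij; apply: enum_val_bij.
have [r [s hs]] := max_generators.
elim: N => [|N [I [g hg]]].
  by exists void, (fun _ => 0) => x; exists (fun _ => 0).
exists (unit + 'I_r * I)%type.
exists (fun u => match u with inl _ => 1 | inr ij => s ij.1 * g ij.2 end) => x.
have [c0 /hs/spanP[b e]] := residue_ex hA x.
have [c hc] := fun_choice (fun i => hg (b i)).
exists (fun u => match u with inl _ => c0 | inr ij => c ij.1 ij.2 end).
rewrite big_sumType /= (big_pred1 tt) => [|[]//].
rewrite -(pair_bigA _ (fun i j => c i j *: (s i * g j))) /= opprD addrA e -sumrB.
apply: ipow_sum => i _; have -> : \sum_j c i j *: (s i * g j) = s i * \sum_j c i j *: g j.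
  by rewrite mulr_sumr; apply: eq_bigr => j _; rewrite -scalerAr.
rewrite (mulrC (b i)) -mulrBr; apply: ipow_mem => //.
exact/hs/span_gen.
Qed.

Section Finite.
Variables (n : nat) (t : 'I_n -> A) (P : prime_idealr A) (N : nat).
Hypothesis mt : forall i, t i \in m.
Hypothesis params : forall x, ipow m N x -> exists2 y, y \in P & x - y \in span t.
Local Notation C0 := (pseries m t P).

Let tm : {subset span t <= m}. Proof. exact: span_sub. Qed.

(** Elements spanning A/m^N over k generate A over the series in t, modulo P: m^N lies in P + (t),
    so [red] improves the coefficients by one power of (t) at a time, and the limit is exact because
    P is closed. *)
Lemma pseries_finite : exists q, exists g : 'I_q -> A, forall x : A,
  exists2 e : 'I_q -> A, forall i, e i \in C0 & x - \sum_i e i * g i \in P.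
Proof.
have [q [g hg]] := residue_span N; exists q, g => x.
have red l r : ipow (span t) l r -> exists p : 'I_q -> {mpoly k[n] },
    (forall i, ipow (span t) l (peval t (p i))) /\
    exists2 y, y \in P & ipow (span t) l.+1 (r - \sum_i peval t (p i) * g i - y).
  elim: l r => [|l IH] r.
    have [c hc] := hg r; exists (fun i => (c i)%:MP); split=> //.
    have [y Py hy] := params hc; exists y => //.
    rewrite (eq_bigr (fun i => c i *: g i)) => [|i _]; first exact: ipow1_mem.
    by rewrite pevalC mulr_algl.
  move=> /ipow_span_coef[c -> hc].
  have [p hp] := fun_choice (fun i => IH _ (hc i)).
  have [y hy] := fun_choice (P := fun i y => y \in P /\ ipow (span t) l.+1
      (c i - \sum_j peval t (p i j) * g j - y))
    (fun i => let: conj _ (ex_intro2 y Py hy) := hp i in ex_intro _ y (conj Py hy)).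
  exists (fun j => \sum_i 'X_i * p i j); split.
    move=> j; rewrite peval_sum; apply: ipow_sum => i _; rewrite pevalM pevalU.
    by apply: ipow_mem; [exact: span_gen|exact: (hp i).1].
  exists (\sum_i t i * y i).
    by apply: rpred_sum => i _; apply: idealMr; exact: (hy i).1.
  have -> : \sum_j peval t (\sum_i 'X_i * p i j) * g j =
      \sum_i t i * \sum_j peval t (p i j) * g j.
    under eq_bigr => j _ do rewrite peval_sum mulr_suml.
    rewrite exchange_big; apply: eq_bigr => i _; rewrite mulr_sumr.
    by apply: eq_bigr => j _; rewrite pevalM pevalU mulrA.
  rewrite -!sumrB; apply: ipow_sum => i _.
  rewrite (mulrC (c i)) -!mulrBr; apply: ipow_mem; first exact: span_gen.
  exact: (hy i).2.
pose ok l (p : 'I_q -> {mpoly k[n] }) := exists2 y, y \in P &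
  ipow (span t) l (x - \sum_i peval t (p i) * g i - y).
have [||p [_ pok pS]] := @dependent_choice _ ok
  (fun l p p' => forall i, ipow m l (peval t (p' i) - peval t (p i))) (fun _ => 0).
- by exists 0; rewrite ?rpred0.
- move=> l p [y Py /red[p' [hp' [y' Py' h]]]]; exists (fun i => p i + p' i); split.
    exists (y + y'); first exact: rpredD.
    have -> : \sum_i peval t (p i + p' i) * g i =
        \sum_i peval t (p i) * g i + \sum_i peval t (p' i) * g i.
      by rewrite -big_split; apply: eq_bigr => i _; rewrite pevalD mulrDl.
    by rewrite !opprD !addrA in h *; rewrite [X in ipow _ _ (X - _)]addrAC.
  move=> i; rewrite pevalD addrAC subrr add0r; exact: (ipow_mono tm).
have [e he] := fun_choice (fun i => adic_limit hadic (fun l => pS l i)).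
exists e => [i|].
  by apply/asboolP => l; exists (p l i), 0; rewrite ?rpred0 // subr0.
apply: (krull_intersection hA) => l; have [y Py h] := pok l; exists y => //.
have -> : x - \sum_i e i * g i - y = (x - \sum_i peval t (p l i) * g i - y)
    - \sum_i (e i - peval t (p l i)) * g i.
  have -> : \sum_i (e i - peval t (p l i)) * g i =
      \sum_i e i * g i - \sum_i peval t (p l i) * g i.
    by rewrite -sumrB; apply: eq_bigr => i _; rewrite mulrBl.
  by ring.
apply: ipowB; first exact: (ipow_mono tm).
by apply: ipow_sum => i _; apply: ipowMr.
Qed.

(** Cayley-Hamilton: multiplication by f acts on the generators g through a matrix M' over the
    series, so det(f - M') kills every g_i modulo P, and 1 is a combination of the g_i. *)
Lemma pseries_integral f :
  exists h : {poly A}, [/\ h \is monic, h \is a polyOver C0 & h.[f] \in P].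
Proof.
have [q [g hg]] := pseries_finite.
have [M hM] := fun_choice (P := fun i (e : 'I_q -> A) => (forall j, e j \in C0) /\
    f * g i - \sum_j e j * g j \in P)
  (fun i => let: ex_intro2 e He Pe := hg (f * g i) in ex_intro _ e (conj He Pe)).
pose M' : 'M[A]_q := \matrix_(i, j) M i j.
exists (char_poly M'); split; first exact: char_poly_monic.
  rewrite /char_poly /determinant; apply: rpred_sum => s _; apply: rpredM.
    by apply: rpredX; apply: rpredN1.
  apply: rpred_prod => i _; rewrite !mxE; apply: rpredB.
    by apply: rpredMn; apply: polyOverX.
  by rewrite polyOverC; case: (hM i).
have -> : (char_poly M').[f] = \det (f%:M - M').
  rewrite -[LHS]/(horner_eval f _) -det_map_mx; congr (\det _).
  apply/matrixP => i j; rewrite !mxE -[LHS]/(('X *+ (i == j) - (M i j)%:P).[f]).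
  by rewrite hornerD hornerN hornerC hornerMn hornerX.
pose D := f%:M - M'.
have gD i : \sum_j D i j * g j \in P.
  have -> : \sum_j D i j * g j = f * g i - \sum_j M i j * g j; last by case: (hM i).
  rewrite (eq_bigr (fun j => f%:M i j * g j - M i j * g j)).
    rewrite sumrB; congr (_ - _).
    rewrite (bigD1 i) //= mxE eqxx big1 ?addr0 // => j ne.
    by rewrite mxE eq_sym (negPf ne) mul0r.
  by move=> j _; rewrite !mxE mulrBl.
have detg i : \det D * g i \in P.
  have : \sum_j (\adj D *m D) i j * g j \in P.
    under eq_bigr => j _ do rewrite mxE mulr_suml.
    rewrite exchange_big; apply: rpred_sum => l _ /=.
    under eq_bigr => j _ do rewrite -mulrA.
    by rewrite -mulr_sumr; apply: idealMr; apply: gD.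
  rewrite mul_adj_mx (bigD1 i) //= mxE eqxx big1 ?addr0 // => j ne.
  by rewrite mxE eq_sym (negPf ne) mul0r.
have [e _ he] := hg 1.
rewrite -(mulr1 (\det _)) -(subrK (\sum_i e i * g i) 1) mulrDr.
apply: rpredD; first exact: idealMr.
rewrite mulr_sumr; apply: rpred_sum => i _; rewrite mulrCA.
exact: idealMr.
Qed.

(* The constant term of an equation of minimal degree of f over the power series. *)
Lemma pseries_descent (P1 : prime_idealr A) f : {subset P <= P1} -> f \in P1 ->
  f \notin P -> exists c, [/\ c \in C0, c \in P1 & c \notin P].
Proof.
move=> PP1 P1f Pf; have [h []] := pseries_integral f.
elim/poly_ind: h => [|h c IH]; first by rewrite monicE lead_coef0 eq_sym oner_eq0.
move=> hmon /polyOverP hC; rewrite hornerMXaddC => hP.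
have C0c : c \in C0 by have := hC 0%N; rewrite coefD coefMX coefC eqxx add0r.
have P1c : c \in P1.
  by rewrite -(addrK (h.[f] * f) c); apply: rpredB; [rewrite addrC PP1|exact: idealMr].
have [Pc|] := boolP (c \in P); last by exists c.
have h0 : h != 0.
  apply: contraTneq hmon => h0; rewrite h0 mul0r add0r monicE lead_coefC.
  by apply/negP => /eqP c1; have := idealr1 P; rewrite -c1 Pc.
apply: IH.
- move: hmon; rewrite !monicE lead_coefDl ?lead_coefMX // size_mulX // size_polyC.
  by rewrite ltnS; apply: leq_trans (leq_b1 _) _; rewrite lt0n size_poly_eq0.
- apply/polyOverP => i; have := hC i.+1; by rewrite coefD coefMX coefC addr0.
have : h.[f] * f \in P by rewrite -(addrK c (_ * f)); apply: rpredB.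
by rewrite prime_idealrM (negPf Pf) orbF.
Qed.

End Finite.

(* Noether normalization: some nonzero power series in t lies in P 1, and its
   leading form allows one to drop a parameter modulo P 1. *)
Lemma chain_bound n (t : 'I_n -> A) (P : nat -> prime_idealr A) N :
  (forall i, t i \in m) ->
  (forall x, ipow m N x -> exists2 y, y \in P 0%N & x - y \in span t) ->
  (forall i, (i < n.+1)%N ->
    {subset P i <= P i.+1} /\ exists2 x, x \in P i.+1 & x \notin P i) -> False.
Proof.
elim: n t P N => [|n IH] t P N mt params chain.
  have [PP1 [f P1f /negP[]]] := chain 0%N isT.
  have := ideal_sub_max hA P1f => /(ipowX N)/params[y Py].
  have span0' (x : A) : x \in span t -> x = 0 by case/spanP=> c ->; rewrite big_ord0.
  move/span0' => /eqP; rewrite subr_eq0 => /eqP e.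
  have : f ^+ N \in P 0%N by rewrite e.
  elim: (N) => [|N' IHN]; first by rewrite expr0 => h; have := idealr1 (P 0%N); rewrite h.
  by rewrite exprS prime_idealrM => /orP[|/IHN].
have [PP1 [f P1f Pf]] := chain 0%N isT.
have [c [C0c P1c Pc]] := pseries_descent mt params PP1 P1f Pf.
have tm := span_sub mt.
have [l hl] : exists l, forall y, y \in P 0%N -> ~ ipow m l (c - y).
  apply: contrapT => no; case/negP: Pc; apply: (krull_intersection hA) => l.
  apply: contrapT => hl; apply: no; exists l => y Py h; apply: hl; by exists y.
have powN K x : ipow m (K * N) x -> exists2 y, y \in P 0%N & ipow (span t) K (x - y).
  elim: K x => [|K IHK] x; first by exists 0; rewrite ?rpred0.
  rewrite mulSn; apply: (ipow_add_ind
    (X := fun x => exists2 y, y \in P 0%N & ipow (span t) K.+1 (x - y))).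
  - by exists 0; rewrite ?rpred0 // subrr; apply: ipow_zero.
  - move=> y z [y' Py hy] [z' Pz hz]; exists (y' + z'); first exact: rpredD.
    by rewrite opprD addrACA; apply: ipowD.
  move=> y z /params[y' Py hy] /IHK[z' Pz hz].
  exists (z * y' + (y - y') * z'); first by rewrite rpredD // idealMr.
  have -> : y * z - (z * y' + (y - y') * z') = (y - y') * (z - z') by ring.
  exact: ipow_mem.
(* The precision l N turns into (t)^l modulo P 0. This error is negligible against an initial form
   of degree d < l, and an initial form of that degree exists because c stays away from P 0 at level
   l. *)
have /asboolP/(_ (l * N)%N)[p [y Py /powN[y' Py' hc]]] := C0c.
case: (low_form A p l) => [hp|[d [q [dl hq q0 hpq]]]].
  apply: (hl (y + y')); first exact: rpredD.
  have -> : c - (y + y') = (c - peval t p - y - y') + peval t p by ring.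
  by apply: ipowD; [exact: (ipow_mono tm)|exact: ipow_peval].
have [||t' [mt' ht']] := @form_reduces_params k char0 A m hA n t d q (fun x => x \in P 1%N) mt hq q0.
- by split=> [|u v|u v]; [exact: rpred0|exact: rpredD|exact: idealMr].
- exists (c - y - y'); first by rewrite !rpredB // PP1.
  have -> : peval t q - (c - y - y') =
    - (peval t p - peval t q) - (c - peval t p - y - y') by ring.
  by apply: ipowB; [apply: ipowN|apply: ipow_le hc].
apply: (IH t' (P \o S) (d * N)%N mt').
  move=> x /powN[z Pz /ht'[w Pw hw]]; exists (z + w); first by rewrite rpredD // PP1.
  by rewrite opprD addrA.
by move=> i hi; apply: (chain i.+1).
Qed.

Section Regular.

(** A polynomial of order below l whose value lies in m^l has a nonzero initial form that vanishes
    to higher order. [form_reduces_params] with the zero ideal would then give n elements generating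
    an ideal that contains a power of m. *)
Lemma peval_independent n (t : 'I_n.+1 -> A) : (forall a, a \in m <-> a \in span t) ->
  (forall (t' : 'I_n -> A) K, (forall i, t' i \in m) ->
    ~ forall x, ipow m K x -> x \in span t') ->
  forall p l, ipow m l (peval t p) -> forall mo, mo \in msupp p -> (l <= mdeg mo)%N.
Proof.
move=> hm noparam p l hp.
have mt i : t i \in m by apply/hm/span_gen.
have mspan K x : ipow m K x -> ipow (span t) K x by apply: ipow_mono => y /hm.
case: (low_form A p l) => [//|[d [q [dl hq q0 hpq]]]].
have [||t' [mt' ht']] := @form_reduces_params k char0 A m hA n t d q (fun x => x = 0) mt hq q0.
- by split=> [//|u v -> ->|u v ->]; rewrite ?addr0 ?mulr0.
- exists 0 => //; rewrite subr0; apply: ipow_subl (hpq t) _.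
  exact/(ipow_le dl)/mspan.
case: (noparam t' d mt') => x /mspan/ht'[y ->]; by rewrite subr0.
Qed.

Lemma peval_dense n (t : 'I_n -> A) : (forall a, a \in m <-> a \in span t) ->
  forall a l, exists p, ipow m l (a - peval t p).
Proof.
move=> hm a l; elim: l a => [|l IH] a; first by exists 0.
have [c /hm/spanP[b e]] := residue_ex hA a.
have [p hp] := fun_choice (fun i => IH (b i)).
exists (c%:MP + \sum_i 'X_i * p i).
rewrite pevalD pevalC peval_sum opprD addrA e -sumrB.
apply: ipow_sum => i _; rewrite pevalM pevalU mulrC -mulrBr; apply: ipow_mem => //.
exact/hm/span_gen.
Qed.

(** Independence of the monomials makes d/dt_i continuous on polynomials in the parameters t, so it
    extends to A. Some linear coefficient d_i of c is nonzero because c is not in m^2, and the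
    derivative of c along t_i is d_i modulo m. *)
Lemma regular_derivation (c : A) : regular_local_at m -> c \in m -> ~ ipow m 2 c ->
  exists D : A -> A, der D /\ D c \notin m.
Proof.
move=> [_ _ [s hs [[P chain] _]]] mc m2c.
have [n [e [t ht]]] : exists n, exists e : size s = n, exists t : 'I_n -> A,
    forall a, a \in m <-> a \in span t.
  exists (size s), erefl, (fun i => s`_i) => a; rewrite hs; exact: sspan_span.
move: chain; rewrite e {hs e s} => chain.
case: n t ht chain => [|n] t ht chain.
  have /spanP[b cE] := (ht c).1 mc; case: m2c; rewrite cE big_ord0; exact: ipow_zero.
have mt i : t i \in m by apply/ht/span_gen.
have noparam (t' : 'I_n -> A) K : (forall i, t' i \in m) ->
    ~ forall x, ipow m K x -> x \in span t'.
  move=> mt' h; apply: (@chain_bound n t' P K mt') => // x /h hx.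
  by exists 0; rewrite ?rpred0 // subr0.
have /spanP[b cE] := (ht c).1 mc.
have [d hd] := fun_choice (fun i => residue_ex hA (b i)).
have [i di] : exists i, d i != 0.
  apply: contrapT => no; apply: m2c; rewrite cE; apply: ipow_sum => i _.
  have d0 : d i = 0 by apply/eqP/negPn/negP => di; apply: no; exists i.
  have := hd i; rewrite d0 scale0r subr0 => mb.
  by apply: ipow_mem => //; apply: ipow1_mem.
have [||||||E [hE Et]] := @der_extend k {mpoly k[n.+1] } A m hadic (peval t) (mderiv i).
- exact: pevalD.
- exact: pevalM.
- by move=> x; rewrite pevalZ peval1.
- split=> [p q|x|p q]; first exact: mderivD.
    by rewrite mderivZ -mpolyC1 mderivC scaler0.
  by rewrite mderivM addrC mulrC; congr (_ + _); rewrite mulrC.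
- exact: peval_dense.
- move=> l p /(peval_independent ht noparam) hp; apply: ipow_peval => // mo.
  rewrite mcoeff_msupp mcoeff_mderiv => h; have := hp (mo + U_(i))%MM.
  rewrite mdegD mdeg1 addn1 ltnS; apply; rewrite mcoeff_msupp.
  by apply: contraNneq h => ->; rewrite mul0rn.
exists E; split=> //; apply/negP => mEc.
have Etj j : E (t j) = (i == j)%:R.
  rewrite -[t j](pevalU t) Et mderivX mnm1E eq_sym.
  have [->|_] := eqVneq i j; last by rewrite scale0r peval0.
  rewrite scale1r pevalX big1 // => l _.
  by rewrite mnmBE !mnm1E subnn expr0.
have Ec : E c - (d i)%:A \in m.
  have -> : E c = b i + \sum_j t j * E (b j).
    rewrite cE (der_sum hE) (eq_bigr (fun j => b j * (i == j)%:R + t j * E (b j))).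
      rewrite big_split /= (bigD1 i) //= eqxx mulr1 big1 ?addr0 // => j ne.
      by rewrite eq_sym (negPf ne) mulr0.
    by move=> j _; rewrite (derM hE) Etj.
  rewrite addrAC; apply: rpredD => //; apply: rpred_sum => j _.
  by rewrite mulrC idealMr.
have := scalar_mem (c := d i) (m := m); rewrite -(subKr (E c) _%:A) rpredB // => /(_ isT) d0.
by rewrite d0 eqxx in di.
Qed.

End Regular.
End ChainBound.

(** * Completed differentials *)

Section CompletedDifferentials.
Variables (k : fieldType) (R : comAlgType k) (n : idealr R).
Variables (I : finType) (s : I -> R).
Hypothesis hR : @adic_complete R n R^o.
Hypothesis hres : forall x : R, exists c : k, x - c%:A \in n.
Hypothesis hs : forall x, x \in n <-> x \in span s.

Local Notation M := (cont_diff n).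
Local Notation d := (@cont_d k R n).
Local Notation kd := (@kahler_d k R).
Local Notation adicM := (@adic R n (kahler R)).

Lemma adicS_ind (V : lmodType R) l (X : V -> Prop) :
  X 0 -> (forall x y, X x -> X y -> X (x + y)) ->
  (forall a x, a \in n -> @adic R n V l x -> X (a *: x)) ->
  forall x, @adic R n V l.+1 x -> X x.
Proof.
move=> X0 XD XM x [t [It ->]]; rewrite big_seq; apply: big_ind => // p /It[Ip hp].
exact: XM.
Qed.

Lemma adicS_mem (V : lmodType R) l a (x : V) :
  a \in n -> @adic R n V l x -> @adic R n V l.+1 (a *: x).
Proof.
move=> na hx; exists [:: (a, x)]; split; last by rewrite big_seq1.
by move=> p; rewrite inE => /eqP ->.
Qed.

Lemma adic_ipowZ (V : lmodType R) l a (x : V) : ipow n l a -> @adic R n V l (a *: x).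
Proof.
elim: l a => [|l IH] //; apply: ipowS_ind => [|a b ha hb|a b na hb].
- by rewrite scale0r; apply: adic0.
- by rewrite scalerDl; apply: adicD.
by rewrite -scalerA; apply: adicS_mem => //; apply: IH.
Qed.

Let kdD := let: And3 h _ _ := @kahler_d_derivation k R in h.
Let kdC := let: And3 _ h _ := @kahler_d_derivation k R in h.
Let kdM := let: And3 _ _ h := @kahler_d_derivation k R in h.

Let kdsum (J : finType) (F : J -> R) : kd (\sum_i F i) = \sum_i kd (F i).
Proof.
by apply: (big_morph kd kdD); rewrite -(scale0r (1 : R)) kdC.
Qed.

(** With r = c + sum_i e_i s_i one gets d r = sum_i e_i d s_i + sum_i s_i d e_i, and the second sum
    lies in the maximal ideal times the module. *)
Lemma kahler_approx l (x : kahler R) : adicM l x ->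
  exists a : I -> R, (forall i, ipow n l (a i)) /\
    adicM l.+1 (x - \sum_i a i *: kd (s i)).
Proof.
pose X l x := exists a : I -> R, (forall i, ipow n l (a i)) /\
    adicM l.+1 (x - \sum_i a i *: kd (s i)).
have X0 l' : X l' 0.
  exists (fun _ => 0); split; first by move=> i; apply: ipow_zero.
  by rewrite big1 => [|i _]; rewrite ?scale0r // subr0; apply: adic0.
have XD l' y z : X l' y -> X l' z -> X l' (y + z).
  move=> [a [ha hy]] [b [hb hz]]; exists (fun i => a i + b i); split.
    by move=> i; apply: ipowD.
  under eq_bigr => i _ do rewrite scalerDl.
  by rewrite big_split opprD addrACA; apply: adicD.
rewrite -/(X l x); elim: l x => [|l IH] x; last first.
  move: x; apply: adicS_ind => [||b y nb /IH[a [ha hy]]] //; first exact: XD.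
  exists (fun i => b * a i); split; first by move=> i; apply: ipow_mem.
  under eq_bigr => i _ do rewrite -scalerA.
  by rewrite -scaler_sumr -scalerBr; apply: adicS_mem.
move=> _; rewrite [x]umod_sum; apply: (big_ind (X 0%N)) => //; first exact: XD.
move=> [b r] _ /=; have [c /hs/spanP[e er]] := hres r.
have {er}-> : r = c%:A + \sum_i e i * s i by rewrite -er addrC subrK.
exists (fun i => b * e i); split=> //.
rewrite -/(kd _) kdD kdC add0r kdsum scaler_sumr -sumrB.
apply: adic_sum => i; rewrite kdM scalerDr -scalerA addrAC subrr add0r scalerA mulrC.
rewrite -scalerA; apply: adicS_mem => //; exact/hs/span_gen.
Qed.

Lemma mcompl_in_eq0 (x : kahler R) :
  mcompl_in n x = 0 <-> forall l, adicM l x.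
Proof.
have e0 : (0 : M) = mcompl_pi (mcauchy_cst n (0 : kahler R)).
  have := mcompl_in_linear n (-1) (0 : kahler R) 0.
  by rewrite scaler0 addr0 scaleN1r addNr => <-.
rewrite e0; split=> [/mcompl_piP h l|h].
  have [N /(_ N (leqnn N))] := h l.
  by rewrite -[_ - 0]/(x - 0 - 0) !subr0.
apply/mcompl_piP => l; exists 0%N => i _.
by rewrite -[_ - 0]/(x - 0 - 0) !subr0.
Qed.

Let inD x y : mcompl_in n (x + y : kahler R) = mcompl_in n x + mcompl_in n y.
Proof. by have := mcompl_in_linear n 1 x y; rewrite !scale1r. Qed.
Let in0 : mcompl_in n (0 : kahler R) = 0.
Proof. by apply: (addIr (mcompl_in n (0 : kahler R))); rewrite -inD !add0r. Qed.
Let inZ a (x : kahler R) : mcompl_in n (a *: x) = a *: mcompl_in n x.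
Proof. by rewrite -[a *: x]addr0 mcompl_in_linear in0 addr0. Qed.
Let inB (x y : kahler R) : mcompl_in n (x - y) = mcompl_in n x - mcompl_in n y.
Proof. by rewrite inD -scaleN1r inZ scaleN1r. Qed.
Let in_sum (F : I -> kahler R) : mcompl_in n (\sum_i F i) = \sum_i mcompl_in n (F i).
Proof. exact: (big_morph _ inD in0). Qed.
Let in_comb (a : I -> R) :
  \sum_i a i *: d (s i) = mcompl_in n (\sum_i a i *: kd (s i)).
Proof. by rewrite in_sum; apply: eq_bigr => i _; rewrite inZ. Qed.

Lemma cont_d_derivation : derivation d.
Proof.
split=> [a b|c|a b]; rewrite /cont_d; first by rewrite kdD inD.
  by rewrite kdC in0.
by rewrite kdM inD !inZ.
Qed.

Lemma cont_diff_span (u : M) : exists a : I -> R, u = \sum_i a i *: d (s i).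
Proof.
elim/mcompl_ind: u => v.
have /asboolP hv := valP v.
pose N l := projT1 (cid (hv l)).
have hN l i j : (N l <= i)%N -> (N l <= j)%N -> adicM l (val v i - val v j).
  by move=> hi hj; exact: (projT2 (cid (hv l)) i j hi hj).
pose L l := (\sum_(i < l.+1) N i)%N.
have NL l : (N l <= L l)%N by rewrite /L big_ord_recr leq_addl.
have LS l : (L l <= L l.+1)%N by rewrite /L [leqRHS]big_ord_recr leq_addr.
have [||a [_ aok aS]] := @dependent_choice (I -> R)
  (fun l a => adicM l (val v (L l) - \sum_i a i *: kd (s i)))
  (fun l a b => forall i, ipow n l (b i - a i)) (fun _ => 0).
- by [].
- move=> l a ha; have h : adicM l (val v (L l.+1) - \sum_i a i *: kd (s i)).
    rewrite -(subrK (val v (L l)) (val v (L l.+1))) -addrA; apply: adicD => //.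
    by apply: hN => //; apply: leq_trans (LS l).
  have [b [hb hab]] := kahler_approx h.
  exists (fun i => a i + b i); split; last by move=> i; rewrite addrAC subrr add0r.
  under eq_bigr => i _ do rewrite scalerDl.
  by rewrite big_split opprD addrA.
have [b hb] := fun_choice (fun i => adic_limit hR (fun l => aS l i)).
exists b; rewrite in_comb; apply/mcompl_piP => l; exists (L l) => i hi.
rewrite subr0 -[(_ - _) i]/(val v i - \sum_i b i *: kd (s i)).
have -> : val v i - \sum_i b i *: kd (s i) = (val v i - val v (L l)) +
    (val v (L l) - \sum_i a l i *: kd (s i)) - \sum_i (b i - a l i) *: kd (s i).
  have -> : \sum_j (b j - a l j) *: kd (s j) =
      \sum_j b j *: kd (s j) - \sum_j a l j *: kd (s j).
    by rewrite -sumrB; apply: eq_bigr => j _; rewrite scalerBl.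
  by rewrite opprB !addrA !subrK.
apply: adicB; last by apply: adic_sum => j; apply: adic_ipowZ.
apply: adicD => //; apply: hN => //; exact: leq_trans hi.
Qed.

(** The value on a combination of the d s_i is forced. It is well defined because two combinations
    equal in the completion differ by a Kaehler differential in every n^l times the module, which D
    sends into every n^l, hence to 0. *)
Lemma cont_diff_lift (D : R -> R) : der D -> exists phi : M -> R,
  (forall a u v, phi (a *: u + v) = a * phi u + phi v) /\ forall x, phi (d x) = D x.
Proof.
move=> hD; have aD : @derivation k R R^o D by case: hD => h1 h2 h3; split.
have mD l x : adicM l x -> ipow n l (mlift (D : R -> R^o) x).
  elim: l x => [|l IH] //; apply: adicS_ind => [|y z hy hz|a y na /IH hy].
  - by rewrite mlift0 //; apply: ipow_zero.
  - by rewrite mliftD //; apply: ipowD.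
  by rewrite mliftZ //; apply: ipow_mem.
have comb (a : I -> R) :
    mlift (D : R -> R^o) (\sum_i a i *: kd (s i)) = \sum_i a i * D (s i).
  rewrite (big_morph (mlift (D : R -> R^o)) (fun x y => mliftD aD x y) (mlift0 aD)).
  by apply: eq_bigr => i _; rewrite mliftZ // mlift_gen.
have uniq (x : kahler R) (a : I -> R) : mcompl_in n x = \sum_i a i *: d (s i) ->
    mlift (D : R -> R^o) x = \sum_i a i * D (s i).
  move=> e; have {e} : mcompl_in n (x - \sum_i a i *: kd (s i)) = 0.
    by rewrite inB e in_comb subrr.
  move=> /mcompl_in_eq0 h; rewrite -comb; apply/eqP; rewrite -subr_eq0; apply/eqP.
  apply: (adic_separated hR) => l; have := mD l _ (h l).
  by rewrite mliftD // -scaleN1r mliftZ // scaleN1r.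
pose phi u := \sum_i projT1 (cid (cont_diff_span u)) i * D (s i).
have phiE (a : I -> R) : phi (\sum_i a i *: d (s i)) = \sum_i a i * D (s i).
  rewrite /phi; case: cid => b /= e; rewrite -comb; apply: uniq.
  by rewrite -in_comb e.
exists phi; split=> [a u v|x].
  have [b ->] := cont_diff_span u; have [c ->] := cont_diff_span v.
  have -> : a *: \sum_i b i *: d (s i) + \sum_i c i *: d (s i) =
      \sum_i (a * b i + c i) *: d (s i).
    rewrite scaler_sumr -big_split; apply: eq_bigr => i _.
    by rewrite scalerDl scalerA.
  rewrite !phiE mulr_sumr -big_split; apply: eq_bigr => i _.
  by rewrite mulrDl mulrA.
have [b e] := cont_diff_span (d x); rewrite e phiE -(uniq (kd x)) //.
by rewrite mlift_gen.
Qed.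

End CompletedDifferentials.

Lemma fraction_repr (R : idomainType) (q : {fraction R}) :
  exists a b : R, b != 0 /\ q * @FracField.tofrac R b = @FracField.tofrac R a.
Proof.
elim/quotW: q => x; exists (frac x).1, (frac x).2; split; first exact: denom_ratioP.
unlock FracField.tofrac; rewrite -[LHS]FracField.pi_mul.
apply/eqmodP; rewrite /= FracField.equivfE /FracField.mulf.
by rewrite !numden_Ratio ?mulf_neq0 ?oner_eq0 ?denom_ratioP // !mulr1 mulrC.
Qed.

(** * The fraction field of a domain and forms over a field *)

Section FractionField.
Variables (R : comNzRingType) (dR : GRing.integral_domain_axiom R).
Local Notation iota := (@to_fraction R dR).

Lemma to_fractionD : {morph iota : x y / x + y}.
Proof. exact: (@tofracD (domain_pack dR)). Qed.
Lemma to_fractionM : {morph iota : x y / x * y}.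
Proof. exact: (@tofracM (domain_pack dR)). Qed.
Lemma to_fraction0 : iota 0 = 0.
Proof. exact: (@tofrac0 (domain_pack dR)). Qed.
Lemma to_fraction1 : iota 1 = 1.
Proof. exact: (@tofrac1 (domain_pack dR)). Qed.
Lemma to_fractionN : {morph iota : x / - x}.
Proof. exact: (@tofracN (domain_pack dR)). Qed.
Lemma to_fraction_eq0 x : iota x = 0 -> x = 0.
Proof.
move=> h; have := @tofrac_eq0 (domain_pack dR) x.
by rewrite -/(iota x) h eqxx => /esym/eqP.
Qed.
Lemma to_fraction_inj : injective iota.
Proof.
move=> x y e; apply/eqP; rewrite -subr_eq0; apply/eqP/to_fraction_eq0.
by rewrite to_fractionD to_fractionN e subrr.
Qed.
Lemma to_fraction_repr (q : fraction_field dR) :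
  exists a b : R, iota b != 0 /\ q * iota b = iota a.
Proof.
have [a [b [b0 e]]] := @fraction_repr (domain_pack dR) q; exists a, b; split=> //.
by rewrite -(@tofrac_eq0 (domain_pack dR)) in b0.
Qed.
Lemma to_fraction_sum (J : finType) (F : J -> R) :
  iota (\sum_i F i) = \sum_i iota (F i).
Proof. exact: (big_morph iota to_fractionD to_fraction0). Qed.

Lemma common_denominator (J : finType) (q : J -> fraction_field dR) :
  exists b : R, exists a : J -> R, iota b != 0 /\ forall i, q i * iota b = iota (a i).
Proof.
have [a ha] := fun_choice (fun i => to_fraction_repr (q i)).
have [b hb] := fun_choice ha.
exists (\prod_i b i).
have prodE (X : pred J) : iota (\prod_(i | X i) b i) = \prod_(i | X i) iota (b i).
  exact: (big_morph iota to_fractionM to_fraction1).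
exists (fun i => a i * \prod_(j | j != i) b j); split.
  by rewrite prodE; apply/prodf_neq0 => i _; exact: (hb i).1.
move=> i; rewrite to_fractionM -(hb i).2 !prodE (bigD1 i) //=.
by rewrite mulrA.
Qed.

End FractionField.

(** The spanning family e may be dependent, so its Gram matrix H may be singular. A zero kernel of
    [Th] turns the vectors annihilated by H into relations among the e_i; phi respects these, which
    makes the linear system solvable. *)
Lemma nondegenerate_formP (K : fieldType) (V : lmodType K) (I : finType) (e : I -> V)
    (Th : V -> V -> K) :
  (forall v, exists c : I -> K, v = \sum_i c i *: e i) ->
  bilinear_form Th -> skew_form Th ->
  nondegenerate_form Th <-> (forall u, (forall v, Th u v = 0) -> u = 0).
Proof.
move=> he [Thr Thl] skew.
have ThrD u v w a : Th u (a *: v + w) = a * Th u v + Th u w by exact: Thr.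
have ThlD u v w a : Th (a *: v + w) u = a * Th v u + Th w u by exact: Thl.
have Th0r u : Th u 0 = 0.
  by have := ThrD u 0 0 (-1); rewrite scaler0 addr0 mulN1r addNr.
have Th0l u : Th 0 u = 0 by rewrite skew Th0r oppr0.
split=> [nd u hu|inj phi hphi].
  have [|w [_ w_uniq]] := nd (fun _ => 0); first by move=> a x y; rewrite scaler0 addr0.
  by rewrite -(w_uniq u hu); apply: w_uniq => v; rewrite Th0l.
have phiD v w a : phi (a *: v + w) = a * phi v + phi w by exact: hphi.
have phi0 : phi 0 = 0.
  by have := phiD 0 0 (-1); rewrite scaler0 addr0 mulN1r addNr.
have combl (c : I -> K) v : Th (\sum_i c i *: e i) v = \sum_i c i * Th (e i) v.
  elim/big_rec2: _ => [|i x y _ <-]; first exact: Th0l.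
  exact: ThlD.
have combr (c : I -> K) v : Th v (\sum_i c i *: e i) = \sum_i c i * Th v (e i).
  elim/big_rec2: _ => [|i x y _ <-]; first exact: Th0r.
  exact: ThrD.
have combp (c : I -> K) : phi (\sum_i c i *: e i) = \sum_i c i * phi (e i).
  elim/big_rec2: _ => [|i x y _ <-]; first exact: phi0.
  exact: phiD.
have uniq u w : (forall v, Th u v = phi v) -> (forall v, Th w v = phi v) -> u = w.
  move=> hu hw; apply/eqP; rewrite -subr_eq0; apply/eqP/inj => v.
  by rewrite -scaleN1r addrC ThlD mulN1r hu hw addNr.
pose H : 'M[K]_(#|I|) := \matrix_(i, j) Th (e (enum_val i)) (e (enum_val j)).
pose p : 'rV[K]_(#|I|) := \row_j phi (e (enum_val j)).
have reix (F : I -> K) : \sum_i F i = \sum_(i < #|I|) F (enum_val i).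
  rewrite (reindex (@enum_val I predT)) //.
  by apply: onW_bij; apply: enum_val_bij.
(* The Gram matrix H of Th and phi have the same annihilators. *)
have /submxP[c pc] : (p <= H)%MS.
  rewrite submxE; apply/eqP/rowP => l; rewrite [RHS]mxE.
  pose la j := cokermx H j l.
  have kerla i : \sum_j H i j * la j = 0.
    by have := mulmx_coker H => /matrixP /(_ i l); rewrite !mxE.
  have wz : \sum_j la (enum_rank j) *: e j = 0.
    apply: inj => v; rewrite skew; have [b ->] := he v.
    rewrite combl big1 ?oppr0 // => i _; rewrite combr reix.
    rewrite (_ : \sum_j _ = 0) ?mulr0 // -[RHS](kerla (enum_rank i)).
    by apply: eq_bigr => j _; rewrite enum_valK mxE enum_rankK mulrC.
  have := combp (fun j => la (enum_rank j)); rewrite wz phi0 reix => /esym h.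
  rewrite mxE -[RHS]h; apply: eq_bigr => j _.
  by rewrite mxE enum_valK mulrC.
pose u := \sum_i c 0 (enum_rank i) *: e i.
have hu v : Th u v = phi v.
  have [b ->] := he v.
  rewrite combr combp; apply: eq_bigr => j _; congr (_ * _).
  have := congr1 (fun r : 'rV_#|I| => r 0 (enum_rank j)) pc; rewrite mxE enum_rankK => ->.
  rewrite combl mxE reix; apply: eq_bigr => i _.
  by rewrite enum_valK mxE enum_rankK.
by exists u; split=> // w hw; apply: uniq.
Qed.

(* For a complete local domain this says that the kernel of the bivector over
   the generic point is zero: a 1-form is zero there as soon as all derivations
   vanish on it. *)
Definition hamiltonian_faithful (k : fieldType) (R : poissonAlgType k) (I : finType)
    (s : I -> R) : Prop :=
  forall a : I -> R, (forall x, \sum_i a i * {[s i, x]} = 0) ->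
  forall D : R -> R, der D -> \sum_i a i * D (s i) = 0.

(** * The bivector on continuous differentials and at the generic point *)

Section PoissonForm.
Variables (k : fieldType) (R : poissonAlgType k) (n : idealr R).
Variables (I : finType) (s : I -> R).
Hypothesis hR : @adic_complete R n R^o.
Hypothesis hres : forall x : R, exists c : k, x - c%:A \in n.
Hypothesis hs : forall x, x \in n <-> x \in span s.

Local Notation M := (cont_diff n).
Local Notation d := (@cont_d k R n).
Let spanM := cont_diff_span hR hres hs.

Section LinearForms.
Variable (phi : M -> R).
Hypothesis phiP : forall a u v, phi (a *: u + v) = a * phi u + phi v.

Lemma form_comb (a : I -> R) : phi (\sum_i a i *: d (s i)) = \sum_i a i * phi (d (s i)).
Proof.
have phi0 : phi 0 = 0.
  by have := phiP (-1) 0 0; rewrite scaler0 addr0 mulN1r addNr.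
by elim/big_rec2: _ => [|i x y _ <-] //; apply: phiP.
Qed.

End LinearForms.

(** The bracket is a derivation in each argument, so the lifting property is applied twice: to {-,
    b} for fixed b, then to b |-> phi b u for fixed u. *)
Lemma cont_form : exists Th : M -> M -> R,
  [/\ forall u a v w, Th u (a *: v + w) = a * Th u v + Th u w,
      forall u a v w, Th (a *: v + w) u = a * Th v u + Th w u &
      forall a b, Th (d a) (d b) = {[a, b]}].
Proof.
have [phi hphi] := fun_choice (fun b => cont_diff_lift hR hres hs (poisson_derl b)).
have dphi u : der (fun b => phi b u).
  have [a ->] := spanM u.
  rewrite (_ : (fun b => phi b _) = fun b => \sum_i a i * {[s i, b]}).
    apply: (der_sumf (D := fun i b => a i * {[s i, b]})) => i.
    exact/der_mull/poisson_der.
  apply/funext => b; rewrite (form_comb (hphi b).1).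
  by apply: eq_bigr => i _; rewrite (hphi b).2.
have [Th hTh] := fun_choice (fun u => cont_diff_lift hR hres hs (dphi u)).
exists Th; split=> [u a v w|u a v w|a b]; first exact: (hTh u).1.
  have [c ->] := spanM u; rewrite !(form_comb (hTh _).1) mulr_sumr -big_split.
  by apply: eq_bigr => j _ /=; rewrite !(hTh _).2 (hphi _).1; ring.
by rewrite (hTh _).2 (hphi b).2.
Qed.

(** The linear form of D on differentials is [Th] u for some u, and expanding u in the d s_i
    exhibits D as a combination of Hamiltonian derivations. *)
Lemma nondegenerate_derivation : nondegenerate_poisson n ->
  forall D : R -> R, der D -> exists a : I -> R, forall x, D x = \sum_i a i * {[s i, x]}.
Proof.
move=> [Th [[Thr Thl] _ Thd nd]] D hD.
have [phi [phiP phid]] := cont_diff_lift hR hres hs hD.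
have [u [hu _]] := nd phi phiP.
have [a ua] := spanM u; exists a => x.
rewrite -phid -hu ua.
have ThP c v w : Th (c *: v + w) (d x) = c * Th v (d x) + Th w (d x) by exact: Thl.
rewrite (form_comb (phi := fun u => Th u (d x)) ThP).
by apply: eq_bigr => i _; rewrite Thd.
Qed.

Section Generic.
Variable dR : GRing.integral_domain_axiom R.
Local Notation K := (fraction_field dR).
Local Notation iota := (@to_fraction R dR).
Local Notation V := (base_change iota M).
Local Notation bc := (@base_change_in R K iota M).
Local Notation e := (fun i => bc (d (s i))).

Let bcP a x y : bc (a *: x + y) = iota a *: bc x + bc y.
Proof. exact: base_change_in_semilinear. Qed.

Lemma semilinear_comb (W : lmodType K) (g : M -> W) (a : I -> R) :
  semilinear_map iota g -> g (\sum_i a i *: d (s i)) = \sum_i iota (a i) *: g (d (s i)).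
Proof.
move=> hg; have g0 : g 0 = 0.
  by have := hg (-1) 0 0; rewrite scaler0 addr0 to_fractionN to_fraction1 scaleN1r addNr.
by elim/big_rec2: _ => [|i x y _ <-] //; apply: hg.
Qed.

Lemma base_change_span (v : V) : exists c : I -> K, v = \sum_i c i *: e i.
Proof.
rewrite [v]umod_sum; apply: (big_ind (fun v => exists c : I -> K, v = \sum_i c i *: e i)).
- by exists (fun _ => 0); rewrite big1 // => i _; rewrite scale0r.
- move=> x y [c ->] [c' ->]; exists (fun i => c i + c' i).
  by rewrite -big_split; apply: eq_bigr => i _; rewrite scalerDl.
move=> [b u] _ /=; have [a ->] := spanM u.
exists (fun i => b * iota (a i)); rewrite -[mgen _ _]/(bc _).
rewrite semilinear_comb; last exact: base_change_in_semilinear.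
by rewrite scaler_sumr; apply: eq_bigr => i _; rewrite scalerA.
Qed.

Lemma linear_comb (W : lmodType K) (f : V -> W) (c : I -> K) : linear f ->
  f (\sum_i c i *: e i) = \sum_i c i *: f (e i).
Proof.
move=> fP; have f0 : f 0 = 0.
  by have := fP (-1) 0 0; rewrite scaler0 addr0 scaleN1r addNr.
by elim/big_rec2: _ => [|i x y _ <-] //; apply: fP.
Qed.

Lemma functional_comb (f : V -> K^o) (c : I -> K) : linear f ->
  f (\sum_i c i *: e i) = \sum_i c i * f (e i).
Proof. exact: linear_comb. Qed.

Lemma bilinear_combl (Th : V -> V -> K) (c : I -> K) v : bilinear_form Th ->
  Th (\sum_i c i *: e i) v = \sum_i c i * Th (e i) v.
Proof. by move=> [_ Thl]; apply: (@functional_comb (Th^~ v)). Qed.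

Lemma bilinear_combr (Th : V -> V -> K) (c : I -> K) v : bilinear_form Th ->
  Th v (\sum_i c i *: e i) = \sum_i c i * Th v (e i).
Proof. by move=> [Thr _]; apply: (@functional_comb (Th v)). Qed.

Lemma generic_form : exists Th : V -> V -> K, [/\ bilinear_form Th, skew_form Th &
  forall a b, Th (bc (d a)) (bc (d b)) = iota {[a, b]}].
Proof.
have [Th0 [Th0r Th0l Th0d]] := cont_form.
have g_lin u : @semilinear_map R K iota M K^o (fun v => iota (Th0 u v)).
  by move=> a x y; rewrite Th0r to_fractionD to_fractionM.
pose g u : V -> K^o := mlift (fun v => iota (Th0 u v) : K^o).
have gP u : linear (g u) by apply: mlift_linear; apply: g_lin.
have gE u v : g u (bc v) = iota (Th0 u v) by apply: mlift_gen; apply: g_lin.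
have g_semi v : @semilinear_map R K iota M K^o (fun u => g u v).
  move=> a x y; have [c ->] := base_change_span v.
  rewrite !(linear_comb _ (gP _)) scaler_sumr -big_split; apply: eq_bigr => i _ /=.
  rewrite !gE Th0l to_fractionD to_fractionM scalerDr; congr (_ + _).
  by rewrite !scalerA mulrC -scalerA.
pose Th (u v : V) : K := mlift (fun u => g u v) u.
have ThlP v : linear (Th^~ v : V -> K^o) by apply: mlift_linear; apply: g_semi.
have ThE u v : Th (bc u) v = g u v by exact: (mlift_gen (V := K^o) u (g_semi v)).
have Thd a b : Th (bc (d a)) (bc (d b)) = iota {[a, b]} by rewrite ThE gE Th0d.
have ThrP u : linear (Th u : V -> K^o).
  move=> a x y; have [c ->] := base_change_span u.
  rewrite !(@functional_comb (Th^~ _)) // scaler_sumr -big_split.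
  apply: eq_bigr => i _ /=; rewrite !ThE gP -[_ *: g _ x]/(_ * _).
  by rewrite -[a *: (_ * _)]/(a * _); ring.
have bil : bilinear_form Th by [].
exists Th; split=> // u v.
have [c ->] := base_change_span u; have [c' ->] := base_change_span v.
rewrite !(bilinear_combl _ _ bil).
under eq_bigr => i _ do rewrite (bilinear_combr _ _ bil) mulr_sumr.
under [in RHS]eq_bigr => i _ do rewrite (bilinear_combr _ _ bil) mulr_sumr.
rewrite exchange_big -sumrN; apply: eq_bigr => j _.
rewrite -sumrN; apply: eq_bigr => i _.
by rewrite !Thd poissonC to_fractionN; ring.
Qed.

(** A form-level kernel vector and a relation among Hamiltonian derivations correspond after
    clearing denominators. A nonzero kernel vector u has a linear form f with f u = 1; multiplied by
    a common denominator of its values on the finitely many generators, f o d becomes a derivation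
    of R that contradicts faithfulness. *)
Lemma generic_bivectorP :
  @nondegenerate_bivector k R K iota V (fun a => bc (d a)) <-> hamiltonian_faithful s.
Proof.
split=> [[Th [bil skew Thd]] /(nondegenerate_formP base_change_span bil skew) inj|faith].
  move=> a ha D hD; have [Thr Thl] := bil.
  have [phi [phiP phid]] := cont_diff_lift hR hres hs hD.
  have g_semi : @semilinear_map R K iota M K^o (fun u => iota (phi u)).
    by move=> b x y; rewrite phiP to_fractionD to_fractionM.
  have u0 : \sum_i iota (a i) *: e i = 0.
    apply: inj => v; have [c ->] := base_change_span v.
    rewrite (bilinear_combr _ _ bil) big1 // => j _.
    rewrite (bilinear_combl _ _ bil) (_ : \sum_i _ = 0) ?mulr0 //.
    have := congr1 iota (ha (s j)); rewrite to_fraction_sum to_fraction0 => h.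
    by rewrite -[RHS]h; apply: eq_bigr => i _; rewrite Thd to_fractionM.
  apply: (@to_fraction_eq0 R dR).
  have gP := mlift_linear g_semi; have := functional_comb (fun i => iota (a i)) gP.
  rewrite u0; have -> : mlift (fun u => iota (phi u) : K^o) (0 : V) = 0.
    by have := gP (-1) 0 0; rewrite scaler0 addr0 scaleN1r addNr.
  move=> /esym h; rewrite to_fraction_sum -[RHS]h; apply: eq_bigr => i _.
  by rewrite mlift_gen // phid to_fractionM.
have [Th [bil skew Thd]] := generic_form; exists Th; split=> //.
apply/(nondegenerate_formP base_change_span bil skew) => u hu.
have [Thr Thl] := bil.
have [c uE] := base_change_span u.
have [b [a [b0 ba]]] := common_denominator c.
have ham x : \sum_i a i * {[s i, x]} = 0.
  apply: (@to_fraction_eq0 R dR); rewrite to_fraction_sum.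
  rewrite -[RHS](mulr0 (iota b)) -[in RHS](hu (bc (d x))) uE.
  rewrite (bilinear_combl _ _ bil) mulr_sumr; apply: eq_bigr => i _.
  by rewrite to_fractionM -ba Thd mulrA (mulrC (iota b)).
have [//|/eqP u0] := pselect (u = 0).
have [|||f [fP fu _]] := @linear_form_sep K V (pred1 0) u.
- by rewrite inE eqxx.
- by move=> x y z; rewrite !inE => /eqP -> /eqP ->; rewrite scaler0 addr0.
- by rewrite inE.
have [t [p [t0 tp]]] := common_denominator (fun i => f (e i)).
have exD x : exists y, iota y = iota t * f (bc (d x)).
  have [a' ->] := spanM (d x); exists (\sum_i a' i * p i).
  rewrite semilinear_comb; last exact: base_change_in_semilinear.
  rewrite (functional_comb _ fP) to_fraction_sum mulr_sumr; apply: eq_bigr => i _.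
  by rewrite to_fractionM -tp; ring.
have [D hD] := fun_choice exD.
have derD : der D.
  have [dD dC dM] := cont_d_derivation n.
  have bc0 : bc 0 = 0.
    by have := bcP (-1) 0 0; rewrite scaler0 addr0 to_fractionN to_fraction1 scaleN1r addNr.
  have f0 : f 0 = 0.
    by have := fP (-1) 0 0; rewrite scaler0 addr0 scaleN1r addNr.
  split=> [x y|l|x y]; apply: (@to_fraction_inj R dR).
  - rewrite to_fractionD !hD dD -mulrDr; congr (_ * _).
    by have := bcP 1 (d x) (d y); rewrite scale1r to_fraction1 scale1r => ->;
      have := fP 1 (bc (d x)) (bc (d y)); rewrite !scale1r.
  - by rewrite hD dC bc0 f0 mulr0 to_fraction0.
  rewrite to_fractionD !to_fractionM !hD dM bcP fP.
  have -> : bc (y *: d x) = iota y *: bc (d x).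
    by rewrite -[y *: _]addr0 bcP bc0 addr0.
  have -> : f (iota y *: bc (d x)) = iota y * f (bc (d x)).
    by rewrite -[_ *: _]addr0 fP f0 addr0.
  by rewrite -[_ *: f _]/(_ * _); ring.
have := faith a ham D derD => /(congr1 iota).
rewrite to_fraction_sum to_fraction0 => h.
have : iota t * (iota b * f u) = 0.
  rewrite -h uE (functional_comb _ fP) !mulr_sumr; apply: eq_bigr => i _.
  by rewrite to_fractionM hD -ba; ring.
by move/eqP; rewrite fu mulr1 mulf_eq0 (negPf t0) (negPf b0).
Qed.

End Generic.
End PoissonForm.

(** * Power series and Euler's relation *)

Definition alg_morph (k : fieldType) (R S : comAlgType k) (f : R -> S) : Prop :=
  [/\ {morph f : x y / x + y}, {morph f : x y / x * y} &
      forall c : k, f c%:A = c%:A].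

Section AlgMorph.
Variables (k : fieldType) (R S : comAlgType k) (f : R -> S).
Hypothesis hf : alg_morph f.

Lemma amD : {morph f : x y / x + y}. Proof. by case: hf. Qed.
Lemma amM : {morph f : x y / x * y}. Proof. by case: hf. Qed.
Lemma amC (c : k) : f c%:A = c%:A. Proof. by case: hf. Qed.
Lemma am0 : f 0 = 0. Proof. by have := amC 0; rewrite !scale0r. Qed.
Lemma am1 : f 1 = 1. Proof. by have := amC 1; rewrite !scale1r. Qed.
Lemma amN : {morph f : x / - x}.
Proof. by move=> x; apply/eqP; rewrite -addr_eq0 -amD addNr am0. Qed.
Lemma amB : {morph f : x y / x - y}. Proof. by move=> x y; rewrite amD amN. Qed.
Lemma amZ (c : k) x : f (c *: x) = c *: f x.
Proof. by rewrite -mulr_algl amM amC mulr_algl. Qed.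
Lemma am_sum (J : Type) (r : seq J) (P : pred J) (F : J -> R) :
  f (\sum_(i <- r | P i) F i) = \sum_(i <- r | P i) f (F i).
Proof. exact: (big_morph f amD am0). Qed.
Lemma am_ipow (I : {pred R}) (J : {pred S}) : (forall x, x \in I -> f x \in J) ->
  forall n x, ipow I n x -> ipow J n (f x).
Proof. exact: (ipow_morph am0 amD amM). Qed.

End AlgMorph.

Section Euler.
Variables (k : fieldType) (char0 : [pchar k] =i pred0) (R : comAlgType k).
Variables (I : finType) (z : I -> R) (D : I -> R -> R).
Hypothesis hD : forall i, der (D i).
Hypothesis Dz : forall i l, D i (z l) = (i == l)%:R.

Definition euler (x : R) : R := \sum_i z i * D i x.

Lemma euler_der : der euler.
Proof. by apply: (der_sumf (D := fun i x => z i * D i x)) => i; apply: der_mull. Qed.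

Lemma euler_z i : euler (z i) = z i.
Proof.
rewrite /euler (bigD1 i) //= Dz eqxx mulr1 big1 ?addr0 // => l ne.
by rewrite Dz (negPf ne) mulr0.
Qed.

Lemma euler_ipow n x : ipow (span z) n x -> ipow (span z) n.+1 (euler x - n%:R * x).
Proof.
have eM := derM euler_der.
elim: n x => [|n IH] x.
  move=> _; rewrite mul0r subr0; apply: ipow1_mem; apply: span_sum => i _.
  by rewrite mulrC; apply: spanM; apply: span_gen.
move=> /ipow_span_coef[c -> hc].
rewrite (der_sum euler_der) mulr_sumr -sumrB; apply: ipow_sum => i _.
have -> : euler (c i * z i) - n.+1%:R * (c i * z i) =
    z i * (euler (c i) - n%:R * c i).
  by rewrite eM euler_z -natr1; ring.
by apply: ipow_mem; [exact: span_gen|exact: IH].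
Qed.

Lemma euler_step n x : ipow (span z) n.+1 x ->
  (forall i, ipow (span z) n.+1 (D i x)) -> ipow (span z) n.+2 x.
Proof.
move=> hx hDx.
have h : ipow (span z) n.+2 (n.+1%:R * x).
  apply: ipow_subl (euler_ipow hx) _; apply: ipow_sum => i _.
  by apply: ipow_mem => //; apply: span_gen.
rewrite -(scale1r x) -(mulVf (natk_neq0 char0 n)) -scalerA -mulr_algl; apply: ipowM.
by rewrite scaler_nat -[x *+ _]mulr_natl.
Qed.

End Euler.

(* R is the ring of power series in z over R0, with constant term map p and
   coordinate derivations D. *)
Record taylor (k : fieldType) (R R0 : comAlgType k) (m : idealr R) (m0 : idealr R0)
    (I : finType) (z : I -> R) (D : I -> R -> R) (j : R0 -> R) (p : R -> R0) : Prop :=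
  Taylor {
    tl_complete : @adic_complete R m R^o;
    tl_mem : forall i, z i \in m;
    tl_der : forall i, der (D i);
    tl_dual : forall i l, D i (z l) = (i == l)%:R;
    tl_j : alg_morph j;
    tl_p : alg_morph p;
    tl_jm : forall b, b \in m0 -> j b \in m;
    tl_pm : forall a, a \in m -> p a \in m0;
    tl_Dj : forall i b, D i (j b) = 0;
    tl_pj : forall b, p (j b) = b;
    tl_pz : forall i, p (z i) = 0;
    tl_dec : forall a, a - j (p a) \in span z
  }.

Section TaylorTheory.
Variables (k : fieldType) (char0 : [pchar k] =i pred0).
Variables (R R0 : comAlgType k) (m : idealr R) (m0 : idealr R0).
Variables (I : finType) (z : I -> R) (D : I -> R -> R) (j : R0 -> R) (p : R -> R0).
Hypothesis T : taylor m m0 z D j p.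

Lemma span_z_max : {subset span z <= m}.
Proof. exact/span_sub/(tl_mem T). Qed.

Lemma taylor_ker a : p a = 0 -> a \in span z.
Proof. by move=> pa; have := tl_dec T a; rewrite pa (am0 (tl_j T)) subr0. Qed.

(** This replaces the comparison of coefficients. Derivatives may be sums of two members of Q
    because that is what the Leibniz rule yields for the set used in [faithful_up]. *)
Lemma taylor_zero (Q : R -> Prop) : (forall a, Q a -> p a = 0) ->
  (forall i a, Q a -> exists b c, [/\ Q b, Q c & D i a = b + c]) ->
  forall a, Q a -> a = 0.
Proof.
move=> Qp QD; suff h n a : Q a -> ipow (span z) n.+1 a.
  move=> a Qa; apply: (adic_separated (tl_complete T)) => n.
  by apply: ipowS; apply: (ipow_mono span_z_max); apply: h.
elim: n a => [|n IH] a Qa; first by apply/ipow1_mem/taylor_ker/Qp.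
apply: (euler_step char0 (tl_der T) (tl_dual T)); first exact: IH.
by move=> i; have [b [c [Qb Qc ->]]] := QD i a Qa; apply: ipowD; apply: IH.
Qed.

Lemma taylor_der0 (E : R -> R) : der E -> (forall b, E (j b) = 0) ->
  (forall i, E (z i) = 0) -> forall a, E a = 0.
Proof.
move=> hE Ej Ez a; apply: (adic_separated (tl_complete T)) => n.
elim: n a => [|n IH] a //.
have /spanP[c ac] := tl_dec T a; rewrite -(subrK (j (p a)) a) ac.
rewrite (derD hE) Ej addr0 (der_sum hE); apply: ipow_sum => i _.
rewrite (derM hE) Ez mulr0 add0r; apply: ipow_mem => //; exact: (tl_mem T).
Qed.

Variables (W : finType) (w : W -> R0).

Definition full_gens (u : W + I) : R :=
  match u with inl v => j (w v) | inr i => z i end.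

Lemma full_gens_span :
  (forall b, b \in m0 <-> b \in span w) ->
  forall a, a \in m <-> a \in span full_gens.
Proof.
move=> hw a; set s := full_gens; split; last first.
  apply: span_sub => -[v|i]; last exact: (tl_mem T).
  by apply: (tl_jm T); apply/hw/span_gen.
move=> /(tl_pm T)/hw/spanP[e pe]; rewrite -(subrK (j (p a)) a); apply: spanD.
  have /spanP[e' ->] := tl_dec T a; apply: span_sum => i _.
  by apply: spanM; exact: (span_gen s (inr i)).
rewrite pe (am_sum (tl_j T)); apply: span_sum => v _; rewrite (amM (tl_j T)).
by apply: spanM; exact: (span_gen s (inl v)).
Qed.

End TaylorTheory.

(** * Derivations of tensor products and their extension to power series *)

Section TensorMaps.
Variables (k : fieldType) (B C : poissonAlgType k).

Definition tmap (f : B -> B) (g : C -> C) : tensor B C -> tensor B C :=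
  mlift (fun u : B * C => tens (f u.1) (g u.2)).

Lemma tmap_bilinear (f : B -> B) (g : C -> C) : linear f -> linear g ->
  bilinear_map (fun u : B * C => tens (f u.1) (g u.2)).
Proof.
move=> hf hg; split=> [b|c] a x y /=; first by rewrite hg tens_linearr.
by rewrite hf tens_linearl.
Qed.

Section Tmap.
Variables (f : B -> B) (g : C -> C).
Hypotheses (hf : linear f) (hg : linear g).

Lemma tmapE b c : tmap f g (tens b c) = tens (f b) (g c).
Proof. exact: (mlift_gen (b, c) (tmap_bilinear hf hg)). Qed.
Lemma tmap_linear : linear (tmap f g).
Proof. exact: (mlift_linear (tmap_bilinear hf hg)). Qed.
Lemma tmapD : {morph tmap f g : x y / x + y}.
Proof. by move=> x y; have := tmap_linear 1 x y; rewrite !scale1r. Qed.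
Lemma tmap0 : tmap f g 0 = 0.
Proof. by apply: (addIr (tmap f g 0)); rewrite -tmapD !add0r. Qed.
Lemma tmapZ a x : tmap f g (a *: x) = a *: tmap f g x.
Proof. by have := tmap_linear a x 0; rewrite tmap0 !addr0. Qed.
End Tmap.

Lemma der_linear (A : comAlgType k) (D : A -> A) : der D -> linear D.
Proof. by move=> hD a x y; rewrite (derD hD) (der_scale _ _ hD). Qed.

Lemma linear_id (A : comAlgType k) : linear (@id A). Proof. by []. Qed.

Lemma der_leibniz_tens (E : tensor B C -> tensor B C) :
  {morph E : x y / x + y} -> (forall a : k, E a%:A = 0) ->
  (forall b c b' c', E (tens b c * tens b' c') =
     tens b c * E (tens b' c') + tens b' c' * E (tens b c)) -> der E.
Proof.
move=> ED EC EM; have E0 : E 0 = 0 by have := EC 0; rewrite scale0r.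
split=> // x y; elim/tens_ind: x => [|x x' hx hx'|b c].
- by rewrite mul0r E0; ring.
- by rewrite mulrDl !ED hx hx'; ring.
elim/tens_ind: y => [|y y' hy hy'|b' c']; last exact: EM.
- by rewrite mulr0 E0; ring.
- by rewrite mulrDr !ED hy hy'; ring.
Qed.

Lemma tmap_derl (D : B -> B) : der D -> der (tmap D id).
Proof.
move=> hD; have lD := der_linear hD; have li := @linear_id C.
apply: der_leibniz_tens => [|a|b c b' c']; first exact: tmapD.
  by rewrite tmapZ // -tens11 tmapE // (der1 hD) tens0l scaler0.
rewrite tensM !tmapE // !tensM (derM hD) tensDl.
by rewrite (mulrC c' c).
Qed.

Lemma tmap_derr (D : C -> C) : der D -> der (tmap id D).
Proof.
move=> hD; have lD := der_linear hD; have li := @linear_id B.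
apply: der_leibniz_tens => [|a|b c b' c']; first exact: tmapD.
  by rewrite tmapZ // -tens11 tmapE // (der1 hD) tens0r scaler0.
rewrite tensM !tmapE // !tensM (derM hD) tensDr.
by rewrite (mulrC b' b).
Qed.

End TensorMaps.

(* C is a ring of power series in z over k, embedded in R by s as the constant
   coefficient series. *)
Record coordinates (k : fieldType) (R C : comAlgType k) (m : idealr R) (mC : idealr C)
    (I : finType) (z : I -> R) (D : I -> R -> R) (zC : I -> C) (DC : I -> C -> C)
    (s : C -> R) : Prop := Coordinates {
    co_mem : forall i, zC i \in mC;
    co_der : forall i, der (DC i);
    co_dual : forall i l, DC i (zC l) = (i == l)%:R;
    co_dec : forall c, exists l : k, c - l%:A \in span zC;
    co_s : alg_morph s;
    co_sm : forall c, c \in mC -> s c \in m;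
    co_sz : forall i, s (zC i) = z i;
    co_sD : forall i c, D i (s c) = s (DC i c)
  }.

Section TensorTaylor.
Variables (k : fieldType) (char0 : [pchar k] =i pred0).
Variables (R : comAlgType k) (R0 C : poissonAlgType k).
Variables (m : idealr R) (m0 : idealr R0) (mC : idealr C).
Variables (I : finType) (z : I -> R) (D : I -> R -> R) (j : R0 -> R) (p : R -> R0).
Variables (zC : I -> C) (DC : I -> C -> C) (s : C -> R).
Hypothesis T : taylor m m0 z D j p.
Hypothesis S : coordinates m mC z D zC DC s.
Local Notation t := (tensor_ideal m0 mC).
Local Notation tmi := (Idealr.clone (tensor R0 C) (tensor_ideal m0 mC) _).

Definition tau : tensor R0 C -> R := mlift (fun u : R0 * C => j u.1 * s u.2).

Let tau_bil : bilinear_map (fun u : R0 * C => j u.1 * s u.2).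
Proof.
split=> [b|c] a x y /=.
  by rewrite (amD (co_s S)) (amZ (co_s S)) mulrDr -scalerAr.
by rewrite (amD (tl_j T)) (amZ (tl_j T)) mulrDl -scalerAl.
Qed.

Lemma tauE b c : tau (tens b c) = j b * s c.
Proof. exact: (mlift_gen (b, c) tau_bil). Qed.

Lemma tau_alg : alg_morph tau.
Proof.
have lin : linear tau by exact: (mlift_linear tau_bil).
have tauD : {morph tau : x y / x + y}.
  by move=> x y; have := lin 1 x y; rewrite !scale1r.
have tau0 : tau 0 = 0 by apply: (addIr (tau 0)); rewrite -tauD !add0r.
split=> // [x y|c]; last first.
  have := lin c 1 0; rewrite tau0 !addr0 => ->.
  by rewrite -tens11 tauE (am1 (tl_j T)) (am1 (co_s S)) mulr1.
elim/tens_ind: x => [|x x' hx hx'|b c]; first by rewrite mul0r tau0 mul0r.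
  by rewrite mulrDl !tauD hx hx' mulrDl.
elim/tens_ind: y => [|y y' hy hy'|b' c']; first by rewrite mulr0 tau0 mulr0.
  by rewrite mulrDr !tauD hy hy' mulrDr.
by rewrite tensM !tauE (amM (tl_j T)) (amM (co_s S)); ring.
Qed.

Lemma tau_max x : x \in t -> tau x \in m.
Proof.
move=> /asboolP[r [hr ->]]; rewrite (am_sum tau_alg) big_seq; apply: rpred_sum => q.
move=> /hr /orP[h|h]; rewrite tauE.
  by rewrite mulrC; apply: idealMr; apply: (tl_jm T).
by apply: idealMr; apply: (co_sm S).
Qed.

Let zT (i : I) : tensor R0 C := tens 1 (zC i).
Let DT (i : I) := tmap (@id R0) (DC i).
Let DT_der i : der (DT i). Proof. exact/tmap_derr/(co_der S). Qed.
Let DTE i b c : DT i (tens b c) = tens b (DC i c).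
Proof. by apply: tmapE; [exact: linear_id|exact/der_linear/(co_der S)]. Qed.

Let DT_dual i l : DT i (zT l) = (i == l)%:R.
Proof. by rewrite DTE (co_dual S); case: eqP; rewrite ?tens0r. Qed.

Lemma tau_D i x : D i (tau x) = tau (DT i x).
Proof.
have tD := amD tau_alg.
elim/tens_ind: x => [|x y hx hy|b c].
- by rewrite (der0 (DT_der i)) (am0 tau_alg) (der0 (tl_der T i)).
- by rewrite (derD (DT_der i)) !tD (derD (tl_der T i)) hx hy.
by rewrite DTE !tauE (derM (tl_der T i)) (tl_Dj T) (co_sD S) mulr0 addr0.
Qed.

Let tZ i : zT i \in t.
Proof.
apply/asboolP; exists [:: (1, zC i)]; rewrite big_seq1; split=> // q.
by rewrite inE => /eqP -> /=; rewrite (co_mem S) orbT.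
Qed.

Let const_t b : b \in m0 -> tens b 1 \in t.
Proof.
move=> mb; apply/asboolP; exists [:: (b, 1)]; rewrite big_seq1; split=> // q.
by rewrite inE => /eqP -> /=; rewrite mb.
Qed.

Let ps c : exists2 l : k, p (s c) = l%:A & c - l%:A \in span zC.
Proof.
have [l hl] := co_dec S c; exists l => //.
have /spanP[e ce] := hl; rewrite -(subrK l%:A c) ce.
rewrite (amD (co_s S)) (amC (co_s S)) (amD (tl_p T)) (amC (tl_p T)).
rewrite (am_sum (co_s S)) (am_sum (tl_p T)) big1 ?add0r // => i _.
by rewrite (amM (co_s S)) (co_sz S) (amM (tl_p T)) (tl_pz T) mulr0.
Qed.

Let tens_dec x : x - tens (p (tau x)) 1 \in span zT.
Proof.
have pD := amD (tl_p T); have tD := amD tau_alg.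
elim/tens_ind: x => [|x y hx hy|b c].
- by rewrite (am0 tau_alg) (am0 (tl_p T)) tens0l subrr span0.
- by rewrite tD pD tensDl opprD addrACA spanD.
rewrite tauE (amM (tl_p T)) (tl_pj T); have [l -> /spanP[e ce]] := ps c.
rewrite -scalerAr mulr1 tensZl -tensZr -tensNr -tensDr ce raddf_sum.
apply: span_sum => i _ /=; rewrite -[b]mulr1 -tensM.
by apply: spanM; apply: span_gen.
Qed.

(* Modulo t^(l+1), dividing Euler's relation E y = q y + ... by q moves x into
   (z)^q for every q. *)
Lemma tau_ipow_inv l x : ipow m l (tau x) -> ipow t l x.
Proof.
elim: l x => [|l IH] x // hx.
have DTt i y : ipow t l.+1 y -> ipow t l (DT i y) by apply: der_ipow.
pose E := euler zT DT.
have hE : der E by exact: euler_der.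
have Et y : (forall i, ipow t l (DT i y)) -> ipow t l.+1 (E y).
  by move=> h; apply: ipow_sum => i _; apply: ipow_mem.
have Ex : ipow t l.+1 (E x).
  apply: Et => i; apply: IH; rewrite -tau_D; apply: der_ipow => //; exact: (tl_der T).
have pt : ipow t l.+1 (tens (p (tau x)) 1).
  have hp := am_ipow (tl_p T) (tl_pm T) hx; move: (p _) hp.
  apply: (ipow_morph (f := fun b => tens b (1 : C))); first exact: tens0l.
  - by move=> b c; apply: tensDl.
  - by move=> b c; rewrite tensM mulr1.
  exact: const_t.
have key q : exists2 y, ipow t l.+1 (x - y) & ipow (span zT) q.+1 y.
  elim: q => [|q [y hy zy]].
    exists (x - tens (p (tau x)) 1); last exact/ipow1_mem/tens_dec.
    by rewrite subKr.
  have Ey : ipow t l.+1 (E y).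
    rewrite -(subKr x y) (derB hE); apply: ipowB => //.
    by apply: Et => i; apply: DTt.
  have hr := euler_ipow DT_der DT_dual zy.
  pose c : k := (q.+1%:R)^-1.
  exists (- (c *: (E y - q.+1%:R * y))); last first.
    by rewrite -scalerN -mulr_algl; apply/ipowM/ipowN.
  have -> : - (c *: (E y - q.+1%:R * y)) = y - c *: E y.
    rewrite scalerBr opprB; congr (_ - _).
    by rewrite mulr_natl -scaler_nat scalerA mulVf ?scale1r // natk_neq0.
  rewrite opprB addrA addrAC; apply: ipowD => //.
  by rewrite -mulr_algl; apply: ipowM.
have [y hy zy] := key l; apply: (ipow_subr hy).
by apply: ipow_mono zy => w; apply: (@span_sub _ _ zT tmi) => i; exact: tZ.
Qed.

Lemma tau_dense a l : exists x, ipow m l (a - tau x).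
Proof.
elim: l a => [|l IH] a; first by exists 0.
have /spanP[c ac] := tl_dec T a.
have [x hx] := fun_choice (fun i => IH (c i)).
exists (tens (p a) 1 + \sum_i x i * zT i).
rewrite (amD tau_alg) tauE (am1 (co_s S)) mulr1 opprD addrA ac (am_sum tau_alg) -sumrB.
apply: ipow_sum => i _; rewrite (amM tau_alg) [tau (zT i)]tauE (am1 (tl_j T)) mul1r.
rewrite (co_sz S) -mulrBl mulrC; apply: ipow_mem => //; exact: (tl_mem T).
Qed.

(** The derivation d (x) id of R0 (x) C is continuous for the topology induced by R, which is the
    tensor topology by [tau_ipow_inv], and the image of [tau] is dense. *)
Lemma taylor_extend (d : R0 -> R0) : der d -> exists E : R -> R,
  [/\ der E, forall b, E (j b) = j (d b) & forall i, E (z i) = 0].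
Proof.
move=> hd; have hD := tmap_derl C hd.
have [||||||E [hE Etau]] := der_extend (tl_complete T) (f := tau) (D := tmap d id).
- exact: amD tau_alg.
- exact: amM tau_alg.
- exact: amC tau_alg.
- by [].
- exact: tau_dense.
- move=> l x /tau_ipow_inv /(der_ipow hD).
  by apply: (am_ipow tau_alg); apply: tau_max.
have dE b c : tmap d id (tens b c) = tens (d b) c.
  by apply: tmapE; [exact: der_linear|exact: linear_id].
exists E; split=> // [b|i].
  have := Etau (tens b 1); rewrite dE !tauE (am1 (co_s S)) !mulr1; exact.
have := Etau (zT i); rewrite dE (der1 hd) tens0l (am0 tau_alg) tauE.
by rewrite (am1 (tl_j T)) mul1r (co_sz S).
Qed.

End TensorTaylor.

Record hamiltonian_coordinates (k : fieldType) (R R0 : poissonAlgType k) (I : finType)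
    (z : I -> R) (D : I -> R -> R) (j : R0 -> R) (c : I -> k) (dual : I -> I) : Prop :=
  HamiltonianCoordinates {
    hc_j : forall a b, j {[a, b]} = {[j a, j b]};
    hc_D : forall i x, D i x = c i *: {[x, z (dual i)]};
    hc_c : forall i, c i != 0;
    hc_dual : involutive dual
  }.

(** * Non-degeneracy over the constants and over the power series *)

Section Faithful.
Variables (k : fieldType) (char0 : [pchar k] =i pred0).
Variables (R R0 : poissonAlgType k) (m : idealr R) (m0 : idealr R0).
Variables (I : finType) (z : I -> R) (D : I -> R -> R) (j : R0 -> R) (p : R -> R0).
Variables (c : I -> k) (dual : I -> I).
Hypothesis T : taylor m m0 z D j p.
Hypothesis H : hamiltonian_coordinates z D j c dual.

Lemma bracket_z i x : {[x, z i]} = (c (dual i))^-1 *: D (dual i) x.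
Proof. by rewrite (hc_D H) scalerA mulVf ?(hc_c H) // scale1r (hc_dual H). Qed.

Lemma bracket_const_z b i : {[j b, z i]} = 0.
Proof. by rewrite bracket_z (tl_Dj T) scaler0. Qed.

Variables (W : finType) (w : W -> R0).

(** A relation among the Hamiltonian derivations of the w_v gives a derivation F of R vanishing on
    constants and coordinates, hence zero. So the relation persists in R, where it can be tested on
    the extension of d. *)
Lemma faithful_down : (forall d : R0 -> R0, der d ->
    exists E : R -> R, [/\ der E, forall b, E (j b) = j (d b) & forall i, E (z i) = 0]) ->
  hamiltonian_faithful (full_gens z j w) -> hamiltonian_faithful w.
Proof.
move=> ext faith a ha d hd; have [E [hE Ej _]] := ext d hd.
pose F x := \sum_v j (a v) * {[j (w v), x]}.
have hF : der F.
  by apply: (der_sumf (D := fun v x => j (a v) * {[j (w v), x]})) => v;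
    apply/der_mull/poisson_der.
have F0 : forall x, F x = 0.
  apply: (taylor_der0 T hF) => [b|i].
    rewrite -(am0 (tl_j T)) -(ha b) (am_sum (tl_j T)); apply: eq_bigr => v _.
    by rewrite (amM (tl_j T)) (hc_j H).
  by apply: big1 => v _; rewrite bracket_const_z mulr0.
pose a' (u : W + I) := match u with inl v => j (a v) | inr i => 0 end.
have := faith a' _ E hE; rewrite big_sumType /= [X in _ + X]big1 => [|i _]; last first.
  by rewrite mul0r.
rewrite addr0 => h; rewrite -(tl_pj T (\sum_v _)) (am_sum (tl_j T)) -[RHS](am0 (tl_p T)).
congr p; rewrite -[RHS]h => [|x].
  by apply: eq_bigr => v _; rewrite (amM (tl_j T)) Ej.
rewrite big_sumType /= [X in _ + X]big1 => [|i _]; last by rewrite mul0r.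
by rewrite addr0; exact: F0.
Qed.

(** Bracketing the relation with the conjugate of z_i kills its dz_i coefficient. For the rest, Q
    collects the values of all such relations e on all derivations th from R0 to R: constant terms
    vanish by the hypothesis on R0, and D_i of a member is one with e differentiated plus one with
    th differentiated. *)
Lemma faithful_up : hamiltonian_faithful w -> hamiltonian_faithful (full_gens z j w).
Proof.
move=> faith a ha E hE.
have az i : a (inr i) = 0.
  have := ha (z (dual i)); rewrite big_sumType /= big1 ?add0r => [|v _]; last first.
    by rewrite bracket_const_z mulr0.
  rewrite (bigD1 i) //= big1 ?addr0 => [|l ne]; last first.
    by rewrite bracket_z (hc_dual H) (tl_dual T) eq_sym (negPf ne) scaler0 mulr0.
  rewrite bracket_z (hc_dual H) (tl_dual T) eqxx -scalerAr mulr1 => /eqP.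
  by rewrite scaler_eq0 invr_eq0 (negPf (hc_c H i)) => /eqP.
rewrite big_sumType /= [X in _ + X]big1 ?addr0 => [|i _]; last by rewrite az mul0r.
pose Q x := exists e : W -> R, exists th : R0 -> R, [/\ der_along j th,
  forall b, \sum_v e v * j {[w v, b]} = 0 & x = \sum_v e v * th (w v)].
apply: (taylor_zero char0 T (Q := Q)).
- move=> x [e [th [hth he ->]]]; rewrite (am_sum (tl_p T)).
  under eq_bigr => v _ do rewrite (amM (tl_p T)).
  apply: (faith (fun v => p (e v)) _ (p \o th)).
    move=> b; rewrite -[RHS](am0 (tl_p T)) -[in RHS](he b) (am_sum (tl_p T)).
    by apply: eq_bigr => v _; rewrite (amM (tl_p T)) (tl_pj T).
  split=> [u y|l|u y] /=; first by rewrite (derD hth) (amD (tl_p T)).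
    by rewrite (derC hth) (am0 (tl_p T)).
  by rewrite (derM hth) (amD (tl_p T)) !(amM (tl_p T)) !(tl_pj T).
- move=> i x [e [th [hth he ->]]]; have hD := tl_der T i.
  exists (\sum_v D i (e v) * th (w v)), (\sum_v e v * D i (th (w v))); split.
  + exists (fun v => D i (e v)), th; split=> // b.
    rewrite -[RHS](der0 hD) -[in RHS](he b) (der_sum hD); apply: eq_bigr => v _.
    by rewrite (derM hD) (tl_Dj T) mulr0 add0r mulrC.
  + exists e, (D i \o th); split=> //; split=> [u y|l|u y] /=.
    - by rewrite (derD hth) (derD hD).
    - by rewrite (derC hth) (der0 hD).
    by rewrite (derM hth) (derD hD) !(derM hD) !(tl_Dj T) !mulr0 !addr0.
  rewrite (der_sum hD) -big_split; apply: eq_bigr => v _ /=.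
  by rewrite (derM hD); ring.
exists (fun v => a (inl v)), (E \o j); split=> //.
  split=> [x y|l|x y] /=; first by rewrite (amD (tl_j T)) (derD hE).
    by rewrite (amC (tl_j T)) (derC hE).
  by rewrite (amM (tl_j T)) (derM hE).
move=> b; have := ha (j b); rewrite big_sumType /= [X in _ + X]big1 ?addr0 => [h|i _].
  by rewrite -[RHS]h; apply: eq_bigr => v _; rewrite (hc_j H).
by rewrite az mul0r.
Qed.

End Faithful.

(** * Symplectic splitting *)

Section Centralizer.
Variables (k : fieldType) (A : poissonAlgType k) (I : finType) (z : I -> A).

Definition centralizer : {pred A} := fun a => `[< forall i, {[a, z i]} = 0 >].

Lemma centralizerP a : reflect (forall i, {[a, z i]} = 0) (a \in centralizer).
Proof. exact: asboolP. Qed.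

Fact centralizer_subring : subring_closed centralizer.
Proof.
split=> [|a b /centralizerP ha /centralizerP hb|a b /centralizerP ha /centralizerP hb].
- by apply/centralizerP => i; rewrite poisson1l.
- by apply/centralizerP => i; rewrite poissonBl ha hb subr0.
by apply/centralizerP => i; rewrite poissonMl ha hb !mul0r addr0.
Qed.
HB.instance Definition _ :=
  GRing.isSubringClosed.Build A centralizer centralizer_subring.

Lemma centralizerZ (c : k) a : a \in centralizer -> c *: a \in centralizer.
Proof. by move=> /centralizerP ha; apply/centralizerP => i; rewrite poissonZl ha scaler0. Qed.

Lemma centralizer_bracket a b :
  a \in centralizer -> b \in centralizer -> {[a, b]} \in centralizer.
Proof.
move=> /centralizerP ha /centralizerP hb; apply/centralizerP => i.
have za : {[z i, a]} = 0 by rewrite poissonC ha oppr0.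
have zb : {[z i, b]} = 0 by rewrite poissonC hb oppr0.
by rewrite poissonC poisson_leibniz za zb poisson0l poisson0r addr0 oppr0.
Qed.

Definition centr : Type := {a : A | centralizer a}.
HB.instance Definition _ := SubChoice.copy centr {a : A | centralizer a}.
HB.instance Definition _ := [SubChoice_isSubComNzRing of centr by <:].

Definition centr_scale (c : k) (x : centr) : centr :=
  Sub (c *: val x) (centralizerZ c (valP x)).
Lemma val_centr_scale c x : val (centr_scale c x) = c *: val x. Proof. by []. Qed.

Fact centr_scalerA a b v : centr_scale a (centr_scale b v) = centr_scale (a * b) v.
Proof. by apply: val_inj; rewrite !val_centr_scale scalerA. Qed.
Fact centr_scale1r : left_id 1 centr_scale.
Proof. by move=> v; apply: val_inj; rewrite val_centr_scale scale1r. Qed.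
Fact centr_scalerDr : right_distributive centr_scale +%R.
Proof.
move=> a u v; apply: val_inj; rewrite val_centr_scale.
by rewrite -[RHS]/(a *: val u + a *: val v) -scalerDr.
Qed.
Fact centr_scalerDl v : {morph centr_scale^~ v : a b / a + b}.
Proof.
move=> a b; apply: val_inj; rewrite val_centr_scale.
by rewrite -[RHS]/(a *: val v + b *: val v) scalerDl.
Qed.
HB.instance Definition _ := GRing.Zmodule_isLmodule.Build k centr
  centr_scalerA centr_scale1r centr_scalerDr centr_scalerDl.

Fact centr_scalerAl (a : k) (u v : centr) : a *: (u * v) = (a *: u) * v.
Proof. by apply: val_inj; exact: scalerAl. Qed.
HB.instance Definition _ := GRing.Lmodule_isLalgebra.Build k centr centr_scalerAl.
HB.instance Definition _ := GRing.Lalgebra_isComAlgebra.Build k centr.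

Definition centr_poisson (x y : centr) : centr :=
  Sub {[val x, val y]} (centralizer_bracket (valP x) (valP y)).

Fact centr_poisson_linear x : linear (centr_poisson x).
Proof.
move=> a u v; apply: val_inj.
rewrite -[RHS]/(a *: {[val x, val u]} + {[val x, val v]}) -poissonZr -poissonDr.
by [].
Qed.
Fact centr_poissonC x y : centr_poisson x y = - centr_poisson y x.
Proof. by apply: val_inj; exact: poissonC. Qed.
Fact centr_poissonMr x y w :
  centr_poisson x (y * w) = centr_poisson x y * w + centr_poisson x w * y.
Proof. by apply: val_inj; exact: poissonMr. Qed.
Fact centr_poisson_jacobi x y w : centr_poisson x (centr_poisson y w)
  + centr_poisson y (centr_poisson w x) + centr_poisson w (centr_poisson x y) = 0.
Proof. by apply: val_inj; exact: poisson_jacobi. Qed.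
Fact centr_poisson1l x : centr_poisson 1 x = 0.
Proof. by apply: val_inj; exact: poisson1l. Qed.
HB.instance Definition _ := isPoisson.Build k centr centr_poisson_linear
  centr_poissonC centr_poissonMr centr_poisson_jacobi centr_poisson1l.

Lemma val_alg_morph : alg_morph (val : centr -> A).
Proof. by split. Qed.

Lemma centrP (x : centr) i : {[val x, z i]} = 0.
Proof. exact: (centralizerP _ (valP x)). Qed.

Variables (m : idealr A).
Definition centr_max : {pred centr} := fun x => val x \in m.
Fact centr_max_ideal : idealr_closed centr_max.
Proof.
split=> [||a x y]; first exact: (rpred0 m); first by rewrite -[_ \in _]/(1 \in m) idealr1.
by move=> hx hy; apply: rpredD => //; apply: idealMr.
Qed.
HB.instance Definition _ := isIdealr.Build centr centr_max centr_max_ideal.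

Definition centr_ideal : idealr centr := Idealr.clone centr centr_max _.

End Centralizer.

(** Canonical pairs kept in a single family: [dual] exchanges the two members of a pair, and c i
    normalizes c i {-, z (dual i)} to be the partial derivative along z i. *)
Record symplectic (k : fieldType) (A : poissonAlgType k) (m : {pred A}) (I : finType)
    (z : I -> A) (c : I -> k) (dual : I -> I) : Prop := Symplectic {
    sy_mem : forall i, z i \in m;
    sy_dual : involutive dual;
    sy_c : forall i, c i != 0;
    sy_z : forall i l, c i *: {[z l, z (dual i)]} = (i == l)%:R
  }.

Section SymplecticSplitting.
Variables (k : fieldType) (char0 : [pchar k] =i pred0).
Variables (A : poissonAlgType k) (m : idealr A).
Hypothesis hA : complete_local m.
Variables (I : finType) (z : I -> A) (c : I -> k) (dual : I -> I).
Hypothesis hz : symplectic m z c dual.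
Local Notation B := (centr z).
Local Notation mB := (centr_ideal z m).

Let hadic : @adic_complete A m A^o. Proof. by case: hA. Qed.

Definition partial (i : I) (a : A) : A := c i *: {[a, z (dual i)]}.

Lemma partial_der i : der (partial i).
Proof.
have h := der_mull (c i)%:A (poisson_derl (z (dual i))).
by rewrite (_ : partial i = fun x => (c i)%:A * {[x, z (dual i)]}) //;
  apply/funext => x; rewrite mulr_algl.
Qed.

Lemma partial_z i l : partial i (z l) = (i == l)%:R.
Proof. exact: sy_z hz i l. Qed.

Lemma bracket_coord a i : {[a, z i]} = (c (dual i))^-1 *: partial (dual i) a.
Proof. by rewrite /partial scalerA mulVf ?(sy_c hz) // scale1r (sy_dual hz). Qed.

Lemma bracket_zz i l : exists e : k, {[z i, z l]} = e%:A.
Proof.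
rewrite bracket_coord partial_z; exists ((c (dual l))^-1 * (dual l == i)%:R).
by rewrite -scalerA scaler_nat.
Qed.

(** The brackets of coordinates are scalars, hence central, so their Hamiltonian derivations commute
    by Jacobi. *)
Lemma partialC i l a : partial i (partial l a) = partial l (partial i a).
Proof.
rewrite /partial !poissonZl !scalerA mulrC; congr (_ *: _).
have [e ze] := bracket_zz (dual l) (dual i).
have := poisson_leibniz a (z (dual l)) (z (dual i)).
rewrite ze poissonZr poisson1r scaler0 => /esym /eqP.
by rewrite addr_eq0 -poissonC => /eqP.
Qed.

Lemma centralizer_partial a : a \in centralizer z <-> forall i, partial i a = 0.
Proof.
split=> [/centralizerP h i|h]; first by rewrite /partial h scaler0.
by apply/centralizerP => i; rewrite bracket_coord h scaler0.
Qed.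

(** The coordinates are removed one by one: subtracting z_i x with D_i (z_i x) = D_i b makes b
    constant along z_i. The second clause of [der_integral] keeps it constant along the coordinates
    already treated. *)
Lemma splitting_ex a : exists x : B, a - val x \in span z.
Proof.
suff [b [hb ab]] : exists b, (forall i, i \in enum I -> partial i b = 0) /\
    a - b \in span z.
  have Bb : b \in centralizer z.
    by apply/centralizer_partial => i; apply: hb; rewrite mem_enum.
  by exists (Sub b Bb : B).
elim: (enum I) => [|i s [b [hb ab]]]; first by exists a; rewrite subrr span0.
have [si|si] := boolP (i \in s).
  by exists b; split=> // l; rewrite inE => /orP[/eqP ->|]; apply: hb.
have zi : partial i (z i) = 1 by rewrite partial_z eqxx.
have [x [hx xE]] := der_integral char0 hadic (partial i b) (partial_der i) (sy_mem hz i) zi.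
exists (b - z i * x); split; last first.
  rewrite opprB addrA addrAC; apply: spanD => //; rewrite mulrC; apply: spanM.
  exact: span_gen.
move=> l; rewrite inE (derB (partial_der l)) => /orP[/eqP ->|sl].
  by rewrite hx subrr.
have li : partial l (z i) = 0.
  by rewrite partial_z; case: eqP => // e; rewrite -e sl in si.
rewrite hb // sub0r (derM (partial_der l)) li mulr0 addr0 xE ?mulr0 ?oppr0 //.
- exact: partial_der.
- by move=> y; apply: partialC.
by rewrite partialC hb // (der0 (partial_der i)).
Qed.

Lemma splitting_uniq (x y : B) : val x - val y \in span z -> x = y.
Proof.
move=> h; apply: val_inj; apply/eqP; rewrite -subr_eq0; apply/eqP.
have zm : {subset span z <= m} by exact/span_sub/(sy_mem hz).
apply: (adic_separated hadic) => n; apply: ipowS; apply: (ipow_mono zm).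
have D0 i : partial i (val x - val y) = 0.
  by apply: (centralizer_partial _).1; apply: rpredB; apply: valP.
elim: n => [|n IH]; first exact: ipow1_mem.
apply: (euler_step char0 partial_der partial_z) => // i.
by rewrite D0; apply: ipow_zero.
Qed.

Definition splitting (a : A) : B := projT1 (cid (splitting_ex a)).
Lemma splittingP a : a - val (splitting a) \in span z.
Proof. exact: projT2 (cid (splitting_ex a)). Qed.

Lemma splittingE a (x : B) : a - val x \in span z -> splitting a = x.
Proof.
move=> h; apply: splitting_uniq.
have -> : val (splitting a) - val x = (a - val x) - (a - val (splitting a)) by ring.
by apply: spanB => //; apply: splittingP.
Qed.

Lemma splitting_alg : alg_morph splitting.
Proof.
split=> [a b|a b|e]; apply: splittingE.
- rewrite (amD (val_alg_morph z)) opprD addrACA; apply: spanD; exact: splittingP.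
- rewrite (amM (val_alg_morph z)).
  have -> : a * b - val (splitting a) * val (splitting b) =
    b * (a - val (splitting a)) + val (splitting a) * (b - val (splitting b)) by ring.
  by apply: spanD; apply: spanM; apply: splittingP.
by rewrite (amC (val_alg_morph z)) subrr span0.
Qed.

Lemma splitting_taylor : taylor m mB z partial (val : B -> A) splitting.
Proof.
split=> //.
- exact: sy_mem hz.
- exact: partial_der.
- exact: partial_z.
- exact: splitting_alg.
- move=> a ma; rewrite -[_ \in _]/(val (splitting a) \in m).
  rewrite -(subKr a (val _)); apply: rpredB => //.
  exact: (span_sub (sy_mem hz) (splittingP a)).
- by move=> i b; apply: (centralizer_partial _).1; apply: valP.
- by move=> b; apply: splittingE; rewrite subrr span0.
- by move=> i; apply: splittingE; rewrite subr0 span_gen.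
exact: splittingP.
Qed.

Local Notation T := splitting_taylor.

Lemma centr_unit (b : B) : b \notin mB -> exists b', b' * b = 1.
Proof.
move=> mb; have [a ha] := complete_unit hA (mb : val b \notin m).
exists (splitting a); rewrite -[b in LHS](tl_pj T) -(amM (tl_p T)) ha.
exact: am1 (tl_p T).
Qed.

(** B is a retract of A through [splitting]: an ideal of B is generated by the images of generators
    of its preimage, and limits are taken in A and projected. *)
Lemma centr_complete_local : complete_local mB.
Proof.
have sub (J : idealr B) : {subset J <= mB}.
  move=> x Jx; apply/negPn/negP => /centr_unit[b hb].
  by have := idealr1 J; rewrite -hb idealMr.
split.
- split=> [J _|n nmax]; first exact: sub.
  by move=> x; apply/idP/idP; [exact: sub|apply: nmax; exact: sub].
- move=> J; pose J' : {pred A} := fun a => splitting a \in J.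
  have hJ' : idealr_closed J'.
    split; rewrite -?[_ \in J']/(splitting _ \in J).
    + by rewrite (am0 (tl_p T)) rpred0.
    + by rewrite (am1 (tl_p T)) idealr1.
    move=> a x y hx hy; rewrite -[_ \in J']/(splitting _ \in J).
    by rewrite (amD (tl_p T)) (amM (tl_p T)) rpredD ?idealMr.
  have [_ hn _ _] := hA; have [s hs] := hn (mk_idealr hJ').
  exists [seq splitting a | a <- s] => x; split=> [Jx|[e ->]].
    have /hs[e xe] : val x \in mk_idealr hJ'.
      by rewrite mk_idealrE -[_ \in J']/(splitting _ \in J) (tl_pj T).
    exists (fun i => splitting (e i)).
    rewrite -(tl_pj T x) xe (am_sum (tl_p T)) size_map; apply: eq_bigr => i _.
    by rewrite (amM (tl_p T)) (nth_map 0).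
  apply: rpred_sum => i _; apply: idealMr.
  have /mapP[a /(generates_mem hs) ha ->] := mem_nth 0 (ltn_ord i).
  by rewrite mk_idealrE in ha.
- move=> b; have [_ _ /(_ (val b))[e [he eu]] _] := hA; exists e; split.
    by rewrite -[_ \in _]/(val b - e%:A \in m).
  by move=> e' he'; apply: eu.
have vm (x : B) : x \in mB -> val x \in m by [].
apply: complete_of_steps => [u hu|x hx].
  have [|l hl] := adic_limit hadic (u := fun n => val (u n)).
    by move=> n; have := am_ipow (tl_j T) vm (hu n); rewrite (amB (tl_j T)).
  exists (splitting l) => n; rewrite -(tl_pj T (u n)) -(amB (tl_p T)).
  exact: (am_ipow (tl_p T) (tl_pm T)).
apply: val_inj; apply: (adic_separated hadic) => n.
exact: (am_ipow (tl_j T) vm).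
Qed.

End SymplecticSplitting.

Section Symplectic.
Variables (k : fieldType) (char0 : [pchar k] =i pred0).
Variables (A : poissonAlgType k) (m : idealr A).
Hypothesis hA : complete_local m.

Lemma poisson_self (a : A) : {[a, a]} = 0.
Proof.
apply: (natr_inj0 char0 (n := 1)); rewrite mulr_natl mulr2n.
by rewrite {2}poissonC subrr.
Qed.

Section Fixed.
Variables (I : finType) (z : I -> A) (c : I -> k) (dual : I -> I).
Hypothesis hz : symplectic m z c dual.
Local Notation B := (centr z).
Local Notation mB := (centr_ideal z m).
Local Notation T := (splitting_taylor char0 hA hz).

(** The z_i are independent in m/m^2: a k-combination of them in m^2 has its partial derivatives in
    m, and these are its scalar coefficients. The matrix M of residues expresses the z_i in the s_j
    modulo m^2. *)
Lemma symplectic_bound q (s : 'I_q -> A) : (forall a, a \in m <-> a \in span s) ->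
  (#|I| <= q)%N.
Proof.
move=> hs; rewrite leqNgt; apply/negP => lt_q.
have zs i : exists e : 'I_q -> A, z i = \sum_j e j * s j.
  by apply/spanP/hs; exact: sy_mem hz i.
have [e he] := fun_choice zs.
have [E hE] : exists E : I -> 'I_q -> k, forall i j, e i j - (E i j)%:A \in m.
  have h i := fun_choice (fun j => residue_ex hA (e i j)).
  exact: fun_choice h.
pose M : 'M[k]_(#|I|, q) := \matrix_(i, j) E (enum_val i) j.
have kerM : kermx M != 0.
  rewrite -mxrank_eq0 mxrank_ker -lt0n subn_gt0.
  exact: leq_ltn_trans (rank_leq_col M) lt_q.
have /rowV0Pn[v vM v0] := kerM.
have {}vM : v *m M = 0 by apply/sub_kermxP.
pose x := \sum_i v 0 i *: z (enum_val i).
have x2 : ipow m 2 x.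
  have -> : x = \sum_j s j * \sum_i v 0 i *: e (enum_val i) j.
    under [RHS]eq_bigr => j _ do rewrite mulr_sumr.
    rewrite exchange_big; apply: eq_bigr => i _; rewrite he scaler_sumr.
    by apply: eq_bigr => j _; rewrite -scalerAr (mulrC (s j)).
  apply: ipow_sum => j _; apply: ipow_mem; first exact/hs/span_gen.
  apply: ipow1_mem.
  have -> : \sum_i v 0 i *: e (enum_val i) j =
      \sum_i v 0 i *: (e (enum_val i) j - (M i j)%:A).
    have h0 : \sum_i v 0 i * M i j = 0.
      by have := congr1 (fun r : 'rV_q => r 0 j) vM; rewrite !mxE.
    under [RHS]eq_bigr => i _ do rewrite scalerBr scalerA.
    by rewrite sumrB -scaler_suml h0 scale0r subr0.
  apply: rpred_sum => i _; rewrite -[v 0 i *: _]mulr_algl; apply: idealMr.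
  by rewrite mxE.
have dx i : partial z c dual (enum_val i) x = (v 0 i)%:A.
  have hD := partial_der z c dual (enum_val i).
  rewrite (der_sum hD) (bigD1 i) //= (der_scale _ _ hD) (partial_z hz) eqxx.
  rewrite big1 ?addr0 // => l ne; rewrite (der_scale _ _ hD) (partial_z hz).
  by rewrite (inj_eq enum_val_inj) eq_sym (negPf ne) scaler0.
case/negP: v0; apply/eqP/rowP => i; rewrite mxE; apply: (scalar_mem (m := m)).
rewrite -dx; apply: ipow1_ideal; apply: der_ipow x2; exact: partial_der.
Qed.

Section Quotient.
Variables (P : poissonIdeal A) (n : idealr (poisson_quot P)).
Hypothesis nmax : maximal_ideal n.
Local Notation pi := (quot_pi P).

(* The class of the constant term of a in P lies in (z) and is killed by the
   coordinate derivations, hence vanishes in A/P by Euler's relation. *)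
Lemma splitting_ideal a : a \in P -> val (splitting char0 hA hz a) \in P.
Proof.
move=> Pa; apply/quot_pi_mem0.
set b := splitting char0 hA hz a.
pose z' := pi \o z.
pose D' i (x : poisson_quot P) := c i *: {[x, z' (dual i)]}.
have hD' i : der (D' i).
  have h := der_mull (c i)%:A (poisson_derl (z' (dual i))).
  by rewrite (_ : D' i = fun x => (c i)%:A * {[x, z' (dual i)]}) //;
    apply/funext => x; rewrite mulr_algl.
have D'pi i x : D' i (pi x) = pi (partial z c dual i x).
  by rewrite /D' /z' /= -quot_pi_poisson -quot_piZ.
have D'z i l : D' i (z' l) = (i == l)%:R.
  rewrite D'pi (partial_z hz); case: eqP => _; [exact: quot_pi1|exact: quot_pi0].
have z'n : {subset span z' <= n}.
  by apply: span_sub => i; rewrite (quot_max_mem hA nmax); exact: sy_mem hz i.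
have zb : pi (val b) \in span z'.
  have /spanP[e he] := tl_dec T a.
  have -> : pi (val b) = - pi (a - val b).
    by rewrite quot_piB (quot_pi_mem0 P a).2 // sub0r opprK.
  apply: spanN; rewrite he quot_pi_sum; apply: span_sum => i _.
  by rewrite quot_piM; apply: spanM; exact: (span_gen z' i).
apply: (adic_separated (quot_complete hA nmax)) => l; apply: ipowS.
apply: (ipow_mono z'n); elim: l => [|l IH]; first exact: ipow1_mem.
apply: (euler_step char0 hD' D'z) => // i.
by rewrite D'pi (tl_Dj T) quot_pi0; apply: ipow_zero.
Qed.

End Quotient.

End Fixed.

Variables (J : poissonIdeal A) (mJ : idealr (poisson_quot J)).
Hypothesis quot_complete : complete_local mJ.
Hypothesis quot_regular : regular_local_at mJ.
Hypothesis quot_nondegenerate : nondegenerate_poisson mJ.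
Local Notation pi := (quot_pi J).

Let mJmax : maximal_ideal mJ.
Proof. by case: quot_complete => -[]. Qed.

Section Step.
Variables (I : finType) (z : I -> A) (c : I -> k) (dual : I -> I).
Hypothesis hz : symplectic m z c dual.
Local Notation B := (centr z).
Local Notation mB := (centr_ideal z m).
Local Notation T := (splitting_taylor char0 hA hz).
Local Notation p := (splitting char0 hA hz).

(** Projecting to B by [splitting], which preserves J, turns the hypothesis into mB inside J + mB^2.
    Hence mB lies in J + mB^l for all l, and J is closed. *)
Lemma centr_sub_of_square :
  (forall b : B, b \in mB -> ipow mJ 2 (pi (val b))) ->
  forall b : B, b \in mB -> val b \in J.
Proof.
move=> h2.
have step (b : B) : b \in mB -> exists2 x : B, val x \in J & ipow mB 2 (b - x).
  move=> /h2/(quot_ipow hA mJmax)[q Jq hq].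
  exists (p q); first exact: (splitting_ideal hz mJmax).
  rewrite -(tl_pj T b) -(amB (tl_p T)); exact: (am_ipow (tl_p T) (tl_pm T)).
have steps l (b : B) : ipow mB l.+1 b -> exists2 x : B, val x \in J & ipow mB l.+2 (b - x).
  move: b; apply: ipowS_ind => [|b b' [x Jx hx] [x' Jx' hx']|a b ma hb].
  - by exists 0; [exact: (rpred0 J)|rewrite subrr; apply: ipow_zero].
  - exists (x + x'); first exact: (rpredD (S := J)).
    by rewrite opprD addrACA; apply: ipowD.
  have [x Jx hx] := step a ma; exists (b * x); first exact: (idealMr (val b) Jx).
  by rewrite mulrC -mulrBr mulrC; exact: (ipow_mul (n := 2)).
move=> b mb; apply: (krull_intersection hA) => l.
suff [x Jx hx] : exists2 x : B, val x \in J & ipow mB l.+1 (b - x).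
  exists (val x) => //; rewrite -(amB (tl_j T)); apply: ipowS.
  exact: (am_ipow (tl_j T) (tl_jm T)).
elim: l => [|l [x Jx /steps[y Jy hy]]].
  by exists 0; [exact: (rpred0 J)|rewrite subr0; apply: ipow1_mem].
by exists (x + y); [exact: (rpredD (S := J))|rewrite opprD addrA].
Qed.

(** A derivation of A/J taking b to a unit is a combination of Hamiltonians of the z_i and of the
    generators w_v of mB. The z_i commute with b, so some {w_v, b} is a unit. *)
Lemma centr_pair : (exists2 b : B, b \in mB & val b \notin J) ->
  exists f g : B, [/\ f \in mB, g \in mB & {[val f, val g]} \notin m].
Proof.
move=> [b0 mb0 Jb0].
have [b mb b2] : exists2 b : B, b \in mB & ~ ipow mJ 2 (pi (val b)).
  apply: contrapT => no; case/negP: Jb0; apply: centr_sub_of_square mb0 => b mb.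
  by apply: contrapT => h; apply: no; exists b.
have [q [w hw]] := max_generators (centr_complete_local char0 hA hz).
have hs := full_gens_span T hw.
have hsJ := quot_span hA mJmax hs.
have mpb : pi (val b) \in mJ by rewrite (quot_max_mem hA mJmax).
have [D [hD Db]] := regular_derivation char0 quot_complete quot_regular mpb b2.
have cJ : @adic_complete (poisson_quot J) mJ (poisson_quot J)^o by case: quot_complete.
have [a ha] := nondegenerate_derivation cJ (residue_ex quot_complete) hsJ
  quot_nondegenerate hD.
have [v hv] : exists v, {[val (w v), val b]} \notin m.
  apply: contrapT => no; case/negP: Db; rewrite ha; apply: rpred_sum => u _.
  apply: idealMr; rewrite /= -quot_pi_poisson (quot_max_mem hA mJmax).
  case: u => [v|i].
    by apply/negPn/negP => hv; apply: no; exists v.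
  by rewrite poissonC centrP oppr0 rpred0.
by exists (w v), b; split=> //; apply/hw/span_gen.
Qed.

Lemma symplectic_step : (exists2 b : B, b \in mB & val b \notin J) ->
  exists (I' : finType) (z' : I' -> A) (c' : I' -> k) (dual' : I' -> I'),
    symplectic m z' c' dual' /\ (#|I| < #|I'|)%N.
Proof.
move=> /centr_pair[f [g [mf mg /(complete_unit hA)[v hv]]]].
have hadic : @adic_complete A m A^o by case: hA.
have [x [mx xg xc]] := poisson_straighten char0 hadic (mf : val f \in m) hv.
have zg i : {[val g, z i]} = 0 by exact: centrP.
have zx i : {[z i, x]} = 0.
  by apply: xc; rewrite poissonC centrP oppr0.
(* The new pair is x = z' (inl true) and g = z' (inl false), with {x, g} = 1; x commutes with the
   old coordinates because they commute with f and g. *)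
pose z' (u : bool + I) : A :=
  match u with inl true => x | inl false => val g | inr i => z i end.
pose c' (u : bool + I) : k := match u with inl true => 1 | inl false => -1 | inr i => c i end.
pose dual' (u : bool + I) : bool + I :=
  match u with inl e => inl (~~ e) | inr i => inr (dual i) end.
exists (bool + I)%type, z', c', dual'; split; last first.
  by rewrite card_sum card_bool -[X in (X < _)%N]add0n ltn_add2r.
split.
- by case=> [[]|i] //; exact: sy_mem hz i.
- by case=> [[]|i] //=; rewrite (sy_dual hz).
- by case=> [[]|i] /=; rewrite ?oner_eq0 ?oppr_eq0 ?oner_eq0 ?(sy_c hz).
have xz i : {[x, z i]} = 0 by rewrite poissonC zx oppr0.
have gx : {[val g, x]} = -1 by rewrite poissonC xg.
have zg' i : {[z i, val g]} = 0 by rewrite poissonC zg oppr0.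
case=> [[]|i] [[]|l] /=; rewrite ?xg ?poisson_self ?gx ?zg ?zg' ?xz ?zx ?scaler0 ?scale1r //.
- by rewrite scaleN1r opprK.
exact: sy_z hz i l.
Qed.

End Step.

Lemma symplectic_exists :
  exists (I : finType) (z : I -> A) (c : I -> k) (dual : I -> I),
    symplectic m z c dual /\
    forall b : centr z, b \in centr_ideal z m -> val b \in J.
Proof.
have [q [s hs]] := max_generators hA.
pose X d := exists (I : finType) (z : I -> A) (c : I -> k) (dual : I -> I),
  symplectic m z c dual /\ #|I| = d.
have X0 : X 0%N.
  exists void, (of_void A), (of_void k), id.
  by split; [split; case|exact: card_void].
have Xb d : X d -> (d <= q)%N by move=> [I [z [c [dual [hz <-]]]]]; apply: symplectic_bound hz _ _ hs.
have exX : exists d, `[< X d >] by exists 0%N; apply/asboolP.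
have [|d /asboolP[I [z [c [dual [hz cI]]]]] dmax] := ex_maxnP exX (m := q).
  by move=> d /asboolP; apply: Xb.
exists I, z, c, dual; split=> // b mb; apply/negPn/negP => Jb.
have [|I' [z' [c' [dual' [hz' lt_I]]]]] := @symplectic_step I z c dual hz.
  by exists b.
have : (#|I'| <= d)%N by apply: dmax; apply/asboolP; exists I', z', c', dual'.
by rewrite -cI leqNgt lt_I.
Qed.

End Symplectic.

(** * The Poisson section of A onto A/J *)

Section ConstantCoefficientSeries.
Variables (k : fieldType) (char0 : [pchar k] =i pred0).
Variables (A : poissonAlgType k) (m : idealr A).
Hypothesis hA : complete_local m.
Variables (I : finType) (z : I -> A) (c : I -> k) (dual : I -> I).
Hypothesis hz : symplectic m z c dual.
Variables (J : poissonIdeal A) (mJ : idealr (poisson_quot J)).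
Hypothesis mJmax : maximal_ideal mJ.
Local Notation B := (centr z).
Local Notation mB := (centr_ideal z m).
Local Notation T := (splitting_taylor char0 hA hz).
Local Notation p := (splitting char0 hA hz).
Local Notation D := (partial z c dual).
Local Notation pi := (quot_pi J).
Hypothesis hB : forall b : B, b \in mB -> val b \in J.

Let hadic : @adic_complete A m A^o. Proof. by case: hA. Qed.

Local Notation t := (fun i : 'I_#|I| => z (enum_val i)).
Local Notation ev := (@peval k A #|I| t).

(* Limits of polynomials in z with coefficients in k; the quotient map to A/J
   restricts to a bijection on them. *)
Definition zseries (a : A) : Prop := forall l, exists q, ipow m l (a - ev q).

Lemma zseries_ev q : zseries (ev q).
Proof. by move=> l; exists q; rewrite subrr; apply: ipow_zero. Qed.

Lemma zseriesD a b : zseries a -> zseries b -> zseries (a + b).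
Proof.
move=> ha hb l; have [q hq] := ha l; have [r hr] := hb l; exists (q + r).
by rewrite pevalD opprD addrACA; apply: ipowD.
Qed.

Lemma zseriesM a b : zseries a -> zseries b -> zseries (a * b).
Proof.
move=> ha hb l; have [q hq] := ha l; have [r hr] := hb l; exists (q * r).
have -> : a * b - ev (q * r) = b * (a - ev q) + ev q * (b - ev r).
  by rewrite pevalM; ring.
by apply: ipowD; apply: ipowM.
Qed.

Lemma zseriesC e : zseries e%:A.
Proof. by rewrite -(pevalC t); apply: zseries_ev. Qed.

Lemma zseriesB a b : zseries a -> zseries b -> zseries (a - b).
Proof.
move=> ha hb; rewrite -mulN1r; apply: zseriesD => //; apply: zseriesM => //.
by rewrite -scaleN1r; apply: zseriesC.
Qed.

Lemma zseries_z i : zseries (z i).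
Proof.
have := zseries_ev 'X_(enum_rank i); rewrite pevalU enum_rankK; exact.
Qed.

Lemma zseries_closed a : (forall l, exists2 b, zseries b & ipow m l (a - b)) -> zseries a.
Proof.
move=> h l; have [b hb ab] := h l; have [q hq] := hb l; exists q.
exact: ipow_trans ab hq.
Qed.

Lemma zseries_der (E : A -> A) : der E -> (forall i, zseries (E (z i))) ->
  forall a, zseries a -> zseries (E a).
Proof.
move=> hE Ez a ha; apply: zseries_closed => l; have [q hq] := ha l.+1.
exists (E (ev q)); last by rewrite -(derB hE); apply: der_ipow.
elim/mpoly_alg_ind: q {hq} => [e|q r hq hr|q r hq hr|i].
- by rewrite pevalC (derC hE) -(scale0r 1); apply: zseriesC.
- by rewrite pevalD (derD hE); apply: zseriesD.
- rewrite pevalM (derM hE); apply: zseriesD; apply: zseriesM => //; exact: zseries_ev.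
by rewrite pevalU.
Qed.

Lemma zseries_poisson a b : zseries a -> zseries b -> zseries {[a, b]}.
Proof.
move=> ha hb; apply: (zseries_der (poisson_der a)) => // i.
apply: (zseries_der (poisson_derl (z i))) => // l.
have [e ->] := bracket_zz hz l i; exact: zseriesC.
Qed.

Lemma zseries_partial i a : zseries a -> zseries (D i a).
Proof.
move=> ha; apply: zseries_der => //; first exact: partial_der.
by move=> l; rewrite (partial_z hz) -scaler_nat; apply: zseriesC.
Qed.

Lemma zseries_const a : zseries a -> exists e : k, p a = e%:A.
Proof.
move=> ha.
have hev q : exists e : k, p (ev q) = e%:A.
  elim/mpoly_alg_ind: q => [e|q r [e he] [e' he']|q r [e he] [e' he']|i].
  - by exists e; rewrite pevalC (amC (tl_p T)).
  - by exists (e + e'); rewrite pevalD (amD (tl_p T)) he he' scalerDl.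
  - exists (e * e'); rewrite pevalM (amM (tl_p T)) he he'.
    by rewrite mulr_algl scalerA.
  by exists 0; rewrite pevalU (tl_pz T) scale0r.
have he l : exists e : k, ipow mB l (p a - e%:A).
  have [q hq] := ha l; have [e qe] := hev q; exists e.
  by rewrite -qe -(amB (tl_p T)); apply: (am_ipow (tl_p T) (tl_pm T)).
have [e1 h1] := he 1%N; exists e1.
have [_ _ _ cB] := centr_complete_local char0 hA hz.
apply: (adic_separatedB cB) => -[|l] //.
have [e hel] := he l.+1.
have -> : e1 = e; last by [].
apply/eqP; rewrite -subr_eq0; apply/eqP; apply: (scalar_mem (m := mB)).
rewrite scalerBl -(subrK (p a) e1%:A) -addrA; apply: rpredD.
  by rewrite -rpredN opprB; apply: ipow1_ideal.
by apply: ipow1_ideal; apply: ipow_le hel.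
Qed.

(** The constant term of a series in J is a scalar lying in J, hence 0, and the partial derivatives
    are again series in J. *)
Lemma zseries_ideal0 a : zseries a -> a \in J -> a = 0.
Proof.
move=> ha Ja; apply: (taylor_zero char0 T (Q := fun a => zseries a /\ a \in J)) => //.
- move=> b [hb Jb]; have [e pe] := zseries_const hb.
  have := splitting_ideal char0 hA hz mJmax Jb; rewrite pe => /(ideal_sub_max hA).
  by move/scalar_mem => ->; rewrite scale0r.
move=> i b [hb Jb]; exists (D i b), 0; rewrite addr0; split=> //.
  by split; [exact: zseries_partial|apply: idealrZ; apply: poisson_idealr].
by split; [rewrite -(scale0r 1); exact: zseriesC|exact: rpred0].
Qed.

Lemma const_mod_ideal a : exists e : k, exists2 y, y \in J & a - e%:A - y \in span z.
Proof.
have [e he] := residue_ex (centr_complete_local char0 hA hz) (p a).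
exists e, (val (p a - e%:A)); first exact: hB.
have -> : a - e%:A - val (p a - e%:A) = a - val (p a); last exact: (tl_dec T a).
by rewrite (amB (tl_j T)) (amC (tl_j T)); ring.
Qed.

(** Since mB lies in J, A = k + J + (z). Applying this repeatedly to the coefficients of the z_i
    approximates a by polynomials modulo J, and J is closed. *)
Lemma zseries_lift a : exists2 b, zseries b & a - b \in J.
Proof.
have zm := span_z_max T.
have red l r : ipow (span z) l r -> exists q, ipow (span z) l (ev q) /\
    exists2 y, y \in J & ipow (span z) l.+1 (r - ev q - y).
  elim: l r => [|l IH] r.
    have [e [y Jy hy]] := const_mod_ideal r; exists e%:MP; split=> //.
    by exists y => //; rewrite pevalC; apply: ipow1_mem.
  move=> /ipow_span_coef[d -> hd].
  have [q hq] := fun_choice (fun i => IH _ (hd i)).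
  have [y hy] := fun_choice (P := fun i y => y \in J /\ ipow (span z) l.+1
      (d i - ev (q i) - y))
    (fun i => let: conj _ (ex_intro2 y Jy hy) := hq i in ex_intro _ y (conj Jy hy)).
  have evE : ev (\sum_i 'X_(enum_rank i) * q i) = \sum_i z i * ev (q i).
    rewrite peval_sum; apply: eq_bigr => i _.
    by rewrite pevalM pevalU enum_rankK.
  exists (\sum_i 'X_(enum_rank i) * q i); rewrite evE; split.
    apply: ipow_sum => i _; apply: ipow_mem; [exact: span_gen|exact: (hq i).1].
  exists (\sum_i z i * y i).
    by apply: rpred_sum => i _; apply: idealMr; exact: (hy i).1.
  rewrite -!sumrB; apply: ipow_sum => i _.
  rewrite (mulrC (d i)) -!mulrBr; apply: ipow_mem; first exact: span_gen.
  exact: (hy i).2.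
pose ok l q := exists2 y, y \in J & ipow (span z) l (a - ev q - y).
have [||q [_ qok qS]] := @dependent_choice _ ok
  (fun l q q' => ipow m l (ev q' - ev q)) 0.
- by exists 0; rewrite ?rpred0.
- move=> l q [y Jy /red[q' [hq' [y' Jy' h]]]]; exists (q + q'); split.
    exists (y + y'); first exact: rpredD.
    have -> : a - ev (q + q') - (y + y') = a - ev q - y - ev q' - y'.
      by rewrite pevalD; ring.
    exact: h.
  by rewrite pevalD addrAC subrr add0r; exact: (ipow_mono zm).
have [b hb] := adic_limit hadic qS; exists b; first by move=> l; exists (q l).
apply: (krull_intersection hA) => l; have [y Jy h] := qok l; exists y => //.
have -> : a - b - y = (a - ev (q l) - y) - (b - ev (q l)) by ring.
by apply: ipowB => //; exact: (ipow_mono zm).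
Qed.

Lemma zsection_ex (x : poisson_quot J) : exists b, zseries b /\ pi b = x.
Proof.
have [b hb Jb] := zseries_lift (quot_repr x); exists b; split=> //.
by rewrite -[RHS]quot_reprK; apply/esym/quot_pi_eq.
Qed.

Definition zsection (x : poisson_quot J) : A := projT1 (cid (zsection_ex x)).
Lemma zsection_zseries x : zseries (zsection x).
Proof. exact: (projT2 (cid (zsection_ex x))).1. Qed.
Lemma zsectionK x : pi (zsection x) = x.
Proof. exact: (projT2 (cid (zsection_ex x))).2. Qed.

Lemma zsection_eq a x : zseries a -> pi a = x -> zsection x = a.
Proof.
move=> ha ax; apply/eqP; rewrite -subr_eq0; apply/eqP; apply: zseries_ideal0.
  by apply: zseriesB => //; apply: zsection_zseries.
by apply/quot_pi_mem0; rewrite quot_piB zsectionK ax subrr.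
Qed.

Lemma zsection_alg : alg_morph zsection.
Proof.
split=> [x y|x y|e]; apply: zsection_eq.
- by apply: zseriesD; apply: zsection_zseries.
- by rewrite quot_piD !zsectionK.
- by apply: zseriesM; apply: zsection_zseries.
- by rewrite quot_piM !zsectionK.
- exact: zseriesC.
exact: quot_pi_alg.
Qed.

Lemma zsection_poisson x y : zsection {[x, y]} = {[zsection x, zsection y]}.
Proof.
apply: zsection_eq; first by apply: zseries_poisson; apply: zsection_zseries.
by rewrite quot_pi_poisson !zsectionK.
Qed.

Lemma centr_zseries (b : B) a : zseries a -> {[val b, a]} = 0.
Proof.
move=> ha; apply: (adic_separated hadic) => l; have [q hq] := ha l.+1.
have hE := poisson_der (val b).
have evb : {[val b, ev q]} = 0.
  elim/mpoly_alg_ind: q {hq} => [e|q r hq hr|q r hq hr|i].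
  - by rewrite pevalC (derC hE).
  - by rewrite pevalD poissonDr hq hr addr0.
  - by rewrite pevalM poissonMr hq hr !mul0r addr0.
  by rewrite pevalU centrP.
by rewrite -[{[val b, a]}]subr0 -evb -poissonBr; apply: (der_ipow hE).
Qed.

Lemma zsection_coordinates : coordinates m mJ z D (pi \o z)
  (fun i x => c i *: {[x, pi (z (dual i))]}) zsection.
Proof.
have DC i x : c i *: {[pi x, pi (z (dual i))]} = pi (D i x).
  by rewrite -quot_pi_poisson -quot_piZ.
split=> /=.
- by move=> i; rewrite (quot_max_mem hA mJmax); exact: sy_mem hz i.
- move=> i; have h := der_mull (c i)%:A (poisson_derl (pi (z (dual i)))).
  have -> : (fun x => c i *: {[x, pi (z (dual i))]}) =
      fun x => (c i)%:A * {[x, pi (z (dual i))]}; last exact: h.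
    by apply/funext => x; rewrite mulr_algl.
- move=> i l; rewrite DC (partial_z hz).
  by case: eqP => _; [exact: quot_pi1|exact: quot_pi0].
- elim/quot_ind => a; have [e [y Jy /spanP[d hd]]] := const_mod_ideal a.
  exists e; apply/spanP; exists (pi \o d).
  have -> : pi a - e%:A = pi (a - e%:A - y).
    by rewrite !quot_piB quot_pi_alg (quot_pi_mem0 J y).2 // subr0.
  rewrite hd.
  by rewrite quot_pi_sum; apply: eq_bigr => i _; rewrite quot_piM.
- exact: zsection_alg.
- by move=> x; rewrite -{1}(zsectionK x) (quot_max_mem hA mJmax).
- by move=> i; apply: zsection_eq => //; apply: zseries_z.
move=> i x; apply/esym; apply: zsection_eq.
  by apply: zseries_partial; apply: zsection_zseries.
by rewrite -DC zsectionK.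
Qed.

End ConstantCoefficientSeries.

(** * Prime Poisson ideals and holonomicity *)

Lemma mk_primePoissonIdeal (k : fieldType) (A : poissonAlgType k) (S : {pred A}) :
  idealr_closed S -> prime_idealr_closed S ->
  (forall u, u \in S -> forall a, {[u, a]} \in S) ->
  exists P : primePoissonIdeal A, forall a, (a \in P) = (a \in S).
Proof.
move=> hS hp hb.
pose P : primePoissonIdeal A := HB.pack_for (primePoissonIdeal A) S
  (isIdealr.Build A S hS) (isPrimeIdealrClosed.Build A S hp) (isPoissonIdeal.Build k A S hb).
by exists P.
Qed.

Section DerivationCore.
Variables (k : fieldType) (char0 : [pchar k] =i pred0) (A : comAlgType k).

Definition prime_like (X : A -> Prop) : Prop :=
  ideal_like X /\ forall a b, X (a * b) -> X a \/ X b.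

Definition der_core (D : A -> A) (X : A -> Prop) (a : A) : Prop :=
  forall l, X (iter l D a).

Section OneDerivation.
Variables (D : A -> A) (X : A -> Prop).
Hypotheses (hD : der D) (hX : prime_like X).

Let X0 : X 0. Proof. by case: hX => -[]. Qed.
Let XD x y : X x -> X y -> X (x + y). Proof. by case: hX => -[_ h _] _; apply: h. Qed.
Let XM a x : X x -> X (a * x). Proof. by case: hX => -[_ _ h] _; apply: h. Qed.

Let iterD l a b : iter l D (a + b) = iter l D a + iter l D b.
Proof. by elim: l => //= l ->; rewrite (derD hD). Qed.

Lemma iter_der_mul l a x : (forall i, (i <= l)%N -> X (iter i D x)) -> X (iter l D (a * x)).
Proof.
elim: l a x => [|l IH] a x h; first by apply: XM; apply: (h 0%N).
rewrite iterSr (derM hD) iterD; apply: XD.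
  by apply: IH => i hi; rewrite -iterSr; apply: h.
by rewrite mulrC; apply: IH => i hi; apply: h; apply: leqW.
Qed.

(** In Leibniz's formula for D^(i+j) (a b) every term but D^i a D^j b has a factor in X. The
    coefficient [q.+1] is a binomial; only its being a positive integer matters. *)
Lemma iter_der_leading n i j a b : (i + j = n)%N ->
  (forall u, (u < i)%N -> X (iter u D a)) -> (forall u, (u < j)%N -> X (iter u D b)) ->
  exists q, X (iter n D (a * b) - q.+1%:R * (iter i D a * iter j D b)).
Proof.
elim: n i j a b => [|n IH] i j a b.
  by move=> /eqP; rewrite addn_eq0 => /andP[/eqP -> /eqP ->] _ _; exists 0%N;
    rewrite mul1r subrr.
case: i j => [|i] [|j] //.
- move=> [e] _ hb; have [|//|u hu|q hq] := IH 0%N j a (D b).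
  + by rewrite add0n.
  + by rewrite -iterSr; apply: hb.
  exists q; rewrite !iterSr (derM hD) iterD addrAC; apply: XD => //.
  by rewrite mulrC; apply: iter_der_mul => u hu; apply: hb; rewrite e ltnS.
- rewrite addn0 => -[e] ha _; have [|u hu|//|q hq] := IH i 0%N (D a) b.
  + by rewrite addn0.
  + by rewrite -iterSr; apply: ha.
  exists q; rewrite !iterSr (derM hD) iterD.
  set w := q.+1%:R * _ in hq *.
  have -> : iter n D (a * D b) + iter n D (b * D a) - w =
      (iter n D (D a * b) - w) + iter n D (D b * a).
    by rewrite (mulrC b) (mulrC (D b)); ring.
  by apply: XD => //; apply: iter_der_mul => u hu; apply: ha; rewrite e ltnS.
move=> [e] ha hb; have [||u hu|q hq] := IH i.+1 j a (D b).
- by rewrite addSnnS.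
- exact: ha.
- by rewrite -iterSr; apply: hb.
have [|u hu||q' hq'] := IH i j.+1 (D a) b.
- by [].
- by rewrite -iterSr; apply: ha.
- exact: hb.
exists (q + q').+1.
have -> : (q + q').+2%:R = q.+1%:R + q'.+1%:R :> A.
  by rewrite -natrD addSn addnS.
rewrite -iterSr in hq; rewrite -iterSr in hq'.
set w := iter i.+1 D a * iter j.+1 D b in hq hq' *.
have -> : iter n.+1 D (a * b) - (q.+1%:R + q'.+1%:R) * w =
    (iter n D (a * D b) - q.+1%:R * w) + (iter n D (D a * b) - q'.+1%:R * w).
  by rewrite iterSr (derM hD) iterD (mulrC b); ring.
exact: XD.
Qed.

(** If i and l are the first orders at which the derivatives of a and b leave X, the product of
    those two derivatives lies in X up to a positive integer, which is invertible in characteristic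
    0. *)
Lemma der_core_prime : prime_like (der_core D X).
Proof.
split; first split.
- move=> l; have -> : iter l D 0 = 0 by elim: l => //= l ->; rewrite (der0 hD).
  exact: X0.
- by move=> a b ha hb l; rewrite iterD; apply: XD.
- by move=> a x hx l; apply: iter_der_mul => i _; apply: hx.
move=> a b hab; apply: contrapT => hno.
have first_nonmem x : ~ der_core D X x ->
    exists i, ~ X (iter i D x) /\ forall u, (u < i)%N -> X (iter u D x).
  move=> hx; have exi : exists i, `[< ~ X (iter i D x) >].
    apply: contrapT => no; apply: hx => l; apply: contrapT => hl.
    by apply: no; exists l; apply/asboolP.
  have [i /asboolP hi imin] := ex_minnP exi; exists i; split=> // u ui.
  apply: contrapT => /asboolP/imin; by rewrite leqNgt ui.
have [|i [hi ilt]] := first_nonmem a; first by move=> h; apply: hno; left.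
have [|l [hl llt]] := first_nonmem b; first by move=> h; apply: hno; right.
have [q hq] := iter_der_leading erefl ilt llt.
have : X (q.+1%:R * (iter i D a * iter l D b)).
  rewrite -(subKr (iter (i + l) D (a * b)) (_ * _)); apply: XD => //.
  by rewrite -mulN1r; apply: XM.
move/(XM (q.+1%:R^-1 : k)%:A); set w := iter i D a * _.
rewrite mulr_algl mulr_natl -[w *+ _]scaler_nat scalerA mulVf ?natk_neq0 // scale1r.
by case: hX => _ h /h[].
Qed.

Lemma der_core_sub a : der_core D X a -> X a.
Proof. by move/(_ 0%N). Qed.

Lemma der_core_stable (Y : A -> Prop) : (forall a, Y a -> Y (D a)) ->
  (forall a, Y a -> X a) -> forall a, Y a -> der_core D X a.
Proof. by move=> YD YX a Ya l; apply: YX; elim: l => //= l; apply: YD. Qed.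

End OneDerivation.

Variables (I : finType) (D : I -> A -> A) (X : A -> Prop).
Hypotheses (hD : forall i, der (D i)) (hX : prime_like X).
Hypothesis DC : forall i l a, D i (D l a) = D l (D i a).

(* As the D i commute, this is the largest subset of X stable under all of them. *)
Definition ders_core : A -> Prop := foldr (fun i => der_core (D i)) X (enum I).

Lemma ders_core_prime : prime_like ders_core.
Proof. by rewrite /ders_core; elim: (enum I) => //= i s; apply: der_core_prime. Qed.

Lemma ders_core_sub a : ders_core a -> X a.
Proof. by rewrite /ders_core; elim: (enum I) a => //= i s IH a /der_core_sub/IH. Qed.

Lemma ders_core_stable (Y : A -> Prop) : (forall i a, Y a -> Y (D i a)) ->
  (forall a, Y a -> X a) -> forall a, Y a -> ders_core a.
Proof.
move=> YD YX; rewrite /ders_core; elim: (enum I) => //= i s IH.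
by apply: der_core_stable => // a; apply: YD.
Qed.

Lemma ders_core_der i a : ders_core a -> ders_core (D i a).
Proof.
have : i \in enum I by rewrite mem_enum.
rewrite /ders_core; elim: (enum I) a => //= l s IH a.
rewrite inE => /orP[/eqP -> h q|si h q]; first by rewrite -iterSr; apply: h.
have -> : iter q (D l) (D i a) = D i (iter q (D l) a).
  by elim: q => //= q ->; rewrite DC.
exact: IH.
Qed.

End DerivationCore.

Lemma poisson_leibnizr (k : fieldType) (A : poissonAlgType k) (a b y : A) :
  {[{[a, b]}, y]} = {[{[a, y]}, b]} + {[a, {[b, y]}]}.
Proof.
by rewrite poissonC poisson_leibniz opprD (poissonC y a) (poissonC y b)
  poissonNl poissonNr !opprK.
Qed.

Section GenericNondegeneracy.
Variables (k : fieldType) (A : poissonAlgType k) (m : idealr A).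
Hypothesis hA : complete_local m.
Variable P : poissonIdeal A.

Lemma generically_nondegenerateP (n : idealr (poisson_quot P)) (I : finType)
    (s : I -> poisson_quot P) : GRing.integral_domain_axiom (poisson_quot P) ->
  maximal_ideal n -> (forall x, x \in n <-> x \in span s) ->
  generically_nondegenerate n <-> hamiltonian_faithful s.
Proof.
move=> dQ nmax hs; have hc := quot_complete hA nmax; have hr := quot_residue hA nmax.
split=> [[d h]|h]; first exact/(generic_bivectorP hc hr hs d).
by exists dQ; apply/(generic_bivectorP hc hr hs dQ).
Qed.

End GenericNondegeneracy.

Section Holonomic.
Variables (k : fieldType) (char0 : [pchar k] =i pred0).
Variables (A C : poissonAlgType k) (m : idealr A) (mC : idealr C).
Hypothesis hA : complete_local m.
Variables (I : finType) (z : I -> A) (c : I -> k) (dual : I -> I).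
Hypothesis hz : symplectic m z c dual.
Local Notation B := (centr z).
Local Notation mB := (centr_ideal z m).
Local Notation T := (splitting_taylor char0 hA hz).
Local Notation p := (splitting char0 hA hz).
Local Notation D := (partial z c dual).
Let hB : complete_local mB := centr_complete_local char0 hA hz.
Variables (zC : I -> C) (DC : I -> C -> C) (s : C -> A).
Hypothesis S : coordinates m mC z D zC DC s.

Section Quotients.
Variables (P : poissonIdeal A) (Q : poissonIdeal B).
Hypothesis QP : forall b, b \in Q -> val b \in P.
Hypothesis PQ : forall a, a \in P -> p a \in Q.
Variables (n : idealr (poisson_quot P)) (n0 : idealr (poisson_quot Q)).
Hypotheses (nmax : maximal_ideal n) (n0max : maximal_ideal n0).

Definition quot_j (x : poisson_quot Q) : poisson_quot P := quot_pi P (val (quot_repr x)).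
Definition quot_p (x : poisson_quot P) : poisson_quot Q := quot_pi Q (p (quot_repr x)).
Definition quot_D i (x : poisson_quot P) : poisson_quot P :=
  c i *: {[x, quot_pi P (z (dual i))]}.

Lemma quot_jE b : quot_j (quot_pi Q b) = quot_pi P (val b).
Proof.
apply: quot_pi_eq; rewrite -(amB (tl_j T)); apply: QP; exact: quot_reprB.
Qed.

Lemma quot_pE a : quot_p (quot_pi P a) = quot_pi Q (p a).
Proof.
apply: quot_pi_eq; rewrite -(amB (tl_p T)); apply: PQ; exact: quot_reprB.
Qed.

Lemma quot_DE i a : quot_D i (quot_pi P a) = quot_pi P (D i a).
Proof. by rewrite /quot_D -quot_pi_poisson -quot_piZ. Qed.

Lemma quot_taylor : taylor n n0 (quot_pi P \o z) quot_D quot_j quot_p.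
Proof.
split.
- exact: (quot_complete hA nmax).
- by move=> i; rewrite (quot_max_mem hA nmax); exact: sy_mem hz i.
- move=> i; have h := der_mull (c i)%:A (poisson_derl (quot_pi P (z (dual i)))).
  have -> : quot_D i = fun x => (c i)%:A * {[x, quot_pi P (z (dual i))]}; last exact: h.
  by apply/funext => x; rewrite mulr_algl.
- move=> i l; rewrite quot_DE (partial_z hz).
  by case: eqP => _; [exact: quot_pi1|exact: quot_pi0].
- split; last by move=> e; rewrite -quot_pi_alg quot_jE (amC (tl_j T)) quot_pi_alg.
  + elim/quot_ind => a; elim/quot_ind => b.
    by rewrite -quot_piD !quot_jE (amD (tl_j T)) quot_piD.
  elim/quot_ind => a; elim/quot_ind => b.
  by rewrite -quot_piM !quot_jE (amM (tl_j T)) quot_piM.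
- split; last by move=> e; rewrite -quot_pi_alg quot_pE (amC (tl_p T)) quot_pi_alg.
  + elim/quot_ind => a; elim/quot_ind => b.
    by rewrite -quot_piD !quot_pE (amD (tl_p T)) quot_piD.
  elim/quot_ind => a; elim/quot_ind => b.
  by rewrite -quot_piM !quot_pE (amM (tl_p T)) quot_piM.
- elim/quot_ind => b; rewrite (quot_max_mem hB n0max) quot_jE (quot_max_mem hA nmax).
  exact: (tl_jm T).
- elim/quot_ind => a; rewrite (quot_max_mem hA nmax) quot_pE (quot_max_mem hB n0max).
  exact: (tl_pm T).
- by move=> i; elim/quot_ind => b; rewrite quot_jE quot_DE (tl_Dj T) quot_pi0.
- by elim/quot_ind => b; rewrite quot_jE quot_pE (tl_pj T).
- by move=> i; rewrite /= quot_pE (tl_pz T) quot_pi0.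
elim/quot_ind => a; rewrite quot_pE quot_jE -quot_piB.
have /spanP[e ->] := tl_dec T a; rewrite quot_pi_sum; apply: span_sum => i _.
by rewrite quot_piM; apply: spanM; exact: (span_gen (quot_pi P \o z) i).
Qed.

Lemma quot_hamiltonian :
  hamiltonian_coordinates (quot_pi P \o z) quot_D quot_j c dual.
Proof.
split=> //; [|exact: sy_c hz|exact: sy_dual hz].
elim/quot_ind => a; elim/quot_ind => b.
by rewrite -quot_pi_poisson !quot_jE -quot_pi_poisson.
Qed.

Lemma quot_coordinates :
  coordinates n mC (quot_pi P \o z) quot_D zC DC (quot_pi P \o s).
Proof.
split; [exact: co_mem S|exact: co_der S|exact: co_dual S|exact: co_dec S| | | |].
- split=> [x y|x y|e] /=.
  + by rewrite (amD (co_s S)) quot_piD.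
  + by rewrite (amM (co_s S)) quot_piM.
  by rewrite (amC (co_s S)) quot_pi_alg.
- by move=> x mx; rewrite /= (quot_max_mem hA nmax); apply: (co_sm S).
- by move=> i /=; rewrite (co_sz S).
by move=> i x /=; rewrite quot_DE (co_sD S).
Qed.

End Quotients.

Lemma generically_nondegenerate_iff (P : primePoissonIdeal A) (Q : primePoissonIdeal B)
    (n : idealr (poisson_quot P)) (n0 : idealr (poisson_quot Q)) :
  (forall b, b \in Q -> val b \in P) -> (forall a, a \in P -> p a \in Q) ->
  maximal_ideal n -> maximal_ideal n0 ->
  generically_nondegenerate n <-> generically_nondegenerate n0.
Proof.
move=> QP PQ nmax n0max.
have [q [w hw]] := max_generators hB.
have T' := quot_taylor QP PQ nmax n0max.
have hs0 := quot_span hB n0max hw.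
have hs := full_gens_span T' hs0.
have H' := quot_hamiltonian QP.
have S' := quot_coordinates nmax.
have A1 := generically_nondegenerateP hA (prime_quot_domain (P := P)) nmax hs.
have A0 := generically_nondegenerateP hB (prime_quot_domain (P := Q)) n0max hs0.
have down := faithful_down T' H' (w := quot_pi Q \o w) (taylor_extend char0 T' S').
have up := faithful_up char0 T' H' (w := quot_pi Q \o w).
split; first by move/A1/down/A0.
by move/A0/up/A1.
Qed.

(** Elements of B commute with z, so bracketing with one preserves the ideal (z), the kernel of
    p. *)
Lemma splitting_bracket a (b : B) : p {[a, val b]} = {[p a, b]}.
Proof.
have /spanP[f fE] := tl_dec T a.
rewrite -{1}(subrK (val (p a)) a) poissonDl (amD (tl_p T)) fE.
rewrite (der_sum (poisson_derl _)) (am_sum (tl_p T)) big1 ?add0r => [|i _].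
  by rewrite -[{[val (p a), val b]}]/(val {[p a, b]}) (tl_pj T).
rewrite poissonMl (poissonC (z i)) centrP oppr0 mul0r addr0 (amM (tl_p T)).
by rewrite (tl_pz T) mulr0.
Qed.

Lemma core_prime (Q : primePoissonIdeal B) : exists P : primePoissonIdeal A,
  (forall b, b \in Q -> val b \in P) /\ (forall a, a \in P -> p a \in Q).
Proof.
pose X a := p a \in Q.
have hX : prime_like X.
  split; first split; rewrite /X.
  - by rewrite (am0 (tl_p T)) rpred0.
  - by move=> x y hx hy; rewrite (amD (tl_p T)) rpredD.
  - by move=> a x hx; rewrite (amM (tl_p T)) idealMr.
  by move=> a b; rewrite (amM (tl_p T)) prime_idealrM => /orP.
have hD := partial_der z c dual.
have DCo := partialC hz.
pose P : {pred A} := fun a => `[< ders_core D X a >].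
have PX a : a \in P -> p a \in Q by move=> /asboolP/ders_core_sub.
have [[core0 coreD coreM] core_pr] := ders_core_prime char0 hD hX.
have hP : idealr_closed P.
  split; first exact/asboolP.
    by apply/negP => /PX; rewrite (am1 (tl_p T)) idealr1.
  move=> a x y /asboolP hx /asboolP hy; apply/asboolP.
  by apply: coreD => //; apply: coreM.
have Ppr : prime_idealr_closed P.
  by move=> a b /asboolP/core_pr[h|h]; apply/orP; [left|right]; apply/asboolP.
have pbr a x : a \in P -> p {[a, x]} \in Q.
  move=> Pa; rewrite -(subrK (val (p x)) x) poissonDr (amD (tl_p T)).
  have /spanP[e ->] := tl_dec T x; apply: rpredD.
    rewrite (der_sum (poisson_der a)) (am_sum (tl_p T)); apply: rpred_sum => i _.
    rewrite poissonMr (amD (tl_p T)) !(amM (tl_p T)) (tl_pz T) mulr0 add0r.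
    rewrite mulrC; apply: idealMr; rewrite (bracket_coord hz) (amZ (tl_p T)).
    by apply: idealrZ; apply: PX; apply/asboolP/ders_core_der => //; apply/asboolP.
  by rewrite splitting_bracket; apply: poisson_idealr; apply: PX.
have Pbr u : u \in P -> forall a, {[u, a]} \in P.
  (* Only [pbr], a statement about constant terms, is known so far. The sums of brackets of P with A
     form a set stable under every D_i, by Jacobi, and contained in X, hence contained in the
     core. *)
  pose Y y := exists r : seq (A * A), (forall w, w \in r -> w.1 \in P) /\
    y = \sum_(w <- r) {[w.1, w.2]}.
  move=> Pu a; apply/asboolP; apply: (ders_core_stable (Y := Y)); last first.
  - exists [:: (u, a)]; rewrite big_seq1; split=> // w.
    by rewrite inE => /eqP ->.
  - move=> _ [r [hr ->]]; rewrite /X (am_sum (tl_p T)) big_seq.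
    by apply: rpred_sum => w /hr; apply: pbr.
  move=> i _ [r [hr ->]].
  exists ([seq (D i w.1, w.2) | w <- r] ++ [seq (w.1, D i w.2) | w <- r]); split.
    move=> w; rewrite mem_cat => /orP[|] /mapP[v /hr Pv ->] //=.
    by apply/asboolP/ders_core_der => //; apply/asboolP.
  rewrite (der_sum (hD i)) big_cat /= !big_map -big_split /=; apply: eq_bigr => w _ /=.
  rewrite /partial poissonZl poissonZr -scalerDr; congr (_ *: _).
  exact: poisson_leibnizr.
have [P' P'E] := mk_primePoissonIdeal hP Ppr Pbr.
exists P'; split=> [b Qb|a]; rewrite P'E; last exact: PX.
apply/asboolP; apply: (ders_core_stable (Y := fun y => exists2 b : B, b \in Q & y = val b)).
- by move=> i _ [b' Qb' ->]; exists 0; rewrite ?rpred0 // (tl_Dj T).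
- by move=> _ [b' Qb' ->]; rewrite /X (tl_pj T).
by exists b.
Qed.

Lemma restrict_prime (P : primePoissonIdeal A) (n : idealr (poisson_quot P)) :
  maximal_ideal n -> exists Q : primePoissonIdeal B,
  (forall b, b \in Q -> val b \in P) /\ (forall a, a \in P -> p a \in Q).
Proof.
move=> nmax; pose Q : {pred B} := fun b => val b \in P.
have QE b : (b \in Q) = (val b \in P) by [].
have hQ : idealr_closed Q.
  split; rewrite ?QE; first exact: (rpred0 P).
    by rewrite (am1 (tl_j T)) idealr1.
  move=> a x y; rewrite !QE => hx hy.
  by rewrite (amD (tl_j T)) (amM (tl_j T)) rpredD ?idealMr.
have Qpr : prime_idealr_closed Q.
  by move=> a b; rewrite !QE (amM (tl_j T)) prime_idealrM.
have Qbr u : u \in Q -> forall a, {[u, a]} \in Q.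
  by rewrite QE => hu a; rewrite QE; apply: poisson_idealr.
have [Q' Q'E] := mk_primePoissonIdeal hQ Qpr Qbr.
exists Q'; split=> [b|a Pa]; rewrite Q'E //.
exact: (splitting_ideal char0 hA hz nmax).
Qed.

(** If B is a domain, its zero ideal has a prime core in A, whose elements and their derivatives
    have zero constant term; so the core is zero. *)
Lemma domain_iff : GRing.integral_domain_axiom A <-> GRing.integral_domain_axiom B.
Proof.
split=> [dA x y xy|dB].
  have := dA (val x) (val y); rewrite -(amM (tl_j T)) xy => /(_ erefl).
  by rewrite -(am0 (tl_j T)) !(inj_eq val_inj).
have [Q0 Q0E] : exists Q : primePoissonIdeal B, forall b, (b \in Q) = (b \in pred1 0).
  apply: mk_primePoissonIdeal.
  - split; rewrite ?inE ?oner_eq0 // => a x y; rewrite !inE => /eqP -> /eqP ->.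
    by rewrite mulr0 addr0.
  - by move=> u v; rewrite !inE => /eqP/dB.
  by move=> u; rewrite !inE => /eqP -> a; rewrite poisson0l inE eqxx.
have [P [_ PQ]] := core_prime Q0.
have P0 a : a \in P -> a = 0.
  apply: (taylor_zero char0 T (Q := fun a => a \in P)) => [b /PQ|i b Pb].
    by rewrite Q0E => /eqP.
  exists (D i b), 0; rewrite addr0 rpred0; split=> //.
  by apply: idealrZ; apply: poisson_idealr.
move=> x y xy; have : x * y \in P by rewrite xy rpred0.
rewrite prime_idealrM => /orP[/P0 ->|/P0 ->]; apply/orP; [left|right]; exact: eqxx.
Qed.

Lemma holonomic_iff : holonomic A <-> holonomic B.
Proof.
have nA : noetherian A by case: hA.
have nB : noetherian B by case: hB.
split=> [[_ dA hol]|[_ dB hol]]; split=> //; try exact/domain_iff.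
  move=> Q n0 n0max; have [P [QP PQ]] := core_prime Q.
  have [n nmax] := quot_max_ex hA P.
  exact/(generically_nondegenerate_iff QP PQ nmax n0max)/hol.
move=> P n nmax; have [Q [QP PQ]] := restrict_prime nmax.
have [n0 n0max] := quot_max_ex hB Q.
exact/(generically_nondegenerate_iff QP PQ nmax n0max)/hol.
Qed.

End Holonomic.

(** * The isomorphism and exactness *)

Section CompletionIsomorphism.
Variables (k : fieldType) (A S : poissonAlgType k) (m : idealr A) (I : idealr S).
Hypothesis hA : @adic_complete A m A^o.
Variable f : S -> A.
Hypothesis hf : alg_morph f.
Hypothesis fP : {morph f : x y / {[x, y]}}.
Hypothesis fI : forall x, x \in I -> f x \in m.
Hypothesis f_inv : forall l x, ipow m l (f x) -> ipow I l x.
Hypothesis f_dense : forall a l, exists x, ipow m l (a - f x).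

Local Notation pi := (quot_pi (PoissonIdeal.clone k (cauchy_seq I) (@null_seq k S I) _)).

(** The graph of the isomorphism, between a and the sequences in S whose image converges to a. *)
Let limit_of (a : A) (w : cauchy_seq I) : Prop :=
  forall n, exists N, forall i, (N <= i)%N -> ipow m n (a - f (val w i)).

Let limit_ex a : exists w, limit_of a w.
Proof.
have [u hu] := fun_choice (f_dense a).
have cu : acauchy I u.
  apply/asboolP => n; exists n => i j ni nj; apply: f_inv; rewrite (amB hf).
  apply: (@ipow_trans _ _ _ a); last exact: (ipow_le nj).
  by apply/ipow_sym/(ipow_le ni).
exists (Sub u cu) => n; exists n => i ni; exact: (ipow_le ni).
Qed.

Let limit_surj w : exists a, limit_of a w.
Proof.
have /asboolP cw := valP w.
have [|a ha] := hA.1 (fun i => f (val w i)).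
  move=> n; have [N hN] := cw n; exists N => i j Ni Nj.
  by rewrite -(amB hf); apply: (am_ipow hf fI); apply: hN.
exists a => n; have [N hN] := ha n; exists N => i Ni; exact/ipow_sym/hN.
Qed.

(** The loss of one power in the hypothesis on [op] is what the bracket needs. *)
Let limit2 (op : A -> A -> A) (opS : S -> S -> S) (opC : cauchy_seq I -> cauchy_seq I -> cauchy_seq I) :
  (forall w v i, val (opC w v) i = opS (val w i) (val v i)) ->
  {morph f : x y / opS x y >-> op x y} ->
  (forall n a b x y, ipow m n.+1 (a - x) -> ipow m n.+1 (b - y) -> ipow m n (op a b - op x y)) ->
  forall a b w v, limit_of a w -> limit_of b v -> limit_of (op a b) (opC w v).
Proof.
move=> opCE fop hop a b w v ha hb n; have [N hN] := ha n.+1; have [M hM] := hb n.+1.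
exists (maxn N M) => i; rewrite geq_max => /andP[Ni Mi].
by rewrite opCE fop; apply: hop; [exact: hN|exact: hM].
Qed.

Let limitB a b w v : limit_of a w -> limit_of b v -> limit_of (a - b) (w - v).
Proof.
apply: (limit2 (op := fun x y => x - y) (opS := fun x y => x - y)
  (opC := fun x y => x - y)) => // [|n x y x' y' hx hy]; first exact: amB hf.
have -> : x - y - (x' - y') = (x - x') - (y - y') by ring.
by apply: ipowS; apply: ipowB.
Qed.

Let limitM a b w v : limit_of a w -> limit_of b v -> limit_of (a * b) (w * v).
Proof.
apply: (limit2 (op := *%R) (opS := *%R) (opC := *%R)) => // [|n x y x' y' hx hy].
  exact: amM hf.
have -> : x * y - x' * y' = y * (x - x') + x' * (y - y') by ring.
by apply: ipowS; apply: ipowD; apply: ipowM.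
Qed.

Let limit_poisson a b w v :
  limit_of a w -> limit_of b v -> limit_of {[a, b]} {[w, v]}.
Proof.
apply: (limit2 (op := poisson) (opS := poisson) (opC := poisson)) => // n x y x' y' hx hy.
have -> : {[x, y]} - {[x', y']} = {[x - x', y]} + {[x', y - y']}.
  by rewrite poissonBl poissonBr addrA subrK.
apply: ipowD; first exact: (der_ipow (poisson_derl y)).
exact: (der_ipow (poisson_der x')).
Qed.

Let limit_cst x : limit_of (f x) (cauchy_cst_seq I x).
Proof. by move=> n; exists 0%N => i _; rewrite subrr; apply: ipow_zero. Qed.

Let limit_null a w : limit_of a w -> a = 0 <-> pi w = 0.
Proof.
move=> haw; split=> [a0|/quot_pi_mem0/asboolP w0].
  apply/quot_pi_mem0/asboolP => n; have [N hN] := haw n; exists N => i Ni.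
  have := hN i Ni; rewrite a0 sub0r -(amN hf) => /f_inv h.
  by rewrite -[val w i - 0]/(val w i + - 0) oppr0 addr0 -[val w i]opprK; apply: ipowN.
apply: (adic_separated hA) => n; have [N hN] := haw n; have [M hM] := w0 n.
have h1 := hN _ (leq_maxl N M); have h2 := hM _ (leq_maxr N M).
apply: (ipow_subr h1); apply: (am_ipow hf fI).
by have : ipow I n (val w (maxn N M) - 0) by []; rewrite subr0.
Qed.

Let limit_eq a b w v : limit_of a w -> limit_of b v -> a = b <-> pi w = pi v.
Proof.
move=> ha hb; have [h1 h2] := limit_null (limitB ha hb); split=> [ab|wv].
  by apply/eqP; rewrite -subr_eq0 -quot_piB; apply/eqP/h1; rewrite ab subrr.
by apply/eqP; rewrite -subr_eq0; apply/eqP/h2; rewrite quot_piB wv subrr.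
Qed.

Lemma completion_isomorphism : exists g : {lrmorphism A -> completion I},
  bijective g /\ (forall a b, g {[a, b]} = {[g a, g b]}).
Proof.
have [W hW] := fun_choice limit_ex.
pose g a : completion I := pi (W a).
have gE a w : limit_of a w -> g a = pi w by move=> h; apply/(limit_eq (hW a) h).
have gB a b : g (a - b) = g a - g b.
  by rewrite (gE _ _ (limitB (hW a) (hW b))); exact: quot_piB.
have gM a b : g (a * b) = g a * g b.
  by rewrite (gE _ _ (limitM (hW a) (hW b))); exact: quot_piM.
have gC e : g e%:A = e%:A.
  rewrite -(amC hf) (gE _ _ (limit_cst _)).
  have -> : cauchy_cst_seq I e%:A = e%:A by exact: cauchy_seqP.
  exact: quot_pi_alg.
have g1 : g 1 = 1 by have := gC 1; rewrite !scale1r.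
have gZ e a : g (e *: a) = e *: g a by rewrite -mulr_algl gM gC mulr_algl.
have gP a b : g {[a, b]} = {[g a, g b]}.
  by rewrite (gE _ _ (limit_poisson (hW a) (hW b))); exact: quot_pi_poisson.
pose G : {lrmorphism A -> completion I} := HB.pack_for {lrmorphism A -> completion I} g
  (GRing.isZmodMorphism.Build A (completion I) g gB)
  (GRing.isMonoidMorphism.Build A (completion I) g (conj g1 gM))
  (GRing.isScalable.Build k A (completion I) *:%R g gZ).
exists G; split=> //.
have [h hh] := @fun_choice (completion I) A (fun x a => g a = x) (fun x => 
  let w := quot_repr x in let: ex_intro a ha := limit_surj w in
  ex_intro _ a (etrans (gE a w ha) (quot_reprK x))).
exists h; last exact: hh.
by move=> a; apply/(limit_eq (hW _) (hW _)); exact: hh (g a).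
Qed.

End CompletionIsomorphism.

(** * Liouville derivations of A and of B *)

Section Exact.
Variables (k : fieldType) (char0 : [pchar k] =i pred0).
Variables (A C : poissonAlgType k) (m : idealr A) (mC : idealr C).
Hypothesis hA : complete_local m.
Variables (I : finType) (z : I -> A) (c : I -> k) (dual : I -> I).
Hypothesis hz : symplectic m z c dual.
Local Notation B := (centr z).
Local Notation T := (splitting_taylor char0 hA hz).
Local Notation p := (splitting char0 hA hz).
Local Notation D := (partial z c dual).
Variables (zC : I -> C) (DC : I -> C -> C) (s : C -> A).
Hypothesis S : coordinates m mC z D zC DC s.

(* The restriction of a Liouville derivation to B, followed by the projection
   onto B, is one; conversely a Liouville derivation of B, extended by zero on z,
   becomes one after subtracting half of the Euler derivation. *)
Lemma exact_iff : exact_poisson A <-> exact_poisson B.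
Proof.
have pD := amD (tl_p T); have pM := amM (tl_p T); have pj := tl_pj T.
split=> [[xi [xiL xiM xiP]]|[xi [xiL xiM xiP]]].
  exists (fun b => p (xi (val b))); split.
  - move=> e a b; rewrite -[val (e *: a + b)]/(e *: val a + val b) xiL.
    by rewrite pD (amZ (tl_p T)).
  - by move=> a b; rewrite (amM (tl_j T)) xiM pD !pM !pj.
  move=> a b; rewrite -[val {[a, b]}]/{[val a, val b]} xiP !pD.
  rewrite -[{[val a, val b]}]/(val {[a, b]}) pj splitting_bracket.
  by rewrite (poissonC (val a)) (amN (tl_p T)) splitting_bracket -poissonC.
have xi_der : der xi.
  have x1 : xi 1 = 0.
    have := xiM 1 1; rewrite !mulr1 mul1r => /esym/eqP.
    by rewrite -[X in _ == X]addr0 (inj_eq (addrI _)) => /eqP.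
  have x0 : xi 0 = 0.
    by have := xiL (-1) 0 0; rewrite scaler0 addr0 scaleN1r addNr.
  split=> [a b|e|a b]; first by have := xiL 1 a b; rewrite !scale1r.
    by have := xiL e 1 0; rewrite x0 !addr0 x1 scaler0.
  by rewrite xiM; ring.
have [E [hE Ej Ez]] := taylor_extend char0 T S xi_der.
have half2 : (2%:R^-1 : k) * 2%:R = 1 by rewrite mulVf // natk_neq0.
(* On coordinates with scalar bracket e the exactness identity reads 0 = e + 2 h e, whence h =
   -1/2. *)
pose h : A := (- 2%:R^-1 : k)%:A.
have hh : h + h = -1.
  rewrite -scalerDl; have -> : - 2%:R^-1 - 2%:R^-1 = - (2%:R^-1 * 2%:R) :> k by ring.
  by rewrite half2 scaleN1r.
pose X a := E a + h * euler z D a.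
have hX : der X.
  apply: der_add => //; apply: der_mull; apply: euler_der; exact: partial_der.
have Xj (b : B) : X (val b) = val (xi b).
  rewrite /X Ej /euler big1 ?mulr0 ?addr0 // => i _.
  by rewrite (tl_Dj T) mulr0.
have Xz i : X (z i) = h * z i.
  by rewrite /X Ez add0r (euler_z (partial_z hz)).
clearbody X.
exists X; split; first exact: der_linear.
  by move=> a b; rewrite (derM hX); ring.
(* The defect of exactness is a skew biderivation, so it vanishes once it does on B and on the
   coordinates. *)
pose F a b := X {[a, b]} - {[a, b]} - {[X a, b]} - {[a, X b]}.
suff F0 a b : F a b = 0.
  move=> a b; apply/eqP; rewrite -subr_eq0; apply/eqP.
  by rewrite -[RHS](F0 a b) /F; ring.
have FC x y : F x y = - F y x.
  rewrite /F (poissonC x y) (derN hX) (poissonC (X x)) (poissonC x).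
  by ring.
have Fder x : der (F x).
  split=> [y y'|e|y y']; rewrite /F.
  - by rewrite !poissonDr !(derD hX) !poissonDr; ring.
  - by rewrite poissonZr poisson1r scaler0 (der0 hX) (derC hX) poissonZr poisson1r
      scaler0 poisson0r !subr0.
  rewrite (derM hX) !poissonDr !poissonMr (derD hX) !(derM hX).
  by ring.
have val_bracket (x y : B) : val {[x, y]} = {[val x, val y]} by [].
have Fjj (x y : B) : F (val x) (val y) = 0.
  rewrite /F !Xj -!val_bracket Xj xiP !(amD (tl_j T)).
  by ring.
have Fjz (x : B) i : F (val x) (z i) = 0.
  rewrite /F Xj Xz !centrP (der0 hX) poissonMr centrP mul0r addr0.
  by rewrite poissonZr poisson1r scaler0 mul0r !subr0.
have Fzz l i : F (z l) (z i) = 0.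
  have [e ze] := bracket_zz hz l i.
  have hr x : {[x, h]} = 0 by rewrite poissonZr poisson1r scaler0.
  rewrite /F !Xz ze (derC hX) poissonMl poissonMr (poissonC h) !hr oppr0 ze.
  rewrite !mul0r !add0r; apply/eqP.
  have -> : - e%:A - e%:A * h - e%:A * h = - e%:A * (1 + (h + h)) by ring.
  by rewrite hh subrr mulr0.
apply: (taylor_der0 T (Fder a)) => [y|i].
  rewrite FC; apply/eqP; rewrite oppr_eq0; apply/eqP.
  apply: (taylor_der0 T (Fder (val y))) => [x|l]; first exact: Fjj.
  exact: Fjz.
rewrite FC; apply/eqP; rewrite oppr_eq0; apply/eqP.
apply: (taylor_der0 T (Fder (z i))) => [x|l]; last exact: Fzz.
by rewrite FC Fjz oppr0.
Qed.

Lemma tau_poisson :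
  {morph s : x y / {[x, y]}} -> (forall (b : B) x, {[val b, s x]} = 0) ->
  {morph tau (val : B -> A) s : x y / {[x, y]}}.
Proof.
move=> sP comm x y; have tD := amD (tau_alg T S).
have t0 := am0 (tau_alg T S).
elim/tens_ind: x => [|x x' hx hx'|b e]; first by rewrite poisson0l t0 poisson0l.
  by rewrite poissonDl !tD hx hx' poissonDl.
elim/tens_ind: y => [|y y' hy hy'|b' e']; first by rewrite poisson0r t0 poisson0r.
  by rewrite poissonDr !tD hy hy' poissonDr.
rewrite tens_poisson tD !(tauE T S) poissonMl !poissonMr (amM (co_s S)) (amM (tl_j T)) sP.
rewrite (poissonC (s e) (val b')) !comm oppr0 -[val {[b, b']}]/{[val b, val b']}.
by ring.
Qed.

End Exact.

Theorem proposition3p3 (k : fieldType) (char0 : [pchar k] =i pred0)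
    (A : poissonAlgType k) (m : idealr A) (A_complete : complete_local m)
    (J : primePoissonIdeal A) (mJ : idealr (poisson_quot J))
    (quot_complete : complete_local mJ)
    (quot_regular : regular_local_at mJ)
    (quot_nondegenerate : nondegenerate_poisson mJ) :
  exists (B : poissonAlgType k) (mB : idealr B),
    [/\ complete_local mB,
        exists f : {lrmorphism A -> completed_tensor mB mJ},
          bijective f /\ (forall a b, f {[a, b]} = {[f a, f b]}),
        holonomic A <-> holonomic B &
        exact_poisson A <-> exact_poisson B].
Proof.
have [I [z [c [dual [hz hJ]]]]] := symplectic_exists char0 A_complete quot_complete
  quot_regular quot_nondegenerate.
have mJmax : maximal_ideal mJ by case: quot_complete => -[].
have hadic : @adic_complete A m A^o by case: A_complete.
have S := zsection_coordinates char0 A_complete hz mJmax hJ.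
have T := splitting_taylor char0 A_complete hz.
exists (centr z), (centr_ideal z m); split.
- exact: (centr_complete_local char0 A_complete hz).
- apply: (completion_isomorphism hadic (tau_alg T S)).
  + apply: (tau_poisson char0 A_complete hz S).
    * exact: (zsection_poisson char0 A_complete hz mJmax hJ).
    * by move=> b x; apply: (centr_zseries A_complete); apply: zsection_zseries.
  + exact: (tau_max T S).
  + exact: (tau_ipow_inv char0 T S).
  exact: (tau_dense T S).
- exact: (holonomic_iff char0 A_complete hz S).
exact: (exact_iff char0 A_complete hz S).
Qed.
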